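(* There is a unique Lie algebra morphism $\mathfrak{grt}_1\to\widehat{\mathfrak{grt}}{}_1^{ell}$, $\psi\mapsto(\psi,u_+^\psi,u_-^\psi)$, where $u_\pm^\psi:=D_\psi(x_1^\pm)$ and $D_\psi\in\mathrm{Der}(\hat{\mathfrak t}_{1,2})$ is defined by $$D_\psi(e^{x_1})=\psi^{0,2,1}e^{x_1}-e^{x_1}\psi^{0,1,2},\qquad D_\psi(t_{01})=[\psi^{0,1,2},t_{01}],$$ with $\psi^{0,1,2}=\psi(t_{01},t_{12})$, $\psi^{0,2,1}=\psi(t_{02},t_{21})$, $t_{0i}=-\frac{\mathrm{ad}x_i}{e^{\mathrm{ad}x_i}-1}(y_i)$ ($i=1,2$). It extends to a Lie algebra morphism $\mathfrak{grt}\to\widehat{\mathfrak{grt}}_{ell}$ by $1\mapsto e_{22}$. This morphism is homogeneous, $\mathfrak{grt}$ being equipped with its degree and $\widehat{\mathfrak{grt}}_{ell}$ with the degree $\deg_-$.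
   Context: All Lie algebras are over $\mathbb Q$. $\mathfrak t_n$: generators $t_{ij}=t_{ji}$ ($1\le i\ne j\le n$), relations $[t_{ij},t_{ik}+t_{jk}]=0$, $[t_{ij},t_{kl}]=0$ for distinct indices. $\mathfrak t_{1,n}$: generators $x_i^\pm$, relations $\sum_ix_i^\pm=0$, $[x_i^\pm,x_j^\pm]=0$ and $[x_i^+,x_j^-]=[x_j^+,x_i^-]$ ($i\ne j$), $[x_k^\pm,[x_i^+,x_j^-]]=0$ ($i,j,k$ distinct). $x_i=x_i^+,y_i=x_i^-$; hats are degree completions ($\deg x_i^\pm=1$). $\mathfrak t_n\to\mathfrak t_{1,n}$ is $t_{ij}\mapsto[x_i^+,x_j^-]=:t_{ij}$. For disjoint $I_1,\dots,I_n\subset\{1,\dots,p\}$, $x\mapsto x^{I_1,\dots,I_n}$ is $\mathfrak t_n\to\mathfrak t_p$, $t_{ij}\mapsto\sum_{a\in I_i,b\in I_j}t_{ab}$, and, when the $I_i$ partition $\{1,\dots,p\}$, $\mathfrak t_{1,n}\to\mathfrak t_{1,p}$, $x_i^\pm\mapsto\sum_{a\in I_i}x_a^\pm$. $\mathfrak f_2$ is free on $A,B$, embedded in $\mathfrak t_3$ by $A\mapsto t_{12},B\mapsto t_{23}$. $\mathfrak t_{1,2}$ is free on $x_1,y_1$, and $\hat{\mathfrak t}_{1,2}$ is topologically free on $x_1,t_{01}$; $D(e^{x_1})$ is computed in the completed enveloping algebra. $\mathfrak{grt}_1=\{\psi\in\mathfrak f_2\mid\psi+\psi^{3,2,1}=0,\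 \psi+\psi^{2,3,1}+\psi^{3,1,2}=0,\ [t_{23},\psi^{1,2,3}]+[t_{13},\psi^{2,1,3}]=0,\ \psi^{2,3,4}-\psi^{12,3,4}+\psi^{1,23,4}-\psi^{1,2,34}+\psi^{1,2,3}=0\}$, with bracket $\langle\psi_1,\psi_2\rangle=[\psi_1,\psi_2]+D_{\psi_2}(\psi_1)-D_{\psi_1}(\psi_2)$, where here $D_\psi\in\mathrm{Der}(\mathfrak f_2)$ is $A\mapsto[\psi,A],B\mapsto0$. $\mathfrak{grt}=\mathfrak{grt}_1\rtimes\mathbb Q$ with $[1,\psi]=-(\deg\psi)\psi$ ($\deg A=\deg B=1$; $\mathbb Q$ in degree $0$). $\mathfrak{grt}_1^{ell}$ is the set of $(\psi,\alpha_+,\alpha_-)\in\mathfrak{grt}_1\times(\mathfrak t_{1,2})^2$ such that in $\mathfrak t_{1,3}$: $\alpha_\pm^{1,23}+\alpha_\pm^{2,31}+\alpha_\pm^{3,12}+[x_1^\pm,\psi^{1,2,3}]+[x_2^\pm,\psi^{2,1,3}]=0$; $[x_1^\pm,\alpha_\pm^{3,12}]+[\alpha_\pm^{1,23},x_3^\pm]-[x_1^\pm,[x_3^\pm,\psi^{1,2,3}]]=0$; $[x_1^+,\alpha_-^{2,13}]-[x_2^-,\alpha_+^{1,23}]=[x_2^-,[x_1^+,\psi^{1,2,3}]]-[x_1^+,[x_2^-,\psi^{2,1,3}]]$. Bracket: $[(\psi,\alpha_\pm),(\psi',\alpha'_\pm)]=(\langle\psi,\psi'\rangle,D_{\alpha'_\pm}(\alpha_\pm)-D_{\alpha_\pm}(\alpha'_\pm))$,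 where $D_{\alpha_\pm}\in\mathrm{Der}(\mathfrak t_{1,2})$ is $x_1^\pm\mapsto\alpha_\pm$. $\mathfrak{grt}_{ell}=\mathfrak{grt}_1^{ell}\rtimes\mathbb Qe_{22}$ with $[e_{22},(\psi,\alpha_+,\alpha_-)]=(-(\deg\psi)\psi,-(\deg_-\alpha_+)\alpha_+,(1-\deg_-\alpha_-)\alpha_-)$, where on $\mathfrak t_{1,2}$, $\deg_-x_1^+=0$, $\deg_-x_1^-=1$. $\mathfrak{grt}_{ell}$ is $\mathbb N$-graded: $(\psi,\alpha_\pm)$ has degree $n$ if $2\deg\psi=\deg\alpha_\pm-1=n$, and $e_{22}$ has degree $0$; hats denote completions for this degree. The degree $\deg_-$ on $\mathfrak{grt}_{ell}$: $(\psi,\alpha_+,\alpha_-)$ has $\deg_-=q$ if $\deg\psi=q$ and the derivation $D_{\alpha_\pm}$ raises the degree $\deg_-$ of $\mathfrak t_{1,2}$ by $q$; $\deg_-e_{22}=0$. *)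

(* Defs.v *)
From HB Require Import structures.
From mathcomp Require Import all_boot all_order all_algebra.
From mathcomp Require Import boolp functions zify ring.

Set Implicit Arguments.
Unset Strict Implicit.
Unset Printing Implicit Defensive.

Import GRing.Theory.
Local Open Scope ring_scope.
Local Open Scope quotient_scope.

Reserved Notation "<[ x , y ]>" (format "<[ x ,  y ]>").

HB.mixin Record isLie (L : Type) of GRing.Lmodule rat L := {
  lbra : L -> L -> L;
  lbra_linl : forall y, linear (lbra^~ y);
  lbra_linr : forall x, linear (lbra x);
  lbraxx : forall x, lbra x x = 0;
  lbra_jacobi : forall x y z,
    lbra x (lbra y z) + lbra y (lbra z x) + lbra z (lbra x y) = 0
}.

#[short(type="lieType")]
HB.structure Definition Lie := {L of GRing.Lmodule rat L & isLie L}.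

Notation "<[ x , y ]>" := (lbra x y) : ring_scope.

Section LieTheory.
Variable L : lieType.
Implicit Types x y z : L.

Lemma lbraDl x y z : <[x + y, z]> = <[x, z]> + <[y, z]>.
Proof. by have := lbra_linl z 1 x y; rewrite !scale1r. Qed.
Lemma lbraDr x y z : <[x, y + z]> = <[x, y]> + <[x, z]>.
Proof. by have := lbra_linr x 1 y z; rewrite !scale1r. Qed.
Lemma lbra0x x : <[0, x]> = 0.
Proof. by apply: (addrI <[0, x]>); rewrite -lbraDl !addr0. Qed.
Lemma lbrax0 x : <[x, 0]> = 0.
Proof. by apply: (addrI <[x, 0]>); rewrite -lbraDr !addr0. Qed.
Lemma lbraZl a x y : <[a *: x, y]> = a *: <[x, y]>.
Proof. by have := lbra_linl y a x 0; rewrite !addr0 lbra0x addr0. Qed.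
Lemma lbraZr a x y : <[x, a *: y]> = a *: <[x, y]>.
Proof. by have := lbra_linr x a y 0; rewrite !addr0 lbrax0 addr0. Qed.
Lemma lbraNl x y : <[- x, y]> = - <[x, y]>.
Proof. by rewrite -scaleN1r lbraZl scaleN1r. Qed.
Lemma lbraNr x y : <[x, - y]> = - <[x, y]>.
Proof. by rewrite -scaleN1r lbraZr scaleN1r. Qed.
Lemma lbraC x y : <[x, y]> = - <[y, x]>.
Proof.
apply/eqP; rewrite -addr_eq0; apply/eqP.
by have := lbraxx (x + y); rewrite lbraDl !lbraDr !lbraxx addr0 add0r.
Qed.
Lemma lbra_suml I (r : seq I) (P : pred I) (F : I -> L) y :
  <[\sum_(i <- r | P i) F i, y]> = \sum_(i <- r | P i) <[F i, y]>.
Proof.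
by elim/big_rec2: _ => [|i u v _ IH]; rewrite ?lbra0x // lbraDl IH.
Qed.
Lemma lbra_sumr I (r : seq I) (P : pred I) (F : I -> L) y :
  <[y, \sum_(i <- r | P i) F i]> = \sum_(i <- r | P i) <[y, F i]>.
Proof.
by elim/big_rec2: _ => [|i u v _ IH]; rewrite ?lbrax0 // lbraDr IH.
Qed.
End LieTheory.

Inductive lterm (G : Type) : Type :=
| LGen of G
| LZero
| LAdd of lterm G & lterm G
| LScale of rat & lterm G
| LBra of lterm G & lterm G.
Arguments LZero {G}.

HB.instance Definition _ (G : Type) := gen_eqMixin (lterm G).
HB.instance Definition _ (G : Type) := gen_choiceMixin (lterm G).

Section Presentation.
Variables (G : Type) (R : lterm G -> lterm G -> Prop).
Implicit Types s t u : lterm G.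

Inductive lcong : lterm G -> lterm G -> Prop :=
| LC_rel s t of R s t : lcong s t
| LC_refl s : lcong s s
| LC_sym s t of lcong s t : lcong t s
| LC_trans s t u of lcong s t & lcong t u : lcong s u
| LC_add s s' t t' of lcong s s' & lcong t t' :
    lcong (LAdd s t) (LAdd s' t')
| LC_scale a s s' of lcong s s' : lcong (LScale a s) (LScale a s')
| LC_bra s s' t t' of lcong s s' & lcong t t' :
    lcong (LBra s t) (LBra s' t')
| LC_addA s t u : lcong (LAdd s (LAdd t u)) (LAdd (LAdd s t) u)
| LC_addC s t : lcong (LAdd s t) (LAdd t s)
| LC_add0 s : lcong (LAdd LZero s) s
| LC_addN s : lcong (LAdd (LScale (-1) s) s) LZero
| LC_scaleA a b s : lcong (LScale a (LScale b s)) (LScale (a * b) s)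
| LC_scale1 s : lcong (LScale 1 s) s
| LC_scaleDr a s t :
    lcong (LScale a (LAdd s t)) (LAdd (LScale a s) (LScale a t))
| LC_scaleDl a b s :
    lcong (LScale (a + b) s) (LAdd (LScale a s) (LScale b s))
| LC_braDl s t u : lcong (LBra (LAdd s t) u) (LAdd (LBra s u) (LBra t u))
| LC_braDr s t u : lcong (LBra s (LAdd t u)) (LAdd (LBra s t) (LBra s u))
| LC_braZl a s t : lcong (LBra (LScale a s) t) (LScale a (LBra s t))
| LC_braZr a s t : lcong (LBra s (LScale a t)) (LScale a (LBra s t))
| LC_braxx s : lcong (LBra s s) LZero
| LC_jacobi s t u :
    lcong (LAdd (LAdd (LBra s (LBra t u)) (LBra t (LBra u s)))
                (LBra u (LBra s t))) LZero.

Definition lcongb : rel (lterm G) := fun s t => `[< lcong s t >].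

Fact lcongb_refl : reflexive lcongb.
Proof. by move=> s; apply/asboolP/LC_refl. Qed.
Fact lcongb_sym : symmetric lcongb.
Proof. by move=> s t; apply/asboolP/asboolP; apply: LC_sym. Qed.
Fact lcongb_trans : transitive lcongb.
Proof.
by move=> t s u /asboolP st /asboolP tu; apply/asboolP/(LC_trans st tu).
Qed.

Canonical lcong_equiv := EquivRel lcongb lcongb_refl lcongb_sym lcongb_trans.

Definition presLie := {eq_quot lcong_equiv}.
HB.instance Definition _ := Choice.on presLie.
HB.instance Definition _ := EqQuotient.on presLie.

Definition lclass (s : lterm G) : presLie := \pi_presLie s.

Lemma lclassP s t : lclass s = lclass t <-> lcong s t.
Proof.
by split=> [/eqmodP/asboolP //|st]; apply/eqmodP/asboolP.
Qed.

Lemma lcong_repr s : lcong (repr (lclass s)) s.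
Proof. by apply/lclassP; rewrite /lclass reprK. Qed.

Lemma lclassK x : lclass (repr x) = x.
Proof. by rewrite /lclass reprK. Qed.

Definition ladd (x y : presLie) := lclass (LAdd (repr x) (repr y)).
Definition lscale (a : rat) (x : presLie) := lclass (LScale a (repr x)).
Definition lbracket (x y : presLie) := lclass (LBra (repr x) (repr y)).

Lemma laddE s t : ladd (lclass s) (lclass t) = lclass (LAdd s t).
Proof. by apply/lclassP/LC_add; apply: lcong_repr. Qed.
Lemma lscaleE a s : lscale a (lclass s) = lclass (LScale a s).
Proof. by apply/lclassP/LC_scale; apply: lcong_repr. Qed.
Lemma lbracketE s t : lbracket (lclass s) (lclass t) = lclass (LBra s t).
Proof. by apply/lclassP/LC_bra; apply: lcong_repr. Qed.

Lemma lclassW (P : presLie -> Prop) : (forall s, P (lclass s)) -> forall x, P x.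
Proof. by move=> H x; rewrite -[x]lclassK. Qed.

Fact laddA : associative ladd.
Proof.
elim/lclassW=> s; elim/lclassW=> t; elim/lclassW=> u.
by rewrite !laddE; apply/lclassP/LC_addA.
Qed.
Fact laddC : commutative ladd.
Proof.
elim/lclassW=> s; elim/lclassW=> t.
by rewrite !laddE; apply/lclassP/LC_addC.
Qed.
Fact ladd0 : left_id (lclass LZero) ladd.
Proof. by elim/lclassW=> s; rewrite !laddE; apply/lclassP/LC_add0. Qed.
Fact laddN : left_inverse (lclass LZero) (lscale (-1)) ladd.
Proof.
by elim/lclassW=> s; rewrite lscaleE laddE; apply/lclassP/LC_addN.
Qed.

HB.instance Definition _ := GRing.isZmodule.Build presLie laddA laddC ladd0 laddN.

Let addE (x y : presLie) : x + y = ladd x y. Proof. by []. Qed.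

Fact lscaleA a b x : lscale a (lscale b x) = lscale (a * b) x.
Proof.
by elim/lclassW: x => s; rewrite !lscaleE; apply/lclassP/LC_scaleA.
Qed.
Fact lscale1 : left_id 1 lscale.
Proof. by elim/lclassW=> s; rewrite !lscaleE; apply/lclassP/LC_scale1. Qed.
Fact lscaleDr : right_distributive lscale +%R.
Proof.
move=> a; elim/lclassW=> s; elim/lclassW=> t.
by rewrite !addE (laddE s t) (lscaleE a s) (lscaleE a t) lscaleE laddE; apply/lclassP/LC_scaleDr.
Qed.
Fact lscaleDl x : {morph lscale^~ x : a b / a + b}.
Proof.
move=> a b; elim/lclassW: x => s.
rewrite addE (lscaleE a s) (lscaleE b s) lscaleE laddE.
exact/lclassP/LC_scaleDl.
Qed.

HB.instance Definition _ :=
  GRing.Zmodule_isLmodule.Build rat presLie lscaleA lscale1 lscaleDr lscaleDl.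

Let scaleE a (x : presLie) : a *: x = lscale a x. Proof. by []. Qed.

Fact lbracket_linl y : linear (lbracket^~ y).
Proof.
move=> a; elim/lclassW: y => u; elim/lclassW=> s; elim/lclassW=> t.
rewrite !scaleE !addE (lscaleE a s) (laddE _ t) (lbracketE s) (lbracketE t).
rewrite (lscaleE a) laddE lbracketE; apply/lclassP.
apply: LC_trans (LC_braDl _ _ _) (LC_add (LC_braZl _ _ _) (LC_refl _)).
Qed.
Fact lbracket_linr x : linear (lbracket x).
Proof.
move=> a; elim/lclassW: x => u; elim/lclassW=> s; elim/lclassW=> t.
rewrite !scaleE !addE (lscaleE a s) (laddE _ t) (lbracketE _ s) (lbracketE _ t).
rewrite (lscaleE a) laddE lbracketE; apply/lclassP.
apply: LC_trans (LC_braDr _ _ _) (LC_add (LC_braZr _ _ _) (LC_refl _)).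
Qed.
Fact lbracketxx x : lbracket x x = 0.
Proof.
by elim/lclassW: x => s; rewrite lbracketE; apply/lclassP/LC_braxx.
Qed.
Fact lbracket_jacobi x y z : lbracket x (lbracket y z)
  + lbracket y (lbracket z x) + lbracket z (lbracket x y) = 0.
Proof.
elim/lclassW: x => s; elim/lclassW: y => t; elim/lclassW: z => u.
rewrite !addE (lbracketE t) (lbracketE u s) (lbracketE s t) !lbracketE !laddE.
exact/lclassP/LC_jacobi.
Qed.

HB.instance Definition _ := isLie.Build presLie
  lbracket_linl lbracket_linr lbracketxx lbracket_jacobi.

Definition lgen (g : G) : presLie := lclass (LGen g).

Lemma lclass_zero : lclass LZero = 0. Proof. by []. Qed.
Lemma lclass_add s t : lclass (LAdd s t) = lclass s + lclass t.
Proof. by rewrite -laddE. Qed.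
Lemma lclass_scale a s : lclass (LScale a s) = a *: lclass s.
Proof. by rewrite -lscaleE. Qed.
Lemma lclass_bra s t : lclass (LBra s t) = <[lclass s, lclass t]>.
Proof. by rewrite -lbracketE. Qed.
Lemma lclass_rel s t : R s t -> lclass s = lclass t.
Proof. by move=> st; apply/lclassP/LC_rel. Qed.

End Presentation.

Definition lclassE := (lclass_zero, lclass_add, lclass_scale, lclass_bra).

(* Morphisms and derivations out of a presented Lie algebra, given by the
   images of the generators. Both are computed on a representing term; they
   do not depend on its choice as soon as the images satisfy the relations
   (lextP, derP). *)

Fixpoint leval (G : Type) (L : lieType) (a : G -> L) (t : lterm G) : L :=
  match t with
  | LGen g => a g
  | LZero => 0
  | LAdd s t => leval a s + leval a t
  | LScale c s => c *: leval a s
  | LBra s t => <[leval a s, leval a t]>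
  end.

Fixpoint lderiv (G : Type) (L : lieType) (x a : G -> L) (t : lterm G) : L :=
  match t with
  | LGen g => a g
  | LZero => 0
  | LAdd s t => lderiv x a s + lderiv x a t
  | LScale c s => c *: lderiv x a s
  | LBra s t => <[lderiv x a s, leval x t]> + <[leval x s, lderiv x a t]>
  end.

Definition lie_morphism (L M : lieType) (f : L -> M) : Prop :=
  linear f /\ forall x y, f <[x, y]> = <[f x, f y]>.

Definition is_derivation (L : lieType) (D : L -> L) : Prop :=
  linear D /\ forall x y, D <[x, y]> = <[D x, y]> + <[x, D y]>.

Section Extension.
Variables (G : Type) (R : lterm G -> lterm G -> Prop).

Definition lext (L : lieType) (a : G -> L) (x : presLie R) : L :=
  leval a (repr x).

Definition der (a : G -> presLie R) (x : presLie R) : presLie R :=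
  lderiv (@lgen G R) a (repr x).

Lemma leval_cong (L : lieType) (a : G -> L) s t :
  (forall u v, R u v -> leval a u = leval a v) ->
  lcong R s t -> leval a s = leval a t.
Proof.
move=> aR; elim=> //=.
- by move=> ? ? ? _ -> _ ->.
- by move=> ? ? ? ? _ -> _ ->.
- by move=> ? ? ? _ ->.
- by move=> ? ? ? ? _ -> _ ->.
- by move=> *; rewrite addrA.
- by move=> *; rewrite addrC.
- by move=> *; rewrite add0r.
- by move=> *; rewrite scaleN1r addNr.
- by move=> *; rewrite scalerA.
- by move=> *; rewrite scale1r.
- by move=> *; rewrite scalerDr.
- by move=> *; rewrite scalerDl.
- by move=> *; rewrite lbraDl.
- by move=> *; rewrite lbraDr.
- by move=> *; rewrite lbraZl.
- by move=> *; rewrite lbraZr.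
- by move=> *; rewrite lbraxx.
- by move=> *; rewrite lbra_jacobi.
Qed.

Lemma leval_lgen t : leval (@lgen G R) t = lclass R t.
Proof. by elim: t => //= *; rewrite lclassE; congr (_ _ _). Qed.

Lemma lextE (L : lieType) (a : G -> L) t :
  (forall u v, R u v -> leval a u = leval a v) ->
  lext a (lclass R t) = leval a t.
Proof. by move=> aR; apply: leval_cong (lcong_repr _ _). Qed.

Lemma lextP (L : lieType) (a : G -> L) :
  (forall u v, R u v -> leval a u = leval a v) ->
  lie_morphism (lext a) /\ forall g, lext a (lgen R g) = a g.
Proof.
move=> aR; split; last by move=> g; rewrite /lgen lextE.
split=> [c|]; elim/lclassW=> s; elim/lclassW=> t.
  by rewrite -lclass_scale -lclass_add !lextE.
by rewrite -lclass_bra !lextE.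
Qed.

Lemma lderiv_cong (a : G -> presLie R) s t :
  (forall u v, R u v -> lderiv (@lgen G R) a u = lderiv (@lgen G R) a v) ->
  lcong R s t -> lderiv (@lgen G R) a s = lderiv (@lgen G R) a t.
Proof.
move=> aR.
pose e := @leval_lgen; pose d := lderiv (@lgen G R) a.
elim=> //=.
- by move=> ? ? ? _ -> _ ->.
- by move=> ? ? ? ? _ -> _ ->.
- by move=> ? ? ? _ ->.
- move=> s1 s2 t1 t2 c1 -> c2 ->; rewrite !e.
  by have /lclassP -> := c1; have /lclassP -> := c2.
- by move=> *; rewrite addrA.
- by move=> *; rewrite addrC.
- by move=> *; rewrite add0r.
- by move=> *; rewrite scaleN1r addNr.
- by move=> *; rewrite scalerA.
- by move=> *; rewrite scale1r.
- by move=> *; rewrite scalerDr.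
- by move=> *; rewrite scalerDl.
- by move=> *; rewrite !lbraDl addrACA.
- by move=> *; rewrite !lbraDr addrACA.
- by move=> *; rewrite !lbraZl scalerDr.
- by move=> *; rewrite !lbraZr scalerDr.
- by move=> u; rewrite [X in X + _]lbraC addNr.
- move=> u v w; rewrite !lbraDr.
  set x := leval _ u; set y := leval _ v; set z := leval _ w.
  set dx := lderiv _ _ u; set dy := lderiv _ _ v; set dz := lderiv _ _ w.
  have jx := lbra_jacobi dx y z; have jy := lbra_jacobi x dy z.
  have jz := lbra_jacobi x y dz.
  transitivity ((<[dx, <[y, z]>]> + <[y, <[z, dx]>]> + <[z, <[dx, y]>]>)
     + (<[x, <[dy, z]>]> + <[dy, <[z, x]>]> + <[z, <[x, dy]>]>)
     + (<[x, <[y, dz]>]> + <[y, <[dz, x]>]> + <[dz, <[x, y]>]>)); last first.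
    by rewrite jx jy jz !addr0.
  rewrite -!addrA.
  congr (_ + _).
  by rewrite !addrA [LHS](ACl (5*7*1*3*8*2*4*6)%AC).
Qed.

Lemma derE (a : G -> presLie R) t :
  (forall u v, R u v -> lderiv (@lgen G R) a u = lderiv (@lgen G R) a v) ->
  der a (lclass R t) = lderiv (@lgen G R) a t.
Proof. by move=> aR; apply: lderiv_cong (lcong_repr _ _). Qed.

Lemma derP (a : G -> presLie R) :
  (forall u v, R u v -> lderiv (@lgen G R) a u = lderiv (@lgen G R) a v) ->
  is_derivation (der a) /\ forall g, der a (lgen R g) = a g.
Proof.
move=> aR; split; last by move=> g; rewrite /lgen derE.
split=> [c|]; elim/lclassW=> s; elim/lclassW=> t.
  by rewrite -lclass_scale -lclass_add !derE.
by rewrite -lclass_bra !derE //= !leval_lgen.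
Qed.

End Extension.

(* Graded pieces and degree completions. The completion of the graded module
   with pieces g 0, g 1, ... is the product of the pieces. *)

Record grading (V : lmodType rat) := Grading {
  gpart :> nat -> V -> Prop;
  gpart0 : forall d, gpart d 0;
  gpartD : forall d x y, gpart d x -> gpart d y -> gpart d (x + y);
  gpartZ : forall d a x, gpart d x -> gpart d (a *: x)
}.

Record lieGrading (L : lieType) := LieGrading {
  lgrad :> grading L;
  gpart_bra : forall m n x y,
    lgrad m x -> lgrad n y -> lgrad (m + n)%N <[x, y]>
}.

Record algGrading (A : algType rat) := AlgGrading {
  agrad :> grading A;
  gpart_one : agrad 0%N 1;
  gpart_mul : forall m n x y,
    agrad m x -> agrad n y -> agrad (m + n)%N (x * y)
}.

Lemma gpart_sum (V : lmodType rat) (g : grading V) d I (r : seq I) (F : I -> V) :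
  (forall i, g d (F i)) -> g d (\sum_(i <- r) F i).
Proof. by move=> gF; elim/big_rec: _ => [|i x _]; [exact: gpart0|exact: gpartD]. Qed.

Section Completion.
Variables (V : lmodType rat) (g : grading V).

Definition compl_pred : pred (nat -> V) := fun f => `[< forall d, g d (f d) >].

Record compl := Compl { cval :> nat -> V; _ : cval \in compl_pred }.

HB.instance Definition _ := [isSub for cval].
HB.instance Definition _ := [Choice of compl by <:].

Fact compl_closed : subsemimod_closed compl_pred.
Proof.
split=> [|a f /asboolP gf]; last by apply/asboolP=> d; apply: gpartZ.
split=> [|f h /asboolP gf /asboolP gh]; apply/asboolP=> d.
  exact: gpart0.
exact: gpartD.
Qed.
HB.instance Definition _ :=
  GRing.SubChoice_isSubLmodule.Build rat (nat -> V) compl_pred compl compl_closed.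

Lemma complP (f : compl) d : g d (f d).
Proof. by case: f => f /= /asboolP. Qed.

Definition mkcompl (f : nat -> V) (gf : forall d, g d (f d)) : compl :=
  Compl (introT (asboolP _) gf).

Lemma compl_ext (f h : compl) : (forall d, f d = h d) -> f = h.
Proof. by move=> fh; apply/val_inj/funext. Qed.

Lemma complD (f h : compl) d : (f + h) d = f d + h d. Proof. by []. Qed.
Lemma complZ a (f : compl) d : (a *: f) d = a *: f d. Proof. by []. Qed.
Lemma complN (f : compl) d : (- f) d = - f d. Proof. by []. Qed.
Lemma compl0 d : (0 : compl) d = 0. Proof. by []. Qed.

Fact csingle_subproof d x (gx : g d x) e : g e (if e == d then x else 0).
Proof. by case: eqP => [->|_] //; exact: gpart0. Qed.

(* A homogeneous element, seen in the completion. *)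
Definition csingle d x (gx : g d x) : compl := mkcompl (csingle_subproof gx).

End Completion.

(* Continuity for the filtration by degree. *)
Definition ccontinuous (V W : lmodType rat) (g : grading V) (h : grading W)
    (D : compl g -> compl h) : Prop :=
  forall n, exists m, forall f : compl g,
    (forall d, (d < m)%N -> f d = 0) -> forall d, (d < n)%N -> D f d = 0.

Definition cauchy (V : zmodType) (op : V -> V -> V) (f h : nat -> V) (d : nat) : V :=
  \sum_(i < d.+1) op (f i) (h (d - i)%N).

Section Cauchy.
Variable V : zmodType.

Definition csum3 (T : nat -> nat -> nat -> V) d :=
  \sum_(i < d.+1) \sum_(j < d.+1) \sum_(k < d.+1)
     if (i + j + k == d)%N then T i j k else 0.

Lemma csum3E T d : csum3 T d =
  \sum_(i < d.+1) \sum_(j < (d - i).+1) T i j (d - i - j)%N.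
Proof.
apply: eq_bigr => i _.
have le_d : ((d - i).+1 <= d.+1)%N by rewrite ltnS leq_subr.
rewrite (big_ord_widen _ (fun j => T i j (d - i - j)%N) le_d) [RHS]big_mkcond.
apply: eq_bigr => j _; have := ltn_ord i; rewrite !ltnS => le_id.
case: leqP => [le_jd|lt_dj]; last first.
  by rewrite big1 // => k _; case: eqP => // e; exfalso; lia.
have lt_k : (d - i - j < d.+1)%N by lia.
rewrite (bigD1 (Ordinal lt_k)) //= big1 ?addr0 => [|k /eqP kN].
  by rewrite ifT //; apply/eqP; lia.
by case: eqP => // e; case: kN; apply/val_inj => /=; lia.
Qed.

Lemma csum3C T d : csum3 T d = csum3 (fun k i j => T i j k) d.
Proof.
rewrite /csum3.
under eq_bigr do rewrite exchange_big.
rewrite exchange_big; apply: eq_bigr => k _; apply: eq_bigr => i _.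
by apply: eq_bigr => j _; have -> : (k + i + j = i + j + k)%N by lia.
Qed.

Lemma csum3D T U d :
  csum3 T d + csum3 U d = csum3 (fun i j k => T i j k + U i j k) d.
Proof.
rewrite /csum3 -big_split; apply: eq_bigr => i _; rewrite -big_split.
apply: eq_bigr => j _; rewrite -big_split; apply: eq_bigr => k _ /=.
by case: ifP; rewrite ?addr0.
Qed.

Lemma cauchy_rev (op : V -> V -> V) f h d :
  cauchy op f h d = \sum_(i < d.+1) op (f (d - i)%N) (h i).
Proof.
rewrite /cauchy (reindex_inj rev_ord_inj); apply: eq_bigr => i _ /=.
by rewrite subSS subKn // -ltnS.
Qed.
End Cauchy.

Section LieCompletion.
Variables (L : lieType) (g : lieGrading L).

Fact cbra_subproof (f h : compl g) d : g d (cauchy (@lbra L) f h d).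
Proof.
apply: gpart_sum => i; have := gpart_bra (complP f i) (complP h (d - i)).
by rewrite subnKC // -ltnS.
Qed.

Definition cbra (f h : compl g) : compl g := mkcompl (cbra_subproof f h).

Fact cbra_linl h : linear (cbra^~ h).
Proof.
move=> a f f'; apply: compl_ext => d; rewrite complD complZ /= /cauchy.
rewrite scaler_sumr -big_split; apply: eq_bigr => i _ /=.
by rewrite lbraDl lbraZl.
Qed.
Fact cbra_linr f : linear (cbra f).
Proof.
move=> a h h'; apply: compl_ext => d; rewrite complD complZ /= /cauchy.
rewrite scaler_sumr -big_split; apply: eq_bigr => i _ /=.
by rewrite lbraDr lbraZr.
Qed.
Fact cbraxx f : cbra f f = 0.
Proof.
apply: compl_ext => d /=; set x := cauchy _ _ _ _.
have xN : x = - x.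
  rewrite {1}/x cauchy_rev /x /cauchy -sumrN; apply: eq_bigr => i _.
  exact: lbraC.
have : 2%:R *: x = 0 by rewrite scaler_nat mulr2n {1}xN addNr.
by move/eqP; rewrite scaler_eq0 /= => /eqP.
Qed.
Fact cbra_jacobi f h k : cbra f (cbra h k) + cbra h (cbra k f) + cbra k (cbra f h) = 0.
Proof.
have E u v w d : cbra u (cbra v w) d =
    csum3 (fun i j k => <[u i, <[v j, w k]>]>) d.
  by rewrite csum3E; apply: eq_bigr => i _; rewrite /= /cauchy lbra_sumr.
apply: compl_ext => d; rewrite !complD !E.
rewrite [X in _ + X + _]csum3C.
rewrite [X in _ + X]csum3C [X in _ + X]csum3C !csum3D.
by rewrite /csum3 !big1 // => i _; rewrite big1 // => j _; rewrite big1 // => l _;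
  case: ifP => // _; rewrite lbra_jacobi.
Qed.

HB.instance Definition _ := isLie.Build (compl g)
  cbra_linl cbra_linr cbraxx cbra_jacobi.

End LieCompletion.

Section AlgCompletion.
Variables (A : algType rat) (g : algGrading A).

Fact cmul_subproof (f h : compl g) d : g d (cauchy *%R f h d).
Proof.
apply: gpart_sum => i; have := gpart_mul (complP f i) (complP h (d - i)).
by rewrite subnKC // -ltnS.
Qed.

Definition cmul (f h : compl g) : compl g := mkcompl (cmul_subproof f h).
Definition cone : compl g := csingle (gpart_one g).

Fact cmulA : associative cmul.
Proof.
have EC u v w d : cmul (cmul u v) w d = csum3 (fun k i j => u i * v j * w k) d.
  rewrite csum3E /= cauchy_rev; apply: eq_bigr => k _ /=.
  by rewrite /cauchy mulr_suml.
move=> u v w; apply: compl_ext => d; rewrite EC -csum3C csum3E.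
apply: eq_bigr => i _; rewrite mulr_sumr; apply: eq_bigr => j _.
by rewrite mulrA.
Qed.
Fact cmul1l : left_id cone cmul.
Proof.
move=> f; apply: compl_ext => d /=; rewrite /cauchy big_ord_recl /= mul1r subn0.
by rewrite big1 ?addr0 // => i _; rewrite mul0r.
Qed.
Fact cmul1r : right_id cone cmul.
Proof.
move=> f; apply: compl_ext => d /=; rewrite cauchy_rev big_ord_recl /= mulr1 subn0.
by rewrite big1 ?addr0 // => i _; rewrite mulr0.
Qed.
Fact cmulDl : left_distributive cmul +%R.
Proof.
move=> f h k; apply: compl_ext => d; rewrite complD /= /cauchy -big_split.
by apply: eq_bigr => i _; rewrite /= -mulrDl.
Qed.
Fact cmulDr : right_distributive cmul +%R.
Proof.
move=> f h k; apply: compl_ext => d; rewrite complD /= /cauchy -big_split.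
by apply: eq_bigr => i _; rewrite /= -mulrDr.
Qed.
Fact cone_neq0 : cone != 0.
Proof. by apply/eqP=> /(congr1 (fun f : compl g => f 0%N))/eqP; rewrite /= oner_eq0. Qed.

HB.instance Definition _ := GRing.Zmodule_isNzRing.Build (compl g)
  cmulA cmul1l cmul1r cmulDl cmulDr cone_neq0.

Fact cmulZl a (u v : compl g) : a *: (u * v) = (a *: u) * v.
Proof.
apply: compl_ext => d; rewrite complZ /= /cauchy scaler_sumr.
by apply: eq_bigr => i _; rewrite scalerAl.
Qed.
HB.instance Definition _ := GRing.Lmodule_isLalgebra.Build rat (compl g) cmulZl.
Fact cmulZr a (u v : compl g) : a *: (u * v) = u * (a *: v).
Proof.
apply: compl_ext => d; rewrite complZ /= /cauchy scaler_sumr.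
by apply: eq_bigr => i _; rewrite scalerAr.
Qed.
HB.instance Definition _ := GRing.Lalgebra_isAlgebra.Build rat (compl g) cmulZr.

End AlgCompletion.

(* Grading of a Lie algebra by the degrees dg of a family of generators: the
   d-th piece is spanned by the brackets of generators of total degree d. *)
Section GeneratedGrading.
Variables (L : lieType) (G : Type) (gen : G -> L) (dg : G -> nat).

Inductive homog : nat -> L -> Prop :=
| homog_gen g : homog (dg g) (gen g)
| homog0 d : homog d 0
| homogD d x y of homog d x & homog d y : homog d (x + y)
| homogZ d a x of homog d x : homog d (a *: x)
| homog_bra m n x y of homog m x & homog n y : homog (m + n)%N <[x, y]>.

Definition gen_grading : lieGrading L :=
  @LieGrading L (Grading homog0 homogD homogZ) homog_bra.

End GeneratedGrading.

(* Integer degrees: the pieces of negative degree are zero. *)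
Definition gpartz (V : lmodType rat) (g : grading V) (q : int) (x : V) : Prop :=
  if q is Posz d then g d x else x = 0.

Section PresentedGrading.
Variables (G : Type) (R : lterm G -> lterm G -> Prop) (dg : G -> nat).

Definition pres_grading : lieGrading (presLie R) := gen_grading (@lgen G R) dg.

(* The natural map to the degree completion; its d-th entry is the
   homogeneous component of degree d. *)
Definition to_compl : presLie R -> compl pres_grading :=
  lext (fun g => csingle (homog_gen (@lgen G R) dg g : pres_grading _ _)).

(* The derivation multiplying an element of degree d by d. *)
Definition degop : presLie R -> presLie R :=
  der (fun g => (dg g)%:R *: lgen R g).

Lemma degopE d x :
  (forall u v, R u v ->
    lderiv (@lgen G R) (fun g => (dg g)%:R *: lgen R g) u =
    lderiv (@lgen G R) (fun g => (dg g)%:R *: lgen R g) v) ->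
  pres_grading d x -> degop x = d%:R *: x.
Proof.
move=> /derP[[lin leib] gens]; rewrite -/degop in lin leib gens.
have l0 : degop 0 = 0.
  by have /eqP := lin 1 0 0; rewrite !scale1r add0r -subr_eq0 opprD addrA subrr sub0r oppr_eq0 => /eqP.
elim=> {d x} [g|d|d x y _ IHx _ IHy|d a x _ IH|m n x y _ IHx _ IHy] //.
- by rewrite l0 scaler0.
- by have := lin 1 x y; rewrite !scale1r IHx IHy scalerDr.
- by have := lin a x 0; rewrite !addr0 l0 addr0 IH !scalerA mulrC.
- by rewrite leib IHx IHy lbraZl lbraZr -scalerDl natrD.
Qed.

End PresentedGrading.

Inductive aterm (L : Type) : Type :=
| AGen of L
| AZero
| AOne
| AAdd of aterm L & aterm L
| AScale of rat & aterm L
| AMul of aterm L & aterm L.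
Arguments AZero {L}.
Arguments AOne {L}.

HB.instance Definition _ (L : Type) := gen_eqMixin (aterm L).
HB.instance Definition _ (L : Type) := gen_choiceMixin (aterm L).

Section Enveloping.
Variable L : lieType.
Implicit Types s t u : aterm L.

Inductive acong : aterm L -> aterm L -> Prop :=
| AC_lin a x y : acong (AGen (a *: x + y)) (AAdd (AScale a (AGen x)) (AGen y))
| AC_bra x y : acong (AGen <[x, y]>)
    (AAdd (AMul (AGen x) (AGen y)) (AScale (-1) (AMul (AGen y) (AGen x))))
| AC_refl s : acong s s
| AC_sym s t of acong s t : acong t s
| AC_trans s t u of acong s t & acong t u : acong s u
| AC_add s s' t t' of acong s s' & acong t t' :
    acong (AAdd s t) (AAdd s' t')
| AC_scale a s s' of acong s s' : acong (AScale a s) (AScale a s')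
| AC_mul s s' t t' of acong s s' & acong t t' :
    acong (AMul s t) (AMul s' t')
| AC_addA s t u : acong (AAdd s (AAdd t u)) (AAdd (AAdd s t) u)
| AC_addC s t : acong (AAdd s t) (AAdd t s)
| AC_add0 s : acong (AAdd AZero s) s
| AC_addN s : acong (AAdd (AScale (-1) s) s) AZero
| AC_scaleA a b s : acong (AScale a (AScale b s)) (AScale (a * b) s)
| AC_scale1 s : acong (AScale 1 s) s
| AC_scaleDr a s t :
    acong (AScale a (AAdd s t)) (AAdd (AScale a s) (AScale a t))
| AC_scaleDl a b s :
    acong (AScale (a + b) s) (AAdd (AScale a s) (AScale b s))
| AC_mulA s t u : acong (AMul s (AMul t u)) (AMul (AMul s t) u)
| AC_mul1l s : acong (AMul AOne s) s
| AC_mul1r s : acong (AMul s AOne) s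
| AC_mulDl s t u : acong (AMul (AAdd s t) u) (AAdd (AMul s u) (AMul t u))
| AC_mulDr s t u : acong (AMul s (AAdd t u)) (AAdd (AMul s t) (AMul s u))
| AC_mulZl a s t : acong (AScale a (AMul s t)) (AMul (AScale a s) t)
| AC_mulZr a s t : acong (AScale a (AMul s t)) (AMul s (AScale a t)).

Definition acongb : rel (aterm L) := fun s t => `[< acong s t >].

Fact acongb_refl : reflexive acongb.
Proof. by move=> s; apply/asboolP/AC_refl. Qed.
Fact acongb_sym : symmetric acongb.
Proof. by move=> s t; apply/asboolP/asboolP; apply: AC_sym. Qed.
Fact acongb_trans : transitive acongb.
Proof.
by move=> t s u /asboolP st /asboolP tu; apply/asboolP/(AC_trans st tu).
Qed.

Canonical acong_equiv := EquivRel acongb acongb_refl acongb_sym acongb_trans.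

Definition Uenv := {eq_quot acong_equiv}.
HB.instance Definition _ := Choice.on Uenv.
HB.instance Definition _ := EqQuotient.on Uenv.

Definition aclass s : Uenv := \pi_Uenv s.

Lemma aclassP s t : aclass s = aclass t <-> acong s t.
Proof. by split=> [/eqmodP/asboolP //|st]; apply/eqmodP/asboolP. Qed.

Lemma acong_repr s : acong (repr (aclass s)) s.
Proof. by apply/aclassP; rewrite /aclass reprK. Qed.

Lemma aclassW (P : Uenv -> Prop) : (forall s, P (aclass s)) -> forall x, P x.
Proof. by move=> H x; rewrite -[x]reprK; apply: H. Qed.

Definition aadd (x y : Uenv) := aclass (AAdd (repr x) (repr y)).
Definition ascale (a : rat) (x : Uenv) := aclass (AScale a (repr x)).
Definition amul (x y : Uenv) := aclass (AMul (repr x) (repr y)).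

Lemma aaddE s t : aadd (aclass s) (aclass t) = aclass (AAdd s t).
Proof. by apply/aclassP/AC_add; apply: acong_repr. Qed.
Lemma ascaleE a s : ascale a (aclass s) = aclass (AScale a s).
Proof. by apply/aclassP/AC_scale; apply: acong_repr. Qed.
Lemma amulE s t : amul (aclass s) (aclass t) = aclass (AMul s t).
Proof. by apply/aclassP/AC_mul; apply: acong_repr. Qed.

Fact aaddA : associative aadd.
Proof.
elim/aclassW=> s; elim/aclassW=> t; elim/aclassW=> u.
by rewrite (aaddE t) (aaddE s t) !aaddE; apply/aclassP/AC_addA.
Qed.
Fact aaddC : commutative aadd.
Proof.
elim/aclassW=> s; elim/aclassW=> t.
by rewrite (aaddE s) (aaddE t); apply/aclassP/AC_addC.
Qed.
Fact aadd0 : left_id (aclass AZero) aadd.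
Proof. by elim/aclassW=> s; rewrite aaddE; apply/aclassP/AC_add0. Qed.
Fact aaddN : left_inverse (aclass AZero) (ascale (-1)) aadd.
Proof.
by elim/aclassW=> s; rewrite ascaleE aaddE; apply/aclassP/AC_addN.
Qed.
HB.instance Definition _ := GRing.isZmodule.Build Uenv aaddA aaddC aadd0 aaddN.

Let addE (x y : Uenv) : x + y = aadd x y. Proof. by []. Qed.

Fact ascaleA a b x : ascale a (ascale b x) = ascale (a * b) x.
Proof.
by elim/aclassW: x => s; rewrite (ascaleE b) !ascaleE; apply/aclassP/AC_scaleA.
Qed.
Fact ascale1 : left_id 1 ascale.
Proof. by elim/aclassW=> s; rewrite ascaleE; apply/aclassP/AC_scale1. Qed.
Fact ascaleDr : right_distributive ascale +%R.
Proof.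
move=> a; elim/aclassW=> s; elim/aclassW=> t.
rewrite !addE (aaddE s t) (ascaleE a s) (ascaleE a t) ascaleE aaddE.
exact/aclassP/AC_scaleDr.
Qed.
Fact ascaleDl x : {morph ascale^~ x : a b / a + b}.
Proof.
move=> a b; elim/aclassW: x => s.
rewrite addE (ascaleE a s) (ascaleE b s) ascaleE aaddE.
exact/aclassP/AC_scaleDl.
Qed.
HB.instance Definition _ :=
  GRing.Zmodule_isLmodule.Build rat Uenv ascaleA ascale1 ascaleDr ascaleDl.

Let scaleE a (x : Uenv) : a *: x = ascale a x. Proof. by []. Qed.

Fact amulA : associative amul.
Proof.
elim/aclassW=> s; elim/aclassW=> t; elim/aclassW=> u.
by rewrite (amulE t) (amulE s t) !amulE; apply/aclassP/AC_mulA.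
Qed.
Fact amul1l : left_id (aclass AOne) amul.
Proof. by elim/aclassW=> s; rewrite amulE; apply/aclassP/AC_mul1l. Qed.
Fact amul1r : right_id (aclass AOne) amul.
Proof. by elim/aclassW=> s; rewrite amulE; apply/aclassP/AC_mul1r. Qed.
Fact amulDl : left_distributive amul +%R.
Proof.
elim/aclassW=> s; elim/aclassW=> t; elim/aclassW=> u.
rewrite !addE (aaddE s t) (amulE s u) (amulE t u) amulE aaddE.
exact/aclassP/AC_mulDl.
Qed.
Fact amulDr : right_distributive amul +%R.
Proof.
elim/aclassW=> s; elim/aclassW=> t; elim/aclassW=> u.
rewrite !addE (aaddE t u) (amulE s t) (amulE s u) amulE aaddE.
exact/aclassP/AC_mulDr.
Qed.

Fixpoint augment (t : aterm L) : rat :=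
  match t with
  | AGen _ | AZero => 0
  | AOne => 1
  | AAdd s t => augment s + augment t
  | AScale a s => a * augment s
  | AMul s t => augment s * augment t
  end.

Lemma augment_cong s t : acong s t -> augment s = augment t.
Proof.
elim=> //=; try by move=> *; ring.
- by move=> ? ? ? _ -> _ ->.
- by move=> ? ? ? ? _ -> _ ->.
- by move=> ? ? ? _ ->.
- by move=> ? ? ? ? _ -> _ ->.
Qed.

Fact aone_neq0 : aclass AOne != 0.
Proof. by apply/eqP=> /aclassP/augment_cong. Qed.

HB.instance Definition _ := GRing.Zmodule_isNzRing.Build Uenv
  amulA amul1l amul1r amulDl amulDr aone_neq0.

Fact amulZl a (u v : Uenv) : a *: (u * v) = (a *: u) * v.
Proof.
elim/aclassW: u => s; elim/aclassW: v => t.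
rewrite !scaleE (ascaleE a s) -![_ * _]/(amul _ _) (amulE s t) (amulE _ t).
by rewrite ascaleE; apply/aclassP/AC_mulZl.
Qed.
HB.instance Definition _ := GRing.Lmodule_isLalgebra.Build rat Uenv amulZl.
Fact amulZr a (u v : Uenv) : a *: (u * v) = u * (a *: v).
Proof.
elim/aclassW: u => s; elim/aclassW: v => t.
rewrite !scaleE (ascaleE a t) -![_ * _]/(amul _ _) (amulE s t) (amulE s _).
by rewrite ascaleE; apply/aclassP/AC_mulZr.
Qed.
HB.instance Definition _ := GRing.Lalgebra_isAlgebra.Build rat Uenv amulZr.

Definition uin (x : L) : Uenv := aclass (AGen x).

Lemma uin_linear : linear uin.
Proof.
move=> a x y; rewrite scaleE addE (ascaleE a) aaddE.
exact/aclassP/AC_lin.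
Qed.

Lemma uin_bra x y : uin <[x, y]> = uin x * uin y - uin y * uin x.
Proof.
rewrite -scaleN1r scaleE addE -![_ * _]/(amul _ _).
rewrite (amulE (AGen x)) (amulE (AGen y)) ascaleE aaddE.
exact/aclassP/AC_bra.
Qed.

(* The grading of the enveloping algebra induced by that of L. *)
Variable g : lieGrading L.

Inductive uhomog : nat -> Uenv -> Prop :=
| uhomog_in d x of g d x : uhomog d (uin x)
| uhomog1 : uhomog 0 1
| uhomog0 d : uhomog d 0
| uhomogD d (u v : Uenv) of uhomog d u & uhomog d v : uhomog d (u + v)
| uhomogZ d a (u : Uenv) of uhomog d u : uhomog d (a *: u)
| uhomogM m n (u v : Uenv) of uhomog m u & uhomog n v : uhomog (m + n)%N (u * v).

Definition Ugrading : algGrading Uenv :=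
  @AlgGrading _ (Grading uhomog0 uhomogD uhomogZ) uhomog1 uhomogM.

(* The completed enveloping algebra, the map from the completion of L to it,
   and exp x for x of degree 1. *)
Definition Uhat := compl Ugrading.

Definition uhat_in (f : compl g) : Uhat :=
  @mkcompl _ Ugrading (fun d => uin (f d)) (fun d => uhomog_in (complP f d)).

Lemma uhomogX x d : g 1%N x -> uhomog d (uin x ^+ d).
Proof.
move=> gx; elim: d => [|d IH]; first by rewrite expr0; exact: uhomog1.
by rewrite exprS -add1n; apply: uhomogM => //; apply: uhomog_in.
Qed.

Definition uexp x (gx : g 1%N x) : Uhat :=
  @mkcompl _ Ugrading (fun d => d`!%:R^-1 *: uin x ^+ d)
    (fun d => uhomogZ d`!%:R^-1 (uhomogX d gx)).

End Enveloping.

Definition is_alg_derivation (A : algType rat) (D : A -> A) : Prop :=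
  linear D /\ forall u v, D (u * v) = D u * v + u * D v.

(* Der of a completed Lie algebra consists of the continuous derivations; such
   a derivation acts on the completed enveloping algebra through its continuous
   extension. *)
Definition is_cderivation (L : lieType) (g : lieGrading L)
    (D : compl g -> compl g) : Prop :=
  is_derivation D /\ ccontinuous D.

Definition extends_to_Uhat (L : lieType) (g : lieGrading L)
    (D : compl g -> compl g) (E : Uhat g -> Uhat g) : Prop :=
  [/\ is_alg_derivation E, ccontinuous E
    & forall f, E (uhat_in f) = uhat_in (D f)].

Definition f2_rel (s t : lterm bool) : Prop := False.
Definition f2 : lieType := presLie f2_rel.
Definition fA : f2 := lgen f2_rel true.
Definition fB : f2 := lgen f2_rel false.
Definition f2_grading : lieGrading f2 := pres_grading f2_rel (fun=> 1%N).

(* psi(a, b) *)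
Definition f2_eval (L : lieType) (a b : L) : f2 -> L :=
  @lext bool f2_rel L (fun c => if c then a else b).

(* The derivation A |-> [psi, A], B |-> 0. *)
Definition f2_D (psi : f2) : f2 -> f2 :=
  @der bool f2_rel (fun c => if c then <[psi, fA]> else 0).

Lemma f2_evalP (L : lieType) (a b : L) :
  [/\ lie_morphism (f2_eval a b), f2_eval a b fA = a & f2_eval a b fB = b].
Proof.
have [? ? []|h g] := @lextP _ f2_rel L (fun c => if c then a else b).
by split=> //; apply: g.
Qed.

Lemma f2_DP psi :
  [/\ is_derivation (f2_D psi), f2_D psi fA = <[psi, fA]> & f2_D psi fB = 0].
Proof.
have [? ? []|h g] := @derP _ f2_rel (fun c => if c then <[psi, fA]> else 0).
by split=> //; apply: g.
Qed.

Section T.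
Variable n : nat.

Definition tgen := {ij : 'I_n * 'I_n | ij.1 != ij.2}.

(* t_ij, with the junk value 0 for i = j. *)
Definition tterm (i j : 'I_n) : lterm tgen :=
  if insub (i, j) is Some g then LGen g else LZero.

Inductive t_rel : lterm tgen -> lterm tgen -> Prop :=
| t_sym i j of i != j : t_rel (tterm i j) (tterm j i)
| t_4T i j k of uniq [:: i; j; k] :
    t_rel (LBra (tterm i j) (LAdd (tterm i k) (tterm j k))) LZero
| t_comm i j k l of uniq [:: i; j; k; l] :
    t_rel (LBra (tterm i j) (tterm k l)) LZero.

Definition tlie : lieType := presLie t_rel.
Definition tt_ (i j : 'I_n) : tlie := lclass t_rel (tterm i j).

End T.
Arguments tt_ {n} i j.

(* The Lie algebra t_{1,n}, generated by x_i^+ = x (true, i) and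
   x_i^- = x (false, i). *)

Section T1.
Variable n : nat.

Definition t1gen := (bool * 'I_n)%type.

Inductive t1_rel : lterm t1gen -> lterm t1gen -> Prop :=
| t1_sum s : t1_rel (\big[@LAdd t1gen/LZero]_(i < n) LGen (s, i)) LZero
| t1_xx s i j of i != j : t1_rel (LBra (LGen (s, i)) (LGen (s, j))) LZero
| t1_xy i j of i != j : t1_rel (LBra (LGen (true, i)) (LGen (false, j)))
                               (LBra (LGen (true, j)) (LGen (false, i)))
| t1_xt s i j k of uniq [:: i; j; k] :
    t1_rel (LBra (LGen (s, k)) (LBra (LGen (true, i)) (LGen (false, j)))) LZero.

Definition t1lie : lieType := presLie t1_rel.
Definition x_ (s : bool) (i : 'I_n) : t1lie := lgen t1_rel (s, i).

Definition t1_grading : lieGrading t1lie := pres_grading t1_rel (fun=> 1%N).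
(* The grading deg_-. *)
Definition degm_gen (g : t1gen) : nat := if g.1 then 0%N else 1%N.
Definition t1_degm : lieGrading t1lie := pres_grading t1_rel degm_gen.

Definition t_to_t1 : tlie n -> t1lie :=
  lext (fun g : tgen n => <[x_ true (val g).1, x_ false (val g).2]>).

End T1.
Arguments x_ {n} s i.

Lemma leval_tterm n (L : lieType) (F : 'I_n -> 'I_n -> L) i j :
  leval (fun g : tgen n => F (val g).1 (val g).2) (tterm i j) =
  if i != j then F i j else 0.
Proof.
rewrite /tterm; case: insubP => [g ijP gE|/=]; last by move/negbTE->.
by rewrite /= in ijP; rewrite ijP /= gE.
Qed.

Section TTheory.
Variable n : nat.
Implicit Types i j k l : 'I_n.

Lemma tt_C i j : i != j -> tt_ i j = tt_ j i.
Proof. by move=> ij; apply/lclass_rel/t_sym. Qed.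
Lemma tt_diag i : tt_ i i = 0 :> tlie n.
Proof. by rewrite /tt_ /tterm insubF //= eqxx. Qed.
Lemma tt_4T i j k : uniq [:: i; j; k] -> <[tt_ i j, tt_ i k + tt_ j k]> = 0.
Proof.
by move=> u; rewrite -lclass_zero /tt_ -lclass_add -lclass_bra; apply/lclass_rel/t_4T.
Qed.
Lemma tt_comm i j k l : uniq [:: i; j; k; l] -> <[tt_ i j, tt_ k l]> = 0.
Proof.
by move=> u; rewrite -lclass_zero /tt_ -lclass_bra; apply/lclass_rel/t_comm.
Qed.

Lemma x_sum s : \sum_i x_ s i = 0 :> t1lie n.
Proof.
have <- : lclass (@t1_rel n) (\big[@LAdd (t1gen n)/LZero]_(i < n) LGen (s, i))
          = \sum_i x_ s i.
  by elim/big_ind2: _ => // u1 v1 u2 v2 <- <-; rewrite lclass_add.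
exact: (lclass_rel (@t1_sum n s)).
Qed.
Lemma x_xx s i j : <[x_ s i, x_ s j]> = 0.
Proof.
have [->|ij] := eqVneq i j; first exact: lbraxx.
by rewrite -lclass_zero -lclass_bra; apply/lclass_rel/t1_xx.
Qed.
Lemma x_xy i j : <[x_ true i, x_ false j]> = <[x_ true j, x_ false i]>.
Proof.
have [->//|ij] := eqVneq i j.
by rewrite -!lclass_bra; apply/lclass_rel/t1_xy.
Qed.
Lemma x_xt s i j k :
  uniq [:: i; j; k] -> <[x_ s k, <[x_ true i, x_ false j]>]> = 0.
Proof.
move=> u; rewrite /x_ /lgen -lclass_zero.
rewrite -(lclass_bra _ (LGen (true, i))) -lclass_bra.
by apply: lclass_rel; apply: t1_xt.
Qed.
Lemma x_xtD s i j : i != j ->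
  <[x_ s i + x_ s j, <[x_ true i, x_ false j]>]> = 0.
Proof.
move=> ij; have := x_sum s.
rewrite (bigD1 i) //= (bigD1 j) 1?eq_sym //= addrA => /eqP.
rewrite addr_eq0 => /eqP ->; rewrite lbraNl lbra_suml big1 ?oppr0 // => k.
by case/andP=> ki kj; rewrite x_xt //= !inE negb_or ij eq_sym ki eq_sym kj.
Qed.

Lemma t_to_t1P : lie_morphism (@t_to_t1 n) /\
  forall i j, i != j -> t_to_t1 (tt_ i j) = <[x_ true i, x_ false j]>.
Proof.
pose F i j := <[x_ true i, x_ false j]> : t1lie n.
have FE := @leval_tterm n _ F.
have R u v : t_rel u v -> leval (fun g : tgen n => F (val g).1 (val g).2) u =
                          leval (fun g : tgen n => F (val g).1 (val g).2) v.
  case=> [i j ij|i j k|i j k l] /=; rewrite ?FE.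
  - by rewrite ij eq_sym ij; apply: x_xy.
  - rewrite /= !inE negb_or andbT => /andP[/andP[ij ik] jk].
    rewrite ij ik jk /F -lbraDl lbraC.
    set t := <[x_ true i, x_ false j]>.
    have tk : <[x_ false k, t]> = 0 by rewrite x_xt //= !inE negb_or ij ik jk.
    have tij : <[x_ true i + x_ true j, t]> = 0 by apply: x_xtD.
    have := lbra_jacobi (x_ true i + x_ true j) (x_ false k) t.
    rewrite tk lbrax0 add0r [<[t, _]>]lbraC tij oppr0 lbrax0 add0r lbraC.
    by move/eqP; rewrite oppr_eq0 => /eqP ->; rewrite oppr0.
  - rewrite /= !inE !negb_or andbT => /and3P[/and3P[ij ik il] /andP[jk jl] kl].
    rewrite ij kl /F.
    set t := <[x_ true i, x_ false j]>.
    have tk : <[x_ true k, t]> = 0 by rewrite x_xt //= !inE negb_or ij ik jk.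
    have tl : <[x_ false l, t]> = 0 by rewrite x_xt //= !inE negb_or ij il jl.
    have := lbra_jacobi (x_ true k) (x_ false l) t.
    by rewrite tl lbrax0 add0r [<[t, x_ true k]>]lbraC tk oppr0 lbrax0 add0r.
have [mor _] := lextP R; split=> // i j ij.
by rewrite /t_to_t1 /tt_ lextE // FE ij.
Qed.

End TTheory.

(* Numbering of the strands from 1. *)
Definition strand n (k : nat) : 'I_n.+1 := inord k.-1.
Definition tk n (i j : nat) : tlie n.+1 := tt_ (strand n i) (strand n j).
Definition xk n (s : bool) (i : nat) : t1lie n.+1 := x_ s (strand n i).

(* The maps x |-> x^{I_1,...,I_n}. *)
Definition t_ins n p (I : 'I_n -> {set 'I_p}) : tlie n -> tlie p :=
  lext (fun g : tgen n =>
    \sum_(a in I (val g).1) \sum_(b in I (val g).2) tt_ a b).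

Definition t1_ins n p (I : 'I_n -> {set 'I_p}) : t1lie n -> t1lie p :=
  lext (fun g : t1gen n => \sum_(a in I g.2) x_ g.1 a).

Lemma t_insP n p (I : 'I_n -> {set 'I_p}) :
  (forall i j, i != j -> [disjoint I i & I j]) ->
  lie_morphism (t_ins I) /\ forall i j, i != j ->
    t_ins I (tt_ i j) = \sum_(a in I i) \sum_(b in I j) tt_ a b.
Proof.
move=> dis.
have neq i j a b : i != j -> a \in I i -> b \in I j -> a != b.
  move=> /dis d ai bj; apply: contraTneq ai => ->.
  by rewrite (disjointFl d).
pose F i j : tlie p := \sum_(a in I i) \sum_(b in I j) tt_ a b.
have FE := @leval_tterm n _ F.
have FC i j : i != j -> F i j = F j i.
  move=> ij; rewrite /F exchange_big; apply: eq_bigr => a aj.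
  by apply: eq_bigr => b bi; rewrite tt_C // (neq i j).
have R u v : t_rel u v -> leval (fun g : tgen n => F (val g).1 (val g).2) u =
                          leval (fun g : tgen n => F (val g).1 (val g).2) v.
  case=> [i j ij|i j k|i j k l] /=; rewrite ?FE.
  - by rewrite ij eq_sym ij FC.
  - rewrite /= !inE negb_or andbT => /andP[/andP[ij ik] jk].
    rewrite ij ik jk {1}/F lbra_suml big1 // => a ai.
    rewrite lbra_suml big1 // => b bj.
    have ab := neq i j a b ij ai bj.
    rewrite lbraDr /F.
    have -> : <[tt_ a b, \sum_(a' in I i) \sum_(c in I k) tt_ a' c]> =
              <[tt_ a b, \sum_(c in I k) tt_ a c]>.
      rewrite (bigD1 a) //= lbraDr [X in _ + X]lbra_sumr [X in _ + X]big1 ?addr0 // => a' /andP[a'i a'a].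
      rewrite lbra_sumr big1 // => c ck; rewrite tt_comm //= !inE !negb_or ab.
      by rewrite [a == _]eq_sym a'a [b == _]eq_sym (neq i j) // (neq i k a) //
         (neq j k b) // (neq i k a').
    have -> : <[tt_ a b, \sum_(b' in I j) \sum_(c in I k) tt_ b' c]> =
              <[tt_ a b, \sum_(c in I k) tt_ b c]>.
      rewrite (bigD1 b) //= lbraDr [X in _ + X]lbra_sumr [X in _ + X]big1 ?addr0 // => b' /andP[b'j b'b].
      rewrite lbra_sumr big1 // => c ck; rewrite tt_comm //= !inE !negb_or ab.
      by rewrite [b == b']eq_sym b'b (neq i j a b') // (neq i k a) //
         (neq j k b) // (neq j k b').
    rewrite -lbraDr -big_split lbra_sumr big1 // => c ck /=.
    by rewrite tt_4T //= !inE negb_or ab (neq i k) // (neq j k).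
  - rewrite /= !inE !negb_or andbT => /and3P[/and3P[ij ik il] /andP[jk jl] kl].
    rewrite ij kl /F lbra_suml big1 // => a ai; rewrite lbra_suml big1 // => b bj.
    rewrite lbra_sumr big1 // => c ck; rewrite lbra_sumr big1 // => d dl.
    rewrite tt_comm //= !inE !negb_or (neq i j) // (neq i k a c) // (neq i l a) //.
    by rewrite (neq j k) // (neq j l) // (neq k l).
have [mor _] := lextP R; split=> // i j ij.
by rewrite /t_ins /tt_ lextE // FE ij.
Qed.

Lemma t1_insP n p (I : 'I_n -> {set 'I_p}) :
  (forall i j, i != j -> [disjoint I i & I j]) ->
  (forall a, exists i, a \in I i) ->
  lie_morphism (t1_ins I) /\
  forall s i, t1_ins I (x_ s i) = \sum_(a in I i) x_ s a.
Proof.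
move=> dis cov.
have neq i j a b : i != j -> a \in I i -> b \in I j -> a != b.
  move=> /dis d ai bj; apply: contraTneq ai => ->.
  by rewrite (disjointFl d).
pose F (g : t1gen n) : t1lie p := \sum_(a in I g.2) x_ g.1 a.
have R u v : t1_rel u v -> leval F u = leval F v.
  case=> [s|s i j ij|i j ij|s i j k] /=.
  - transitivity (\sum_i F (s, i)).
      by elim/big_ind2: _ => //= ? ? ? ? -> ->.
    transitivity (\sum_a x_ s a : t1lie p); last exact: x_sum.
    rewrite /F /= (exchange_big_dep xpredT) //=; apply: eq_bigr => a _.
    have [i ai] := cov a; rewrite (bigD1 i) //= big1 ?addr0 // => j /andP[aj ji].
    by have := neq j i a a ji aj ai; rewrite eqxx.
  - rewrite /F lbra_suml big1 // => a _; rewrite lbra_sumr big1 // => b _.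
    exact: x_xx.
  - rewrite /F lbra_suml [RHS]lbra_suml.
    under eq_bigr do rewrite lbra_sumr.
    under [RHS]eq_bigr do rewrite lbra_sumr.
    rewrite exchange_big; apply: eq_bigr => b _; apply: eq_bigr => a _.
    exact: x_xy.
  - rewrite /= !inE negb_or andbT => /andP[/andP[ij ik] jk].
    rewrite /F lbra_suml big1 // => c ck; rewrite lbra_suml lbra_sumr big1 // => a ai.
    rewrite !lbra_sumr big1 // => b bj; rewrite x_xt //= !inE negb_or.
    by rewrite (neq i j) // (neq i k) // (neq j k).
have [mor gens] := lextP R; split=> // s i; exact: (gens (s, i)).
Qed.

(* The subsets I_1, ..., I_n of {1, ..., p} listed by s. *)
Definition blocks n p (s : seq (seq nat)) (i : 'I_n) : {set 'I_p} :=
  [set a : 'I_p | a.+1 \in nth [::] s i].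

(* psi^{I_1,I_2,I_3} in t_p and in t_{1,p}, for psi in f_2 seen in t_3. *)
Definition f2_to_t3 : f2 -> tlie 3 := f2_eval (tk 2 1 2) (tk 2 2 3).

Definition f2_t p (s : seq (seq nat)) (psi : f2) : tlie p :=
  t_ins (blocks p s) (f2_to_t3 psi).

Definition f2_t1 p (s : seq (seq nat)) (psi : f2) : t1lie p :=
  t_to_t1 (f2_t p s psi).

Definition t12_t1 p (s : seq (seq nat)) (al : t1lie 2) : t1lie p :=
  t1_ins (blocks p s) al.

(* A Lie algebra given as a subspace of V with a bracket. The bracket is an
   operation on V, of which only the values on the subspace matter. *)

Record lieOn (V : lmodType rat) := LieOn {
  lcarrier :> V -> Prop;
  lbracket_on : V -> V -> V
}.

Definition lie_morphism_on (V W : lmodType rat) (g : lieOn V) (h : lieOn W)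
    (f : V -> W) : Prop :=
  [/\ forall x, g x -> h (f x),
      forall a x y, g x -> g y -> f (a *: x + y) = a *: f x + f y
    & forall x y, g x -> g y ->
        f (lbracket_on g x y) = lbracket_on h (f x) (f y)].

(* The degree completion of g, where deg n x means that x has degree n: the
   product of the homogeneous pieces of g. *)
Definition completion_on (V : lmodType rat) (g : lieOn V)
    (deg : nat -> V -> Prop) : lieOn (nat -> V)%type :=
  LieOn (fun z => forall n, g (z n) /\ deg n (z n)) (cauchy (lbracket_on g)).

(* The semidirect product of g by the one-dimensional Lie algebra with
   generator 1 acting on g by d: [(x, a), (y, b)] = ([x, y] + a d y - b d x, 0). *)
Definition semidirect_on (V : lmodType rat) (g : lieOn V) (d : V -> V) :
    lieOn (V * rat^o)%type :=
  LieOn (fun x : V * rat^o => g x.1) (fun x y : V * rat^o =>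
    (lbracket_on g x.1 y.1 + ((x.2 : rat) *: d y.1 - (y.2 : rat) *: d x.1), 0)).

Definition in_grt1 (psi : f2) : Prop :=
  let psi3 s := f2_t 3 s psi in
  let psi4 s := f2_t 4 s psi in
  [/\ psi3 [:: [:: 1]; [:: 2]; [:: 3]]%N + psi3 [:: [:: 3]; [:: 2]; [:: 1]]%N = 0,
      psi3 [:: [:: 1]; [:: 2]; [:: 3]]%N + psi3 [:: [:: 2]; [:: 3]; [:: 1]]%N
        + psi3 [:: [:: 3]; [:: 1]; [:: 2]]%N = 0,
      <[tk 2 2 3, psi3 [:: [:: 1]; [:: 2]; [:: 3]]%N]>
        + <[tk 2 1 3, psi3 [:: [:: 2]; [:: 1]; [:: 3]]%N]> = 0
    & psi4 [:: [:: 2]; [:: 3]; [:: 4]]%N - psi4 [:: [:: 1; 2]; [:: 3]; [:: 4]]%N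
        + psi4 [:: [:: 1]; [:: 2; 3]; [:: 4]]%N
        - psi4 [:: [:: 1]; [:: 2]; [:: 3; 4]]%N
        + psi4 [:: [:: 1]; [:: 2]; [:: 3]]%N = 0].

Definition ihara (psi1 psi2 : f2) : f2 :=
  <[psi1, psi2]> + f2_D psi2 psi1 - f2_D psi1 psi2.

Definition grt1 : lieOn f2 := LieOn in_grt1 ihara.

Definition f2_deg : f2 -> f2 := degop (fun=> 1%N).

Definition grt : lieOn (f2 * rat^o)%type := semidirect_on grt1 (fun psi => - f2_deg psi).

Definition grt_degree (q : int) (x : f2 * rat^o) : Prop :=
  gpartz f2_grading q x.1 /\ (q != 0 -> x.2 = 0).

Definition t12 : lieType := t1lie 2.

(* Triples (psi, alpha_+, alpha_-). *)
Definition ell : lmodType rat := (f2 * t12 * t12)%type.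
Definition ell_psi (z : ell) : f2 := z.1.1.
Definition ell_alpha (z : ell) (s : bool) : t12 := if s then z.1.2 else z.2.

(* The derivation of t_{1,2} given by x_1^s |-> al s (hence x_2^s |-> - al s). *)
Definition t12_D (al : bool -> t12) : t12 -> t12 :=
  @der (t1gen 2) (@t1_rel 2) (fun g => if g.2 == ord0 then al g.1 else - al g.1).

Lemma t12_x2 s : x_ s ord_max = - x_ s ord0 :> t12.
Proof.
have := x_sum 2 s; rewrite big_ord_recl big_ord1 /= => /eqP.
rewrite addrC addr_eq0 => /eqP <-; congr x_; exact: val_inj.
Qed.

Lemma t12_relP (a : t1gen 2 -> t12) : (forall s, a (s, ord_max) = - a (s, ord0)) ->
  forall u v, t1_rel u v ->
    lderiv (@lgen _ (@t1_rel 2)) a u = lderiv (@lgen _ (@t1_rel 2)) a v.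
Proof.
move=> aN.
have I2 (i : 'I_2) : i = ord0 \/ i = ord_max.
  by case: i => [[|[|//]] i2]; [left|right]; apply: val_inj.
have x2 s : lgen (@t1_rel 2) (s, ord_max) = - lgen (@t1_rel 2) (s, ord0).
  exact: t12_x2.
move=> u v; case=> [s|s i j ij|i j ij|s i j k /= ijk] /=.
- rewrite !big_ord_recl big_ord0 /= addr0.
  have -> : lift ord0 ord0 = ord_max :> 'I_2 by apply: val_inj.
  by rewrite aN subrr.
- case: (I2 i) ij => -> ; case: (I2 j) => -> // _; rewrite x2 aN.
    by rewrite !lbraNr -opprD [X in _ + X]lbraC subrr oppr0.
  by rewrite !lbraNl -opprD [X in _ + X]lbraC subrr oppr0.
- case: (I2 i) ij => -> ; case: (I2 j) => -> // _; rewrite !x2 !aN;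
    by rewrite !lbraNr !lbraNl.
- by have := max_card (mem [:: i; j; k]); rewrite (card_uniqP (ijk : uniq [:: i; j; k])) card_ord.
Qed.

Lemma t12_DP (al : bool -> t12) :
  is_derivation (t12_D al) /\ forall s, t12_D al (x_ s ord0) = al s.
Proof.
have [|der gens] := @derP _ (@t1_rel 2) (fun g => if g.2 == ord0 then al g.1 else - al g.1).
  by apply: t12_relP.
by split=> // s; exact: (gens (s, ord0)).
Qed.

Definition in_grt1ell (z : ell) : Prop :=
  let psi s := f2_t1 3 s (ell_psi z) in
  let al e s := t12_t1 3 s (ell_alpha z e) in
  let x := xk 2 in
  [/\ in_grt1 (ell_psi z),
      forall e : bool,
        al e [:: [:: 1]; [:: 2; 3]]%N + al e [:: [:: 2]; [:: 3; 1]]%N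
          + al e [:: [:: 3]; [:: 1; 2]]%N
          + <[x e 1%N, psi [:: [:: 1]; [:: 2]; [:: 3]]%N]>
          + <[x e 2%N, psi [:: [:: 2]; [:: 1]; [:: 3]]%N]> = 0,
      forall e : bool,
        <[x e 1%N, al e [:: [:: 3]; [:: 1; 2]]%N]>
          + <[al e [:: [:: 1]; [:: 2; 3]]%N, x e 3%N]>
          - <[x e 1%N, <[x e 3%N, psi [:: [:: 1]; [:: 2]; [:: 3]]%N]>]> = 0
    & <[x true 1%N, al false [:: [:: 2]; [:: 1; 3]]%N]>
        - <[x false 2%N, al true [:: [:: 1]; [:: 2; 3]]%N]>
      = <[x false 2%N, <[x true 1%N, psi [:: [:: 1]; [:: 2]; [:: 3]]%N]>]>
        - <[x true 1%N, <[x false 2%N, psi [:: [:: 2]; [:: 1]; [:: 3]]%N]>]>].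

Definition ell_bracket (z w : ell) : ell :=
  let dz := t12_D (ell_alpha z) in
  let dw := t12_D (ell_alpha w) in
  (ihara (ell_psi z) (ell_psi w),
   dw (ell_alpha z true) - dz (ell_alpha w true),
   dw (ell_alpha z false) - dz (ell_alpha w false)).

Definition grt1ell : lieOn ell := LieOn in_grt1ell ell_bracket.

(* deg_- x times x, on t_{1,2} *)
Definition t12_degm : t12 -> t12 := degop (@degm_gen 2).

Lemma f2_degE d psi : f2_grading d psi -> f2_deg psi = d%:R *: psi.
Proof. by apply: degopE. Qed.

Lemma t12_degmE d x : t1_degm 2 d x -> t12_degm x = d%:R *: x.
Proof. by apply: degopE; apply: t12_relP => s; rewrite /= -[lgen _ _]/(x_ _ _) t12_x2 scalerN. Qed.

Definition e22_act (z : ell) : ell :=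
  (- f2_deg (ell_psi z), - t12_degm (ell_alpha z true),
   ell_alpha z false - t12_degm (ell_alpha z false)).

Definition grt_ell : lieOn (ell * rat^o)%type := semidirect_on grt1ell e22_act.

Definition ell_degree (n : nat) (z : ell) : Prop :=
  (if odd n then ell_psi z = 0 else f2_grading n./2 (ell_psi z)) /\
  forall e, t1_grading 2 n.+1 (ell_alpha z e).

Definition grt_ell_degree (n : nat) (z : ell * rat^o) : Prop :=
  ell_degree n z.1 /\ (n != 0%N -> z.2 = 0).

Definition grt1ell_hat : lieOn (nat -> ell)%type := completion_on grt1ell ell_degree.
Definition grt_ell_hat : lieOn (nat -> ell * rat^o)%type :=
  completion_on grt_ell grt_ell_degree.

Definition grt1ell_hat_incl (z : nat -> ell) : nat -> ell * rat^o :=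
  fun n => (z n, 0).
Definition e22_hat : nat -> ell * rat^o :=
  fun n => (0, if n == 0%N then 1 else 0).

Definition raises_degm (q : int) (D : t12 -> t12) : Prop :=
  forall (p : nat) (x : t12),
    t1_degm 2 p x -> gpartz (t1_degm 2) (p%:Z + q) (D x).

Definition ell_degm (q : int) (z : ell) : Prop :=
  gpartz f2_grading q (ell_psi z) /\ raises_degm q (t12_D (ell_alpha z)).

Definition grt_ell_hat_degm (q : int) (z : nat -> ell * rat^o) : Prop :=
  forall n, ell_degm q (z n).1 /\ (q != 0 -> (z n).2 = 0).

Definition t12_hat : lieType := compl (t1_grading 2).

Lemma x_homog n s (i : 'I_n) : t1_grading n 1%N (x_ s i).
Proof. exact: (homog_gen (@lgen _ (@t1_rel n)) (fun=> 1%N) (s, i)). Qed.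

Definition x_hat (s : bool) (k : nat) : t12_hat :=
  csingle (x_homog s (strand 1 k)).

(* The coefficients of the power series u / (e^u - 1), see bernP. *)
Fixpoint bern_seq (n : nat) : seq rat :=
  if n is m.+1 then
    let s := bern_seq m in
    rcons s (- \sum_(k < m.+1) s`_k / (m.+2 - k)`!%:R)
  else [:: 1].
Definition bern (n : nat) : rat := (bern_seq n)`_n.

Lemma size_bern_seq n : size (bern_seq n) = n.+1.
Proof. by elim: n => //= n IH; rewrite size_rcons IH. Qed.

Lemma bern_seqE n k : (k <= n)%N -> (bern_seq n)`_k = bern k.
Proof.
elim: n => [|n IH]; first by rewrite leqn0 => /eqP ->.
rewrite leq_eqVlt => /orP[/eqP -> //|]; rewrite ltnS => kn.
by rewrite /= nth_rcons size_bern_seq ltnS kn IH.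
Qed.

Lemma bernP n : \sum_(k < n.+1) bern k / (n.+1 - k)`!%:R = (n == 0%N)%:R.
Proof.
case: n => [|n]; first by rewrite big_ord1 /= divr1.
rewrite big_ord_recr /= subSnn divr1 [bern n.+1]/bern /=.
rewrite nth_rcons size_bern_seq ltnn eqxx.
under [X in _ + - X]eq_bigr => k _ do rewrite bern_seqE -1?ltnS //.
by rewrite subrr.
Qed.

(* The degree d component of t_{0i} = - (ad x_i / (e^{ad x_i} - 1)) (y_i). *)
Definition t0_seq (i d : nat) : t12 :=
  if d is k.+1 then
    - (bern k *: iter k (fun z => <[xk 1 true i, z]>) (xk 1 false i))
  else 0.

Lemma t0_seqP i d : t1_grading 2 d (t0_seq i d).
Proof.
case: d => [|k] /=; first exact: (gpart0 (t1_grading 2)).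
rewrite -scaleN1r; do 2 apply: (@gpartZ _ (t1_grading 2)).
elim: k => [|k IH]; first exact: x_homog.
by apply: (@gpart_bra _ (t1_grading 2) 1 k.+1) IH; apply: x_homog.
Qed.

Definition t0_hat (i : nat) : t12_hat := mkcompl (t0_seqP i).

Definition t_hat (i j : nat) : t12_hat := <[x_hat true i, x_hat false j]>.

Definition psi012 (psi : f2) : t12_hat := f2_eval (t0_hat 1) (t_hat 1 2) psi.
Definition psi021 (psi : f2) : t12_hat := f2_eval (t0_hat 2) (t_hat 2 1) psi.

Definition exp_x1 : Uhat (t1_grading 2) := uexp (x_homog true (strand 1 1)).

Definition is_Dpsi (psi : f2) (D : t12_hat -> t12_hat) : Prop :=
  [/\ is_cderivation D,
      exists2 E, extends_to_Uhat D E &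
        E exp_x1 = uhat_in (psi021 psi) * exp_x1 - exp_x1 * uhat_in (psi012 psi)
    & D (t0_hat 1) = <[psi012 psi, t0_hat 1]>].

(* (psi, u_+, u_-) as an element of the completion of grt_1^ell; its component
   of degree n consists of the components of degrees n / 2, n + 1, n + 1 of
   psi, u_+, u_-. *)
Definition ell_hat_triple (psi : f2) (u : bool -> t12_hat) : nat -> ell :=
  fun n => (if odd n then 0 else to_compl (fun=> 1%N) psi n./2,
            u true n.+1, u false n.+1).

(* Main.v *)
(* Let t_{0i} = - ad x_i / (e^{ad x_i} - 1) (y_i) for an elliptic triple x_i, y_i
   (the relations of t_{1,3}) and t_{ij} = [x_i, y_j]. Together they satisfy the
   relations of t_4, the strand 0 being new; this rests on an addition formula
   for u / (e^u - 1). Conversely, the relations of t_{1,3} can be read off from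
   [x_i, x_j] = 0, from e^{ad x_i} (t_{0j} + t_{ij}) = t_{0j} and from the
   relations of t_4. So it suffices to deform the latter: over the dual numbers
   L + eps L, put x_i + eps u_+^{i,jk} and y_i + eps u_-^{i,jk} in the gauge given
   by a potential whose differences are the psi^{i,k,j}. The deformation of t_{0i}
   is then the bracket with psi^{0,i,jk}, up to this gauge, and the equations of
   grt_1^ell for (psi, u_+, u_-) follow from the pentagon on the strands
   0, i, j, k and from the other relations of grt_1.

   A continuous derivation of the completion of t_{1,2} is determined by its
   values on x_1 and t_{01}, and D(e^{x_1}) determines D(x_1) since
   (e^{ad x_1} - 1) / ad x_1 is invertible and t_{1,2} embeds in its enveloping
   algebra. This gives uniqueness of D_psi, and compatibility with brackets and
   degrees follows from it, as [D_psi', D_psi] and [deg_-, D_psi] have the defining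
   properties of D_psi for the Ihara bracket and for (deg psi) psi. *)

Require Import Defs.
From HB Require Import structures.
From mathcomp Require Import all_boot all_order all_algebra.
From mathcomp Require Import boolp functions zify ring.

Set Implicit Arguments.
Unset Strict Implicit.
Unset Printing Implicit Defensive.

Import GRing.Theory Num.Theory.
Local Open Scope ring_scope.

(** The lemmas on [T0] are stated in any completed Lie algebra, each relation being a separate
    hypothesis, because they serve twice: over L they produce the relations of t_4 from those of
    t_{1,3}; over L + eps L, where the relations of t_{1,3} are the goal, they are read backwards.
    The hard relation is [t_0i, t_0j + t_ij] = [y_i, y_j]. Its expansion has infinitely many terms,
    but their total, apart from [y_i, y_j], lies in a cyclic Q[[u, v]]-module generated by
    [t_12, t_13], so one scalar identity suffices. Four of the five terms of the pentagon on 0, k,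
    j, i contain the strand 0. The fifth, psi^{k,j,i}, is a difference of potentials by the
    antisymmetry and the three-term relation of grt_1, which is why a change of gauge absorbs it.
    The triples of grt_1^ell are finite sums whereas D_psi produces series: the equations are proved
    in the completion and cut into degrees afterwards. As t_ij has degree 2 in x, y, the part of psi
    of degree m lands in degree 2 m. *)

(** * Linear maps and linear identities *)

Section LinearMaps.
Variables (V W : lmodType rat) (f : V -> W).
Hypothesis fL : linear f.

Lemma linD x y : f (x + y) = f x + f y.
Proof. by have := fL 1 x y; rewrite !scale1r. Qed.
Lemma lin0 : f 0 = 0.
Proof. by apply: (addrI (f 0)); rewrite -linD !addr0. Qed.
Lemma linZ a x : f (a *: x) = a *: f x.
Proof. by have := fL a x 0; rewrite !addr0 lin0 addr0. Qed.
Lemma linN x : f (- x) = - f x.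
Proof. by rewrite -scaleN1r linZ scaleN1r. Qed.
Lemma linB x y : f (x - y) = f x - f y.
Proof. by rewrite linD linN. Qed.
Lemma lin_sum I (r : seq I) (P : pred I) (F : I -> V) :
  f (\sum_(i <- r | P i) F i) = \sum_(i <- r | P i) f (F i).
Proof. by elim/big_rec2: _ => [|i u v _ <-]; rewrite ?lin0 ?linD. Qed.

End LinearMaps.

Lemma iter_linear (V : lmodType rat) (a : V -> V) n : linear a -> linear (iter n a).
Proof. by move=> aL; elim: n => [|n IH] c x y //=; rewrite IH aL. Qed.

(* The square-zero extension of rat by V is a commutative ring, which lets the
   ring tactic prove linear identities in V. *)
Section SquareZero.
Variable V : lmodType rat.
Definition sqz := (rat^o * V)%type.
HB.instance Definition _ := GRing.Lmodule.on sqz.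
Definition sqz_mul (x y : sqz) : sqz :=
  ((x.1 : rat) * y.1, (x.1 : rat) *: y.2 + (y.1 : rat) *: x.2).
Definition sqz_one : sqz := (1, 0).

Fact sqz_mulA : associative sqz_mul.
Proof.
case=> [a x] [b y] [c z]; rewrite /sqz_mul /= !scalerDr !scalerA mulrA addrA.
by rewrite [c * a]mulrC [c * b]mulrC.
Qed.
Fact sqz_mulC : commutative sqz_mul.
Proof. by case=> [a x] [b y]; rewrite /sqz_mul /= mulrC addrC. Qed.
Fact sqz_mul1 : left_id sqz_one sqz_mul.
Proof. by case=> [a x]; rewrite /sqz_mul /= mul1r scale1r scaler0 addr0. Qed.
Fact sqz_mulDl : left_distributive sqz_mul +%R.
Proof.
by case=> [a x] [b y] [c z]; congr pair; rewrite /= ?mulrDl // scalerDl scalerDr addrACA.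
Qed.
Fact sqz_one_neq0 : sqz_one != 0.
Proof. by apply/eqP => /(congr1 fst)/eqP; rewrite oner_eq0. Qed.
HB.instance Definition _ := GRing.Zmodule_isComNzRing.Build sqz
  sqz_mulA sqz_mulC sqz_mul1 sqz_mulDl sqz_one_neq0.

Definition sqz_in (x : V) : sqz := (0, x).
Definition sqz_scal (a : rat) : sqz := (a, 0).

Lemma sqz_inj x y : sqz_in x = sqz_in y -> x = y. Proof. by case. Qed.
Lemma sqz_inD x y : sqz_in (x + y) = sqz_in x + sqz_in y.
Proof. by congr pair; rewrite addr0. Qed.
Lemma sqz_inN x : sqz_in (- x) = - sqz_in x.
Proof. by congr pair; rewrite oppr0. Qed.
Lemma sqz_in0 : sqz_in 0 = 0. Proof. by []. Qed.
Lemma sqz_inZ a x : sqz_in (a *: x) = sqz_scal a * sqz_in x.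
Proof. by congr pair; rewrite /= ?mulr0 ?scaler0 ?addr0. Qed.
End SquareZero.

Definition sqz_inE := (sqz_inD, sqz_inN, sqz_in0, sqz_inZ).

Ltac zmod := apply: sqz_inj; rewrite !sqz_inE; ring.

(** The support lies in a triangle, so the square may be summed along antidiagonals; this regroups
    double series degree by degree. *)
Lemma triangle_sum (V : nmodType) (G : nat -> nat -> V) D :
  (forall n m, (D <= n + m)%N -> G n m = 0) ->
  \sum_(n < D) \sum_(m < D) G n m = \sum_(N < D) \sum_(i < N.+1) G i (N - i)%N.
Proof.
move=> G0.
have E (N : 'I_D) : \sum_(i < N.+1) G i (N - i)%N =
    \sum_(i < D) if (i < N.+1)%N then G i (N - i)%N else 0.
  by rewrite (big_ord_widen D (fun i => G i (N - i)%N)) ?ltn_ord // -big_mkcond.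
under [RHS]eq_bigr do rewrite E.
rewrite [RHS]exchange_big; apply: eq_bigr => n _ /=.
rewrite -(big_mkord xpredT (G n)) (big_cat_nat (n := (D - n)%N)) //= ?leq_subr //.
rewrite [X in _ + X]big_nat_cond [X in _ + X]big1 ?addr0; last first.
  by move=> m /andP[/andP[h _] _]; apply: G0; rewrite -leq_subLR.
rewrite -(big_mkord xpredT (fun N => if (n < N.+1)%N then G n (N - n)%N else 0)).
rewrite [RHS](big_cat_nat (n := n)) //=; last exact: ltnW.
rewrite [X in _ = X + _]big_nat_cond [X in _ = X + _]big1 ?add0r; last first.
  by move=> m /andP[/andP[_ h] _]; rewrite ltnS leqNgt h.
rewrite -{3}[nat_of_ord n]add0n big_addn; apply: eq_bigr => m _.
by rewrite ltnS leq_addl addnK.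
Qed.

(** * Power series of operators on a completion *)

Section Low.
Variables (V : lmodType rat) (g : grading V).
Implicit Types (z w : compl g) (f : nat -> compl g).

Definition low n z := forall d, (d < n)%N -> z d = 0.
(** With the n-th term starting in degree n or later, every degree receives finitely many terms, and
    they are among the first d + 1. *)
Definition summable f := forall n, low n (f n).

Lemma compl_sum I (r : seq I) (P : pred I) (F : I -> compl g) d :
  (\sum_(i <- r | P i) F i) d = \sum_(i <- r | P i) F i d.
Proof. by elim/big_rec2: _ => // i u v _ <-; rewrite complD. Qed.

Lemma low0z z : low 0 z. Proof. by []. Qed.
Lemma low_zero n : low n 0. Proof. by []. Qed.
Lemma lowD n z w : low n z -> low n w -> low n (z + w).
Proof. by move=> h k d dn; rewrite complD h // k // addr0. Qed.
Lemma lowZ n a z : low n z -> low n (a *: z).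
Proof. by move=> h d dn; rewrite complZ h // scaler0. Qed.
Lemma lowN n z : low n z -> low n (- z).
Proof. by move=> h d dn; rewrite complN h // oppr0. Qed.
Lemma lowB n z w : low n z -> low n w -> low n (z - w).
Proof. by move=> h k; apply/lowD/lowN. Qed.
Lemma low_sum n I (r : seq I) (P : pred I) (F : I -> compl g) :
  (forall i, P i -> low n (F i)) -> low n (\sum_(i <- r | P i) F i).
Proof. by move=> h; apply: big_ind; [exact: low_zero|exact: lowD|exact: h]. Qed.
Lemma low_le n m z : low n z -> (m <= n)%N -> low m z.
Proof. by move=> h mn d dm; apply: h; apply: leq_trans dm mn. Qed.
Lemma low_eq0 z : (forall n, low n z) -> z = 0.
Proof. by move=> h; apply: compl_ext => d; rewrite (h d.+1) // compl0. Qed.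
Lemma low_eq z w : (forall n, low n (z - w)) -> z = w.
Proof. by move=> /low_eq0/eqP; rewrite subr_eq0 => /eqP. Qed.
Lemma low_csingle n d x (gx : g d x) : (n <= d)%N -> low n (csingle gx).
Proof. by move=> nd e en /=; case: eqP => // ed; lia. Qed.

Fact csum_subproof f d : g d (\sum_(n < d.+1) f n d).
Proof. by apply: gpart_sum => i; apply: complP. Qed.
(* Junk unless f is summable: the terms f n with n > d are dropped in degree d. *)
Definition csum f : compl g := mkcompl (csum_subproof f).

Lemma csumE f d : csum f d = \sum_(n < d.+1) f n d. Proof. by []. Qed.

Lemma csum_trunc f N : summable f -> low N (csum f - \sum_(n < N) f n).
Proof.
move=> sf d dN; rewrite complD complN compl_sum /=.
rewrite -!(big_mkord xpredT (fun n => f n d)) (big_cat_nat (n := d.+1) (p := N)) //=.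
rewrite opprD addrA subrr add0r big_nat_cond big1 ?oppr0 // => i.
by rewrite andbT => /andP[h _]; apply: sf.
Qed.

Lemma csum_unique f z : summable f ->
  (forall N, low N (z - \sum_(n < N) f n)) -> z = csum f.
Proof.
move=> sf h; apply: low_eq => N; rewrite -(subrKA (\sum_(n < N) f n)).
by rewrite -[X in _ + X]opprB; apply: lowB => //; apply: csum_trunc.
Qed.

Lemma eq_csum f f' : (forall n, f n = f' n) -> csum f = csum f'.
Proof. by move=> h; apply: compl_ext => d; apply: eq_bigr => i _; rewrite h. Qed.

Lemma csumD f f' : csum (fun n => f n + f' n) = csum f + csum f'.
Proof. by apply: compl_ext => d; rewrite complD /= -big_split. Qed.

Lemma csumZ a f : csum (fun n => a *: f n) = a *: csum f.
Proof. by apply: compl_ext => d; rewrite complZ /= scaler_sumr. Qed.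

Lemma csumB f f' : csum (fun n => f n - f' n) = csum f - csum f'.
Proof.
by rewrite -[in RHS]scaleN1r -csumZ -csumD; apply: eq_csum => n; rewrite scaleN1r.
Qed.

Lemma csum_shift f : summable f -> csum f = f 0%N + csum (fun n => f n.+1).
Proof.
move=> h; apply: compl_ext => d; rewrite complD /= big_ord_recl /=; congr (_ + _).
by rewrite [RHS]big_ord_recr /= [f d.+1 d]h // addr0.
Qed.

Lemma low_csum k f : (forall n, low k (f n)) -> low k (csum f).
Proof. by move=> h d dk /=; rewrite big1 // => i _; apply: h. Qed.

Lemma csum2 (F : nat -> nat -> compl g) : (forall n m, low (n + m) (F n m)) ->
  csum (fun n => csum (F n)) = csum (fun N => \sum_(i < N.+1) F i (N - i)%N).
Proof.
move=> h; apply: compl_ext => d /=.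
rewrite (triangle_sum (G := fun n m => F n m d)) => [|n m nm]; last exact: h.
by apply: eq_bigr => N _; rewrite compl_sum.
Qed.

Lemma csum_csingle z : z = csum (fun n => csingle (complP z n)).
Proof.
apply: compl_ext => d /=; rewrite big_ord_recr /= eqxx big1 ?add0r // => i _.
by rewrite gtn_eqF.
Qed.

End Low.

Section Filtered.
Variables (V W : lmodType rat) (g : grading V) (h : grading W).

Definition fmap k (a : compl g -> compl h) :=
  linear a /\ forall n z, low n z -> low (n + k) (a z).

Lemma fmapW k a : fmap k a -> fmap 0 a.
Proof.
by case=> aL af; split=> // n z /af/low_le; apply; rewrite addn0 leq_addr.
Qed.

Lemma fmap_csum k a f : fmap k a -> summable f -> a (csum f) = csum (fun n => a (f n)).
Proof.
move=> /fmapW[aL af] sf; apply: csum_unique => [n|N].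
  by have := af _ _ (sf n); rewrite addn0.
by have := af _ _ (csum_trunc (N := N) sf); rewrite addn0 (linB aL) (lin_sum aL).
Qed.

Lemma fmapD k a b : fmap k a -> fmap k b -> fmap k (fun z => a z + b z).
Proof.
move=> [aL af] [bL bf]; split=> [c x y|n z lz]; last by apply: lowD; auto.
by rewrite aL bL scalerDr addrACA.
Qed.

Lemma fmapN k a : fmap k a -> fmap k (fun z => - a z).
Proof.
move=> [aL af]; split=> [c x y|n z lz]; last by apply: lowN; auto.
by rewrite aL opprD scalerN.
Qed.

End Filtered.

Section PowerSeries.
Variables (V : lmodType rat) (g : grading V) (a : compl g -> compl g).
Hypothesis aF : fmap 1 a.
Let aL := aF.1.
Implicit Types (p q : nat -> rat) (z : compl g).

(** The operator p(a) applied to z, where p lists the coefficients of a power series; it converges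
    because a raises the filtration by 1. *)
Definition ps p z := csum (fun n => p n *: iter n a z).

Lemma iter_low k n z : low n z -> low (n + k) (iter k a z).
Proof.
elim: k => [|k IH] lz /=; first by rewrite addn0.
by rewrite addnS -addn1; apply/aF.2/IH.
Qed.

Lemma ps_summable p z : summable (fun n => p n *: iter n a z).
Proof. by move=> n; apply/lowZ/(iter_low (n := 0)). Qed.

Lemma ps_fmap p : fmap 0 (ps p).
Proof.
split=> [c x y|n z lz].
  rewrite /ps -csumZ -csumD; apply: eq_csum => n.
  by rewrite (iter_linear n aL) scalerDr !scalerA mulrC.
rewrite addn0; apply: low_csum => k; apply/lowZ/(low_le (iter_low (k := k) lz)).
exact: leq_addr.
Qed.

Lemma eq_ps p q z : p =1 q -> ps p z = ps q z.
Proof. by move=> pq; apply: eq_csum => n; rewrite pq. Qed.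

Lemma psM p q z :
  ps p (ps q z) = ps (fun n => \sum_(i < n.+1) p i * q (n - i)%N) z.
Proof.
rewrite {1}/ps.
transitivity (csum (fun n => csum (fun m => (p n * q m) *: iter (n + m) a z))).
  apply: eq_csum => n; have itF : fmap n (iter n a).
    by split=> [|m w]; [apply: iter_linear|apply: iter_low].
  rewrite /ps (fmap_csum itF (ps_summable q z)) -csumZ.
  apply: eq_csum => m; rewrite (linZ (iter_linear n aL)) scalerA.
  by rewrite -iterD.
rewrite csum2 => [|n m]; last exact/lowZ/(iter_low (n := 0)).
apply: eq_csum => N; rewrite scaler_suml; apply: eq_bigr => i _.
by rewrite subnKC // -ltnS.
Qed.

Lemma ps1 z : ps (fun n => (n == 0%N)%:R) z = z.
Proof.
rewrite /ps; apply: compl_ext => d /=; rewrite big_ord_recl /= scale1r.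
by rewrite big1 ?addr0 // => i _; rewrite scale0r.
Qed.

Lemma ps_split p z : ps p z = p 0%N *: z + a (ps (fun n => p n.+1) z).
Proof.
rewrite /ps (csum_shift (ps_summable p z)); congr (_ + _).
rewrite (fmap_csum aF (ps_summable _ z)).
by apply: eq_csum => n; rewrite (linZ aL).
Qed.

End PowerSeries.

(** Only the intertwining b a = a' b matters, so one lemma covers commuting operators, one-sided
    multiplications, projections and Lie morphisms. *)
Lemma ps_comm (V W : lmodType rat) (g : grading V) (h : grading W)
    (a : compl g -> compl g) (a' : compl h -> compl h) (b : compl g -> compl h) k p z :
  fmap 1 a -> fmap k b -> (forall z, b (a z) = a' (b z)) ->
  b (ps a p z) = ps a' p (b z).
Proof.
move=> aF bF ba; rewrite {1}/ps (fmap_csum bF (ps_summable aF p z)).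
apply: eq_csum => n; rewrite (linZ bF.1); congr (_ *: _).
by elim: n => //= n <-.
Qed.

Lemma ps_kill (V : lmodType rat) (g : grading V) (a : compl g -> compl g) p z :
  fmap 1 a -> a z = 0 -> ps a p z = p 0%N *: z.
Proof.
move=> aF az; rewrite ps_split //.
by rewrite (ps_comm (a' := a) (b := a) _ _ aF aF) // az (lin0 (ps_fmap aF _).1) addr0.
Qed.

(* The coefficients of e^u and of (e^u - 1) / u. *)
Definition nexp (n : nat) : rat := n`!%:R^-1.
Definition nhh (n : nat) : rat := n.+1`!%:R^-1.
Definition delta0 (n : nat) : rat := (n == 0%N)%:R.

Lemma factr_neq0 n : n`!%:R != 0 :> rat.
Proof. by rewrite pnatr_eq0 -lt0n fact_gt0. Qed.

Lemma bin_fact_inv n m : (m <= n)%N ->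
  n`!%:R^-1 * 'C(n, m)%:R = m`!%:R^-1 * (n - m)`!%:R^-1 :> rat.
Proof.
move=> mn; rewrite -(bin_fact mn) !natrM.
have := factr_neq0 m; have := factr_neq0 (n - m).
have : 'C(n, m)%:R != 0 :> rat by rewrite pnatr_eq0 -lt0n bin_gt0.
by move=> h1 h2 h3; field; rewrite h1 h2 h3.
Qed.

Section DoubleFamily.
Variables (V : lmodType rat) (a : V -> V).
Hypothesis aL : linear a.

(** A binomial formula: w p q plays the part of u^p v^q and a that of u + v. The families used are
    products of iterates under a Leibniz rule and iterates of two commuting operators. *)
Lemma iter_double k (w : nat -> nat -> V) :
  (forall p q, a (w p q) = w p.+1 q + w p q.+1) ->
  iter k a (w 0 0)%N = \sum_(p < k.+1) 'C(k, p)%:R *: w p (k - p)%N.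
Proof.
move=> aw; elim: k => [|k IH]; first by rewrite big_ord1 bin0 scale1r.
rewrite iterS IH (lin_sum aL).
under eq_bigr => p _ do rewrite (linZ aL) aw scalerDr -subSn -1?ltnS //.
rewrite big_split /= [X in X + _]big_ord_recr [X in _ + X]big_ord_recl /=.
rewrite [RHS]big_ord_recl [X in _ = _ + X]big_ord_recr /=.
rewrite !bin0 !binn !subnn !subn0.
rewrite [LHS](AC (2*2) (3*((1*4)*2))) -big_split; congr (_ + (_ + _)).
apply: eq_bigr => i _ /=.
rewrite /bump !add1n subSS -scalerDl -natrD; congr (_%:R *: _).
by rewrite binS addnC.
Qed.

(** In the same dictionary both sides are ((u + v)^k - v^k) / u. After division by k! this is what
    produces the factor (e^u - 1) / u. *)
Lemma sum_iter_double k (w : nat -> nat -> V) :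
  (forall p q, a (w p q) = w p.+1 q + w p q.+1) ->
  \sum_(i < k) iter i a (w 0 (k.-1 - i))%N =
  \sum_(p < k) 'C(k, p.+1)%:R *: w p (k.-1 - p)%N.
Proof.
elim: k w => [|k IH] w aw; first by rewrite !big_ord0.
rewrite big_ord_recr /= subnn iter_double //.
have -> : \sum_(i < k) iter i a (w 0 (k - i))%N =
          \sum_(i < k) iter i a (w 0 (k.-1 - i).+1)%N.
  apply: eq_bigr => i _; congr (iter _ _ (w _ _)); have := ltn_ord i; lia.
(* The family shifted in its second index satisfies the same recursion, and Pascal's rule adds the
   binomial expansion of the last iterate. *)
rewrite (IH (fun p q => w p q.+1)) // !big_ord_recr /= !binn addrA; congr (_ + _).
rewrite -big_split; apply: eq_bigr => i _ /=.
have -> : (k.-1 - i).+1 = (k - i)%N by have := ltn_ord i; lia.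
by rewrite -scalerDl -natrD.
Qed.

End DoubleFamily.

Section ExpDouble.
Variables (V : lmodType rat) (g : grading V) (a : compl g -> compl g).
Hypothesis aF : fmap 1 a.
Variable w : nat -> nat -> compl g.
Hypothesis aw : forall p q, a (w p q) = w p.+1 q + w p q.+1.

Lemma exp_double :
  ps a nexp (w 0 0)%N = csum (fun N => \sum_(p < N.+1) (nexp p * nexp (N - p)%N) *: w p (N - p)%N).
Proof.
apply: eq_csum => N; rewrite (iter_double aF.1) // scaler_sumr.
by apply: eq_bigr => p _; rewrite scalerA bin_fact_inv // -ltnS.
Qed.

Lemma hh_double :
  csum (fun N => nhh N *: \sum_(i < N.+1) iter i a (w 0 (N - i))%N) =
  csum (fun N => \sum_(p < N.+1) (nhh p * nexp (N - p)%N) *: w p (N - p)%N).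
Proof.
apply: eq_csum => N; rewrite (sum_iter_double aF.1 N.+1 aw) scaler_sumr.
by apply: eq_bigr => p _; rewrite scalerA bin_fact_inv ?subSS // ltn_ord.
Qed.

End ExpDouble.

Lemma exp_add (V : lmodType rat) (g : grading V) (a c : compl g -> compl g) z :
  fmap 1 a -> fmap 1 c -> (forall z, a (c z) = c (a z)) ->
  ps (fun z => a z + c z) nexp z = ps a nexp (ps c nexp z).
Proof.
move=> aF cF ac.
have acn n z' : c (iter n a z') = iter n a (c z') by elim: n => //= n <-; rewrite ac.
rewrite (exp_double (w := fun p q => iter p a (iter q c z)) (fmapD aF cF)) => [|p q].
  rewrite -(csum2 (F := fun p q => (nexp p * nexp q) *: iter p a (iter q c z))).
    apply: eq_csum => n.
    have itF : fmap n (iter n a).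
      by split=> [|m w lw]; [apply: iter_linear aF.1|apply: iter_low].
    rewrite /ps (fmap_csum itF (ps_summable cF _ z)) -csumZ; apply: eq_csum => m.
    by rewrite (linZ itF.1) scalerA.
  move=> n m; rewrite addnC; apply: lowZ; apply: (iter_low aF).
  exact: (iter_low cF (n := 0)).
by rewrite acn -!iterS.
Qed.

Section Bilinear.
Variables (V1 V2 V3 : lmodType rat).
Variables (g1 : grading V1) (g2 : grading V2) (g3 : grading V3).
Variable op : compl g1 -> compl g2 -> compl g3.

Definition fbil := [/\ forall y, linear (op^~ y), forall x, linear (op x)
  & forall m n x y, low m x -> low n y -> low (m + n) (op x y)].

Hypothesis opF : fbil.

Lemma fbil_l m y : low m y -> fmap m (op^~ y).
Proof. by case: opF => oL _ ol ly; split=> // n x lx; apply: ol. Qed.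
Lemma fbil_r m x : low m x -> fmap m (op x).
Proof. by case: opF => _ oL ol lx; split=> // n y ly; rewrite addnC; apply: ol. Qed.

Lemma csum_bil f h : summable f -> summable h ->
  op (csum f) (csum h) = csum (fun N => \sum_(i < N.+1) op (f i) (h (N - i)%N)).
Proof.
move=> sf sh; rewrite -(csum2 (F := fun n m => op (f n) (h m))) => [|n m]; last first.
  by case: opF => _ _; apply.
rewrite (fmap_csum (fbil_l (low0z _)) sf); apply: eq_csum => n.
by rewrite (fmap_csum (fbil_r (low0z _)) sh).
Qed.

Variables (a1 : compl g1 -> compl g1) (a2 : compl g2 -> compl g2) (a3 : compl g3 -> compl g3).
Hypotheses (aF1 : fmap 1 a1) (aF2 : fmap 1 a2) (aF3 : fmap 1 a3).
Hypothesis aop : forall x y, a3 (op x y) = op (a1 x) y + op x (a2 y).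

(** A Leibniz rule exponentiates to multiplicativity. *)
Lemma exp_bil x y : ps a3 nexp (op x y) = op (ps a1 nexp x) (ps a2 nexp y).
Proof.
rewrite (exp_double aF3 (w := fun p q => op (iter p a1 x) (iter q a2 y))) //.
rewrite csum_bil; try exact: ps_summable.
apply: eq_csum => N; apply: eq_bigr => i _.
by case: opF => oL oR _; rewrite (linZ (oL _)) (linZ (oR _)) scalerA.
Qed.

(** The derivative of an exponential: the left side inserts x at every place of every power, and the
    binomial count gathers the insertions into (e^u - 1) / u. It is used over dual numbers and for
    derivations of an enveloping algebra. *)
Lemma hh_bil x y :
  csum (fun N => nhh N *: \sum_(i < N.+1) iter i a3 (op x (iter (N - i) a2 y))) =
  op (ps a1 nhh x) (ps a2 nexp y).
Proof.
rewrite (hh_double aF3 (w := fun p q => op (iter p a1 x) (iter q a2 y))) //.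
rewrite csum_bil; try exact: ps_summable.
apply: eq_csum => N; apply: eq_bigr => i _.
by case: opF => oL oR _; rewrite (linZ (oL _)) (linZ (oR _)) scalerA.
Qed.

End Bilinear.

Lemma bern_hh n : \sum_(i < n.+1) bern i * nhh (n - i) = delta0 n.
Proof.
rewrite /delta0 -bernP; apply: eq_bigr => i _.
by rewrite /nhh subSn // -ltnS.
Qed.

Section OperatorSeries.
Variables (V : lmodType rat) (g : grading V) (a : compl g -> compl g).
Hypothesis aF : fmap 1 a.

Lemma ps_bern_hh z : ps a bern (ps a nhh z) = z.
Proof. by rewrite psM // -[RHS](ps1 a); apply: eq_ps => n; rewrite bern_hh. Qed.
Lemma ps_swap p q z : ps a p (ps a q z) = ps a q (ps a p z).
Proof.
rewrite !psM //; apply: eq_ps => n; rewrite (reindex_inj rev_ord_inj) /=.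
by apply: eq_bigr => i _; rewrite subSS mulrC subKn // -ltnS.
Qed.
Lemma ps_hh_bern z : ps a nhh (ps a bern z) = z.
Proof. by rewrite ps_swap ps_bern_hh. Qed.
Lemma ps_hh_inj z w : ps a nhh z = ps a nhh w -> z = w.
Proof. by move=> e; rewrite -(ps_bern_hh z) e ps_bern_hh. Qed.

Lemma ps_op p z : ps a p (a z) = a (ps a p z).
Proof. by rewrite (ps_comm (a' := a) (b := a) _ _ aF aF). Qed.

Lemma ps_exp z : ps a nexp z = z + a (ps a nhh z).
Proof. by rewrite ps_split // [nexp 0]invr1 scale1r. Qed.

Lemma exp_inv z : ps a nexp (ps (fun z => - a z) nexp z) = z.
Proof.
rewrite -exp_add //; last by move=> w; rewrite (linN aF.1).
  rewrite -[RHS](ps1 a); apply: eq_csum => n.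
  case: n => [|n] /=; first by rewrite [nexp 0]invr1.
  by rewrite subrr scaler0 scale0r.
exact: fmapN.
Qed.

End OperatorSeries.

Section LieBasics.
Variable L : lieType.
Implicit Types x y z : L.

Lemma lbraBl x y z : <[x - y, z]> = <[x, z]> - <[y, z]>.
Proof. by rewrite lbraDl lbraNl. Qed.
Lemma lbraBr x y z : <[x, y - z]> = <[x, y]> - <[x, z]>.
Proof. by rewrite lbraDr lbraNr. Qed.
Lemma lbra_leibniz x y z : <[x, <[y, z]>]> = <[<[x, y]>, z]> + <[y, <[x, z]>]>.
Proof.
have /eqP := lbra_jacobi x y z.
rewrite [<[z, x]>]lbraC lbraNr [<[z, _]>]lbraC -addrA -opprD subr_eq0 => /eqP ->.
by rewrite addrC.
Qed.
Lemma lbra_comm x y z : <[x, y]> = 0 -> <[x, <[y, z]>]> = <[y, <[x, z]>]>.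
Proof. by move=> h; rewrite lbra_leibniz h lbra0x add0r. Qed.
Lemma lbra_eq0C x y : <[x, y]> = 0 -> <[y, x]> = 0.
Proof. by move=> h; rewrite lbraC h oppr0. Qed.

End LieBasics.

Section LieSeries.
Variables (L : lieType) (g : lieGrading L).
Implicit Types x y z : compl g.

Lemma lbra_fbil : fbil (@lbra (compl g)).
Proof.
split=> [y|x|m n x y lx ly d dmn]; [exact: lbra_linl|exact: lbra_linr|].
rewrite /= /cauchy big1 // => i _; have [im|mi] := ltnP i m.
  by rewrite lx // lbra0x.
by rewrite ly ?lbrax0 //; have := ltn_ord i; lia.
Qed.

Lemma lbra_low m n x y : low m x -> low n y -> low (m + n) <[x, y]>.
Proof. by case: lbra_fbil => _ _; apply. Qed.

Lemma ad_fmap n x : low n x -> fmap n (lbra x).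
Proof. by move=> lx; apply: fbil_r lbra_fbil _ _ lx. Qed.

Lemma ad_fmapl y : fmap 0 (lbra^~ y : compl g -> compl g).
Proof. exact: (fbil_l lbra_fbil (low0z y)). Qed.

Lemma ad_fmapr x : fmap 0 (lbra x : compl g -> compl g).
Proof. exact: (ad_fmap (low0z x)). Qed.

Lemma exp_ad_bra x y z : low 1 x ->
  ps (lbra x) nexp <[y, z]> = <[ps (lbra x) nexp y, ps (lbra x) nexp z]>.
Proof.
move=> lx; have F := ad_fmap lx.
exact: (exp_bil lbra_fbil F F F (fun y z => lbra_leibniz x y z)).
Qed.

Lemma ps_ad_bral x p y w : low 1 x -> <[x, w]> = 0 ->
  <[ps (lbra x) p y, w]> = ps (lbra x) p <[y, w]>.
Proof.
move=> lx xw; apply: (ps_comm (a := lbra x) (b := lbra^~ w) _ _ (ad_fmap lx) (ad_fmapl w)).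
by move=> z; rewrite lbra_leibniz xw lbrax0 addr0.
Qed.

Lemma ps_ad_brar x p y w : low 1 x -> <[x, w]> = 0 ->
  <[w, ps (lbra x) p y]> = ps (lbra x) p <[w, y]>.
Proof.
by move=> lx xw; rewrite lbraC ps_ad_bral // -(linN (ps_fmap (ad_fmap lx) p).1) -lbraC.
Qed.

Lemma iter_bral (x y w : compl g) n : <[x, w]> = 0 ->
  <[iter n (lbra x) y, w]> = iter n (lbra x) <[y, w]>.
Proof. by move=> xw; elim: n => //= n <-; rewrite [RHS]lbra_leibniz xw lbrax0 addr0. Qed.

Lemma iter_brar (x y w : compl g) n : <[x, w]> = 0 ->
  <[w, iter n (lbra x) y]> = iter n (lbra x) <[w, y]>.
Proof. by move=> xw; elim: n => //= n <-; rewrite [RHS]lbra_leibniz xw lbra0x add0r. Qed.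

(** On y the operators ad x and ad (- x') agree, and they commute, so their iterates agree on y as
    well. This trades ad x_1 for - ad x_2 on t_12. *)
Lemma iter_adN (x x' y : compl g) n : <[x, x']> = 0 -> <[x + x', y]> = 0 ->
  iter n (lbra x) y = iter n (lbra (- x')) y.
Proof.
move=> xx' xy; have xN : <[x, - x']> = 0 by rewrite lbraNr xx' oppr0.
have xy' : <[x, y]> = <[- x', y]>.
  by apply/eqP; rewrite lbraNl -addr_eq0 -lbraDl xy.
elim: n => //= n ->.
by elim: n => //= n IH; rewrite lbra_comm // IH.
Qed.

Lemma ps_adN x x' p y : <[x, x']> = 0 -> <[x + x', y]> = 0 ->
  ps (lbra x) p y = ps (lbra (- x')) p y.
Proof. by move=> xx' xy; apply: eq_csum => n; rewrite (iter_adN n xx' xy). Qed.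

Lemma lbraN (x : compl g) : lbra (- x) = (fun z => - <[x, z]>).
Proof. by apply: funext => z; rewrite lbraNl. Qed.

Lemma ps_ad_kill x x' p y : low 1 x -> <[x', x]> = 0 -> <[x', y]> = 0 ->
  <[x', ps (lbra x) p y]> = 0.
Proof.
move=> lx xx' xy.
rewrite (ps_comm (a' := lbra x) (b := lbra x') _ _ (ad_fmap lx) (ad_fmapr x')).
  by rewrite xy (lin0 (ps_fmap (ad_fmap lx) p).1).
by move=> z; rewrite lbra_comm.
Qed.

End LieSeries.

(** * Bernoulli identities in Q[[u, v]] *)

Section BivariateSeries.

Definition poly_gpart (d : nat) (p : {poly rat}) : Prop := (size p <= d.+1)%N.

Fact poly_gpart0 d : poly_gpart d 0. Proof. by rewrite /poly_gpart size_poly0. Qed.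
Fact poly_gpartD d p q : poly_gpart d p -> poly_gpart d q -> poly_gpart d (p + q).
Proof. by move=> h k; apply: leq_trans (size_polyD _ _) _; rewrite geq_max h. Qed.
Fact poly_gpartZ d a p : poly_gpart d p -> poly_gpart d (a *: p).
Proof. by move=> h; apply: leq_trans (size_scale_leq _ _) h. Qed.
Definition poly_grading := Grading poly_gpart0 poly_gpartD poly_gpartZ.
Fact poly_gpart1 : poly_grading 0 1.
Proof. by rewrite /= /poly_gpart size_poly1. Qed.
Fact poly_gpartM m n p q : poly_grading m p -> poly_grading n q ->
  poly_grading (m + n) (p * q).
Proof.
by rewrite /= /poly_gpart => h k; apply: leq_trans (size_polyMleq _ _) _; lia.
Qed.
Definition poly_algGrading := @AlgGrading {poly rat} poly_grading poly_gpart1 poly_gpartM.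

(* Q[[u, v]]: the homogeneous component sum_m c_m u^(d-m) v^m of degree d is
   stored dehomogenized, as the polynomial sum_m c_m X^m. *)
Definition uvser := compl poly_algGrading.
HB.instance Definition _ := GRing.NzRing.on uvser.

Fact uvser_mulC : commutative (@GRing.mul uvser).
Proof.
move=> f h; apply: compl_ext => d; rewrite /= cauchy_rev /cauchy.
by apply: eq_bigr => i _; rewrite mulrC.
Qed.
HB.instance Definition _ := GRing.PzRing_hasCommutativeMul.Build uvser uvser_mulC.

End BivariateSeries.

Section Uvser.
Implicit Types (f h p q : uvser).

Lemma uvser_fbil : fbil (@GRing.mul uvser).
Proof.
split=> [y a f h|x a f h|m n f h lf lh d dmn].
- by rewrite mulrDl scalerAl.
- by rewrite mulrDr scalerAr.
rewrite [LHS]/= /cauchy big1 // => i _; have [im|mi] := ltnP i m.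
  by rewrite lf // mul0r.
by rewrite lh ?mulr0 //; have := ltn_ord i; lia.
Qed.

Lemma mul_fmap n p : low n p -> fmap n ( *%R p : uvser -> uvser).
Proof. by move=> lp; apply: fbil_r uvser_fbil _ _ lp. Qed.

Lemma mul_low m n p q : low m p -> low n q -> low (m + n) (p * q).
Proof. by case: uvser_fbil => _ _; apply. Qed.

Fact uv_u_subproof : poly_algGrading 1%N 1.
Proof. by rewrite /= /poly_gpart size_poly1. Qed.
Fact uv_v_subproof : poly_algGrading 1%N 'X.
Proof. by rewrite /= /poly_gpart size_polyX. Qed.
Definition uv_u : uvser := csingle uv_u_subproof.
Definition uv_v : uvser := csingle uv_v_subproof.

Lemma low_u : low 1 uv_u. Proof. exact: low_csingle. Qed.
Lemma low_v : low 1 uv_v. Proof. exact: low_csingle. Qed.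

Lemma uv_lowN p : low 1 p -> low 1 (- p). Proof. exact: lowN. Qed.
Lemma uv_lowD p q : low 1 p -> low 1 q -> low 1 (p + q). Proof. exact: lowD. Qed.

Lemma mul_uE f d : (uv_u * f) d = if d is d'.+1 then f d' else 0.
Proof.
rewrite [LHS]/= /cauchy; case: d => [|d]; first by rewrite big_ord1 mul0r.
rewrite !big_ord_recl /= mul0r add0r mul1r subSS subn0 big1 ?addr0 // => i _.
by rewrite mul0r.
Qed.

Lemma mul_vE f d : (uv_v * f) d = if d is d'.+1 then 'X * f d' else 0.
Proof.
rewrite [LHS]/= /cauchy; case: d => [|d]; first by rewrite big_ord1 mul0r.
rewrite !big_ord_recl /= mul0r add0r subSS subn0 big1 ?addr0 // => i _.
by rewrite mul0r.
Qed.

(** Here and in the next two lemmas u, v and u + v are cancelled: identities with these denominators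
    are proved after clearing them. *)
Lemma uv_uI f h : uv_u * f = uv_u * h -> f = h.
Proof.
move=> e; apply: compl_ext => d.
by have := mul_uE f d.+1; rewrite e mul_uE.
Qed.

Lemma uv_vI f h : uv_v * f = uv_v * h -> f = h.
Proof.
move=> e; apply: compl_ext => d; have := mul_vE f d.+1; rewrite e mul_vE.
by move=> /mulfI ->; rewrite ?polyX_eq0.
Qed.

Lemma uv_uvI f h : (uv_u + uv_v) * f = (uv_u + uv_v) * h -> f = h.
Proof.
move=> e; apply: compl_ext => d.
have E k : ((uv_u + uv_v) * k) d.+1 = (1 + 'X) * k d.
  by rewrite mulrDl complD mul_uE mul_vE mulrDl mul1r.
have := E f; rewrite e E => /mulfI -> //.
apply/eqP => /(congr1 (fun p : {poly rat} => p`_0)) /eqP.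
by rewrite coefD coef1 coefX coef0 addr0 oner_eq0.
Qed.

Definition uvps (c : nat -> rat) p : uvser := ps ( *%R p) c 1.

Lemma S_mul c p f : low 1 p -> ps ( *%R p) c f = uvps c p * f.
Proof.
move=> lp; rewrite -[in LHS](mul1r f).
have rF := fbil_l uvser_fbil (low0z f).
by rewrite -(ps_comm (a := *%R p) c 1 (mul_fmap lp) rF) // => z; rewrite mulrA.
Qed.

Lemma S_bh p : low 1 p -> uvps bern p * uvps nhh p = 1.
Proof. by move=> lp; rewrite -S_mul // ps_bern_hh //; apply: mul_fmap. Qed.

Lemma S_e p : low 1 p -> uvps nexp p = 1 + p * uvps nhh p.
Proof. by move=> lp; rewrite {1}/uvps ps_exp //; apply: mul_fmap. Qed.

Lemma S_eD p q : low 1 p -> low 1 q -> uvps nexp (p + q) = uvps nexp p * uvps nexp q.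
Proof.
move=> lp lq; rewrite -S_mul // -exp_add; try exact: mul_fmap.
  by apply: eq_csum => n; congr (_ *: _); elim: n => //= n ->; rewrite mulrDl.
by move=> z; rewrite mulrCA.
Qed.

(* The coefficients of (b(u) - 1) / u, where b(u) = u / (e^u - 1). *)
Definition ng (n : nat) : rat := bern n.+1.

Lemma S_g p : low 1 p -> uvps bern p = 1 + p * uvps ng p.
Proof. by move=> lp; rewrite {1}/uvps ps_split ?scale1r //; apply: mul_fmap. Qed.

(* ddn p q n = (p ^ n - q ^ n) / (p - q), hence DD is the divided difference. *)
Fixpoint ddn p q n : uvser := if n is n.+1 then q ^+ n + p * ddn p q n else 0.

Lemma ddnP p q n : (p - q) * ddn p q n = p ^+ n - q ^+ n.
Proof.
elim: n => [|n IH] /=; first by rewrite mulr0 !expr0 subrr.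
rewrite mulrDr mulrCA IH !exprS; ring.
Qed.

Lemma low_X p n : low 1 p -> low n (p ^+ n).
Proof.
move=> lp; elim: n => [|n IH]; first exact: low0z.
by rewrite exprS -add1n; apply: mul_low.
Qed.

Lemma low_ddn p q n : low 1 p -> low 1 q -> low n (ddn p q n.+1).
Proof.
move=> lp lq; elim: n => [|n IH]; first exact: low0z.
rewrite [ddn _ _ _]/=; apply: lowD; first exact: low_X.
by rewrite -[n.+1]add1n; apply: mul_low.
Qed.

Definition DD (c : nat -> rat) p q := csum (fun n => c n.+1 *: ddn p q n.+1).

Lemma S_csum c p : uvps c p = csum (fun n => c n *: p ^+ n).
Proof.
apply: eq_csum => n; congr (_ *: _); elim: n => //= n ->.
by rewrite exprS.
Qed.

Lemma DDP c p q : low 1 p -> low 1 q -> (p - q) * DD c p q = uvps c p - uvps c q.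
Proof.
move=> lp lq; have lpq : low 1 (p - q) by apply: lowB.
rewrite (fmap_csum (mul_fmap lpq)) => [|n]; last exact/lowZ/low_ddn.
have sX (r : uvser) : low 1 r -> summable (fun n => c n *: r ^+ n).
  by move=> lr n; apply/lowZ/low_X.
rewrite !S_csum (csum_shift (sX _ lp)) (csum_shift (sX _ lq)) !expr0.
rewrite opprD addrACA subrr add0r -csumB.
by apply: eq_csum => n; rewrite -scalerAr ddnP scalerBr.
Qed.

End Uvser.

Section Action.
Variables (V : lmodType rat) (g : grading V) (a c : compl g -> compl g).
Hypotheses (aF : fmap 1 a) (cF : fmap 1 c) (ac : forall z, a (c z) = c (a z)).
Implicit Types (f h p q : uvser) (z : compl g).

(* The action of f(u, v) through u |-> a, v |-> c. *)
Definition act f z := csum (fun d =>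
  \sum_(m < d.+1) (f d)`_m *: iter (d - m) a (iter m c z)).

Lemma act_low n f z m : low n f -> low m z -> low (m + n) (act f z).
Proof.
move=> lf lz; apply: low_csum => d; apply: low_sum => k _.
have [dn|nd] := ltnP d n; first by rewrite lf // coef0 scale0r; apply: low_zero.
apply: lowZ; have := iter_low aF (k := d - k) (iter_low cF (k := k) lz).
by move/low_le; apply; have := ltn_ord k; lia.
Qed.

Lemma act_fmapl z : fmap 0 (act^~ z).
Proof.
split=> [b f h|n f lf]; last by rewrite addn0; apply: (act_low lf (low0z z)).
rewrite /act -csumZ -csumD; apply: eq_csum => d.
rewrite scaler_sumr -big_split; apply: eq_bigr => m _.
by rewrite [_ d]complD complZ coefD coefZ scalerDl scalerA.
Qed.

Lemma actD f h z : act (f + h) z = act f z + act h z.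
Proof. exact: (linD (act_fmapl z).1). Qed.
Lemma actN f z : act (- f) z = - act f z.
Proof. exact: (linN (act_fmapl z).1). Qed.

Lemma act_summable f z : summable (fun d =>
  \sum_(m < d.+1) (f d)`_m *: iter (d - m) a (iter m c z)).
Proof.
move=> d; apply: low_sum => k _; apply: lowZ.
have := iter_low aF (k := d - k) (iter_low cF (k := k) (low0z z)).
by move/low_le; apply; have := ltn_ord k; lia.
Qed.

Lemma act1 z : act 1 z = z.
Proof.
apply: compl_ext => d; rewrite csumE big_ord_recl big_ord1 /= coef1 scale1r.
rewrite big1 ?addr0 // => i _; rewrite compl_sum big1 // => m _.
by rewrite coef0 scale0r.
Qed.

Lemma iter_comm n z : iter n a (c z) = c (iter n a z).
Proof. by elim: n => //= n ->. Qed.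
Lemma iter_comm' n z : iter n c (a z) = a (iter n c z).
Proof. by elim: n => //= n ->. Qed.

Lemma act_u f z : act (uv_u * f) z = a (act f z).
Proof.
rewrite {1}/act (csum_shift (act_summable (uv_u * f) z)) big_ord1 mul_uE coef0 scale0r add0r.
rewrite (fmap_csum aF (act_summable f z)); apply: eq_csum => d.
rewrite mul_uE big_ord_recr /= nth_default ?scale0r ?addr0; last exact: (complP f d).
rewrite (lin_sum aF.1); apply: eq_bigr => m _; rewrite (linZ aF.1); congr (_ *: _).
by rewrite subSn // -ltnS.
Qed.

Lemma act_v f z : act (uv_v * f) z = c (act f z).
Proof.
rewrite {1}/act (csum_shift (act_summable (uv_v * f) z)) big_ord1 mul_vE coef0 scale0r add0r.
rewrite (fmap_csum cF (act_summable f z)); apply: eq_csum => d.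
rewrite mul_vE big_ord_recl coefXM scale0r add0r (lin_sum cF.1).
apply: eq_bigr => m _; rewrite (linZ cF.1) coefXM /= iter_comm.
by rewrite /bump add1n subSS.
Qed.

Lemma act_ar f z : act f (a z) = a (act f z).
Proof.
rewrite (fmap_csum aF (act_summable f z)); apply: eq_csum => d.
rewrite (lin_sum aF.1); apply: eq_bigr => m _; rewrite (linZ aF.1).
by rewrite iter_comm' -iterSr.
Qed.

Lemma act_cr f z : act f (c z) = c (act f z).
Proof.
rewrite (fmap_csum cF (act_summable f z)); apply: eq_csum => d.
rewrite (lin_sum cF.1); apply: eq_bigr => m _; rewrite (linZ cF.1).
by rewrite -iter_comm -iterSr.
Qed.

(** A scalar series c(p) acts as the operator series c(P), where P is the operator by which p acts;
    this carries identities from Q[[u, v]] to operators. *)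
Lemma act_S b p P f z : low 1 p -> (forall f z, act (p * f) z = P (act f z)) ->
  act (uvps b p * f) z = ps P b (act f z).
Proof.
move=> lp pP; rewrite -S_mul //.
exact: (ps_comm b f (mul_fmap lp) (act_fmapl z) (fun f => pP f z)).
Qed.

End Action.

Section BernoulliIdentities.
Implicit Types p q : uvser.

Lemma S_hN p : low 1 p -> p * uvps nhh (- p) = 1 - uvps nexp (- p).
Proof. by move=> lp; rewrite (S_e (uv_lowN lp)); ring. Qed.

Lemma S_e_bern p : low 1 p -> p = uvps bern p * (uvps nexp p - 1).
Proof.
move=> lp; rewrite S_e //; transitivity (p * (uvps bern p * uvps nhh p)); last by ring.
by rewrite S_bh // mulr1.
Qed.

Lemma S_eN p : low 1 p -> uvps nexp p * uvps nexp (- p) = 1.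
Proof.
move=> lp; rewrite -S_eD // ?subrr; last exact: uv_lowN.
rewrite S_e ?mul0r ?addr0 //; exact: low_zero.
Qed.

Lemma S_bernN_u : uvps bern (- uv_u) = uvps bern uv_u + uv_u.
Proof.
have lu := low_u; have lN := uv_lowN lu.
suff e : (uvps bern uv_u + uv_u) * uvps nhh (- uv_u) = 1.
  rewrite -[RHS]mulr1 -(S_bh lN) [uvps bern (- _) * _]mulrC [RHS]mulrA e.
  by rewrite mul1r.
apply: uv_uI; rewrite mulr1 mulrCA S_hN //; have uE := S_e_bern lu.
set B := uvps bern _ in uE *; set E := uvps nexp uv_u in uE *; set F := uvps nexp _.
have EF : E * F = 1 by apply: S_eN.
have : (B + B * (E - 1)) * (1 - F) = B * (E - 1).
  transitivity (B * E - B * (E * F)); first by ring.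
  by rewrite EF; ring.
by rewrite -uE.
Qed.

Lemma S_ngN_u : uvps ng (- uv_u) = - uvps ng uv_u - 1.
Proof.
have lu := low_u; have lN := uv_lowN lu; apply: uv_uI.
have h1 := S_g lu; have h2 := S_g lN; have h3 := S_bernN_u.
rewrite h1 h2 in h3.
have -> : uv_u * uvps ng (- uv_u) = 1 - (1 + - uv_u * uvps ng (- uv_u)) by ring.
by rewrite h3; ring.
Qed.

(** With b(p) = p / (e^p - 1), substitute p = b(p) (e^p - 1) in e^(p+q) - 1 = (e^p - 1)(e^q - 1) +
    (e^p - 1) + (e^q - 1). *)
Lemma S_bern_add p q : low 1 p -> low 1 q ->
  (p + q) * (uvps bern p * uvps bern q) =
  uvps bern (p + q) * (p * q + p * uvps bern q + q * uvps bern p).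
Proof.
move=> lp lq; have lpq := uv_lowD lp lq.
have pE := S_e_bern lp; have qE := S_e_bern lq; have pqE := S_e_bern lpq.
rewrite S_eD // in pqE.
set P := uvps bern p in pE *; set Q := uvps bern q in qE *; set B := uvps bern (p + q) in pqE *.
set e := uvps nexp p in pE pqE; set f := uvps nexp q in qE pqE.
have : B * (e * f - 1) * (P * Q) = B * (P * (e - 1) * (Q * (f - 1))
  + P * (e - 1) * Q + Q * (f - 1) * P) by ring.
by rewrite -pE -qE -pqE.
Qed.

Let lu := low_u.
Let lv := low_v.
Let luv := uv_lowD lu lv.

(* This is the coefficient with which [t13, t12] enters
   [t01, t02 + t12] - [y1, y2] when u, v act by - ad x2, - ad x3. *)
Lemma fay_identity :
  - DD ng (uv_u + uv_v) uv_u - DD ng (- uv_u) uv_v - DD ng (uv_u + uv_v) uv_v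
  - uvps ng (uv_u + uv_v) * uvps ng uv_v + uvps ng uv_u * uvps ng uv_v
  + uvps ng (uv_u + uv_v) * uvps ng (- uv_u) = 0.
Proof.
have d1 := DDP ng luv lu; have d2 := DDP ng (uv_lowN lu) lv; have d3 := DDP ng luv lv.
have b := S_bern_add lu lv; move: b d1 d2 d3.
rewrite (S_g lu) (S_g lv) (S_g luv) S_ngN_u.
set D1 := DD _ _ uv_u; set D2 := DD _ (- _) _; set D3 := DD _ _ uv_v.
set G := uvps ng (_ + _); set gu := uvps ng uv_u; set gv := uvps ng uv_v.
have -> : uv_u + uv_v - uv_u = uv_v by ring.
have -> : uv_u + uv_v - uv_v = uv_u by ring.
move=> b d1 d2 d3.
(* The arguments of the three divided differences differ by v, - (u + v) and u. Clearing u v (u + v)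
   removes them all and leaves the addition formula for b. *)
apply: uv_uI; apply: uv_vI; apply: uv_uvI.
transitivity (- ((uv_u + uv_v) * uv_u) * (uv_v * D1) + uv_u * uv_v * ((- uv_u - uv_v) * D2)
  - (uv_u + uv_v) * uv_v * (uv_u * D3)
  + (uv_u + uv_v) * uv_u * uv_v * (- G * gv + gu * gv + G * (- gu - 1))); first by ring.
rewrite d1 d2 d3.
transitivity ((uv_u + uv_v) * ((1 + uv_u * gu) * (1 + uv_v * gv)) -
  (1 + (uv_u + uv_v) * G) * (uv_u * uv_v + uv_u * (1 + uv_v * gv) + uv_v * (1 + uv_u * gu))).
  by ring.
by rewrite b subrr; ring.
Qed.

End BernoulliIdentities.

Section OperatorBernoulli.
Variables (V : lmodType rat) (g : grading V) (a : compl g -> compl g).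
Hypothesis aF : fmap 1 a.

(** Letting v act by 0 makes Q[[u, v]] act through the single operator a, so that identities in u
    alone become identities between operator series. *)
Let o : compl g -> compl g := fun=> 0.
Let oF : fmap 1 o.
Proof. by split=> [c x y|n z _]; [rewrite scaler0 addr0|apply: low_zero]. Qed.
Let A f z : act a o (uv_u * f) z = a (act a o f z). Proof. exact: act_u. Qed.
Let AN f z : act a o (- uv_u * f) z = - a (act a o f z).
Proof. by rewrite mulNr (linN (act_fmapl aF oF z).1) A. Qed.

Lemma ps_bernN z : ps (fun z => - a z) bern z = ps a bern z + a z.
Proof.
have -> : ps (fun z => - a z) bern z = act a o (uvps bern (- uv_u) * 1) z.
  by rewrite (act_S (P := fun z => - a z) aF oF _ _ _ (uv_lowN low_u) AN) act1.
have -> : ps a bern z + a z = act a o ((uvps bern uv_u + uv_u) * 1) z.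
  rewrite mulrDl (linD (act_fmapl aF oF z).1) (act_S aF oF _ _ _ low_u A).
  by rewrite A act1.
by rewrite S_bernN_u.
Qed.

Lemma ps_ngN z : ps (fun z => - a z) ng z = - ps a ng z - z.
Proof.
have -> : ps (fun z => - a z) ng z = act a o (uvps ng (- uv_u) * 1) z.
  by rewrite (act_S (P := fun z => - a z) aF oF _ _ _ (uv_lowN low_u) AN) act1.
rewrite S_ngN_u mulrBl mulNr (linB (act_fmapl aF oF z).1) (linN (act_fmapl aF oF z).1).
by rewrite (act_S aF oF _ _ _ low_u A) mulr1 act1.
Qed.

Lemma ps_hh_bernN z : ps a nhh (ps (fun z => - a z) bern z) = ps a nexp z.
Proof.
by rewrite ps_bernN (linD (ps_fmap aF nhh).1) ps_hh_bern // ps_op // ps_exp.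
Qed.

End OperatorBernoulli.

Lemma subv_uv : uv_u + uv_v - uv_u = uv_v. Proof. by ring. Qed.

(** * The elements t_0i attached to three commuting x_i *)

Section ThreePoints.
Variables (L : lieType) (g : lieGrading L).
Local Notation LL := (compl g).

Definition T0 (x y : LL) : LL := - ps (lbra x) bern y.

Variables X1 X2 X3 Y1 Y2 Y3 T12 T13 T23 : LL.
Hypotheses (l1 : low 1 X1) (l2 : low 1 X2) (l3 : low 1 X3).
Hypotheses (X12 : <[X1, X2]> = 0) (X13 : <[X1, X3]> = 0) (X23 : <[X2, X3]> = 0).
Hypothesis Xsum : X1 + X2 + X3 = 0.
Hypotheses (X3T : <[X3, T12]> = 0) (X2T : <[X2, T13]> = 0) (X1T : <[X1, T23]> = 0).

Let a1F := ad_fmap l1.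
Let a2F := ad_fmap l2.

Lemma X12T : <[X1 + X2, T12]> = 0.
Proof. by have := Xsum => /eqP; rewrite addr_eq0 => /eqP ->; rewrite lbraNl X3T oppr0. Qed.

Lemma adX2_T12 p : ps (lbra X2) p T12 = ps (fun z => - <[X1, z]>) p T12.
Proof. by rewrite -lbraN; apply: ps_adN; [apply: lbra_eq0C|rewrite addrC X12T]. Qed.

(* This and its converse exp_T02_inv trade [x_1, y_2] = t_12 for
   e^{ad x_1} (t_02 + t_12) = t_02. *)
Lemma exp_T02 : <[X1, Y2]> = T12 ->
  ps (lbra X1) nexp (T0 X2 Y2 + T12) = T0 X2 Y2.
Proof.
move=> XY; rewrite (linD (ps_fmap a1F nexp).1) [X in X + _]ps_exp // -ps_op //.
rewrite /T0 lbraNr (ps_comm (b := lbra X1) _ _ a2F a1F (fun z => lbra_comm z X12)).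
rewrite XY (linN (ps_fmap a1F nhh).1) adX2_T12 ps_hh_bernN //.
by rewrite subrK.
Qed.

Lemma exp_T02_inv :
  ps (lbra X1) nexp (T0 X2 Y2 + T12) = T0 X2 Y2 -> <[X1, Y2]> = T12.
Proof.
move=> e; suff : ps (lbra X2) bern <[X1, Y2]> = ps (lbra X2) bern T12.
  by move=> /(congr1 (ps (lbra X2) nhh)); rewrite !ps_hh_bern.
rewrite -(ps_comm (b := lbra X1) _ _ a2F a1F (fun z => lbra_comm z X12)) adX2_T12.
apply: oppr_inj; apply: (ps_hh_inj a1F).
rewrite -lbraNr -/(T0 X2 Y2) (linN (ps_fmap a1F nhh).1) ps_hh_bernN // ps_op //.
apply: (addrI (T0 X2 Y2)); rewrite -ps_exp // -{2}e (linD (ps_fmap a1F nexp).1).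
by rewrite addrK.
Qed.

(** Writing b(u) = 1 + u g(u) exposes one factor ad x_1 next to y_1, which the hypothesis on
    [x_1, y_1] replaces by the t_1j. *)
Lemma T0E Y : <[X1, Y]> = - (T12 + T13) ->
  T0 X1 Y = - Y + ps (lbra X1) ng T12 + ps (lbra X1) ng T13.
Proof.
move=> XY; rewrite /T0 ps_split // scale1r -ps_op // XY.
rewrite (linN (ps_fmap a1F _).1) (linD (ps_fmap a1F _).1) opprD opprK -addrA.
by [].
Qed.

Lemma ngT12 : ps (lbra X2) ng T12 = - ps (lbra X1) ng T12 - T12.
Proof. by rewrite adX2_T12 ps_ngN. Qed.

End ThreePoints.

(** After [T0E] each t_ij occurs under both g(ad x_i) and g(ad x_j) = g(- ad x_i), and g(u) + g(- u)
    = - 1 cancels it against the term t_ij of the sum. *)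
Lemma T0_sum (L : lieType) (g : lieGrading L) (X1 X2 X3 Y1 Y2 Y3 T12 T13 T23 : compl g) :
  low 1 X1 -> low 1 X2 -> low 1 X3 ->
  <[X1, X2]> = 0 -> <[X1, X3]> = 0 -> <[X2, X3]> = 0 -> X1 + X2 + X3 = 0 ->
  <[X1, Y2]> = T12 -> <[X2, Y1]> = T12 -> <[X1, Y3]> = T13 -> <[X3, Y1]> = T13 ->
  <[X2, Y3]> = T23 -> <[X3, Y2]> = T23 ->
  <[X3, T12]> = 0 -> <[X2, T13]> = 0 -> <[X1, T23]> = 0 ->
  T0 X1 Y1 + T0 X2 Y2 + T0 X3 Y3 + T12 + T13 + T23 = - (Y1 + Y2 + Y3).
Proof.
move=> l1 l2 l3 X12 X13 X23 Xs XY12 XY21 XY13 XY31 XY23 XY32 X3T X2T X1T.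
have XY11 : <[X1, Y1]> = - (T12 + T13).
  have /eqP := Xs; rewrite -addrA addr_eq0 => /eqP ->.
  by rewrite lbraNl lbraDl XY21 XY31.
have XY22 : <[X2, Y2]> = - (T12 + T23).
  have /eqP := Xs; rewrite addrAC addrC addr_eq0 => /eqP ->.
  by rewrite lbraNl lbraDl XY12 XY32.
have XY33 : <[X3, Y3]> = - (T13 + T23).
  have /eqP := Xs; rewrite addrC addr_eq0 => /eqP ->.
  by rewrite lbraNl lbraDl XY13 XY23.
have Xs' : X1 + X3 + X2 = 0 by rewrite -Xs; zmod.
have Xs2 : X2 + X3 + X1 = 0 by rewrite -Xs; zmod.
rewrite (T0E l1 XY11) (T0E l2 XY22) (T0E l3 XY33).
rewrite (ngT12 l1 X12 Xs X3T) (ngT12 l1 X13 Xs' X2T) (ngT12 l2 X23 Xs2 X1T).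
by zmod.
Qed.

(** * The bracket of t_01 with t_02 + t_12 *)

Section Fay.
Variables (L : lieType) (g : lieGrading L).
Local Notation LL := (compl g).

(** Moving y through (ad x)^n s leaves the sum of (ad x)^i ad [y, x] (ad x)^(n-1-i) s. If the outer
    powers act by p and the inner ones amount to powers of q, this is (p^n - q^n) / (p - q), whence
    a divided difference. *)
Lemma divided_bra (a c : LL -> LL) (y x s F : LL) (k : rat) (p q : uvser) :
  fmap 1 a -> fmap 1 c -> low 1 x -> low 1 p -> low 1 q -> <[y, s]> = 0 ->
  (forall f, <[x, act a c f F]> = act a c (p * f) F) ->
  (forall n, <[<[y, x]>, iter n (lbra x) s]> = k *: act a c (q ^+ n) F) ->
  <[y, ps (lbra x) ng s]> = k *: act a c (DD ng p q) F.
Proof.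
move=> aF cF lx lp lq ys xF yF.
rewrite (fmap_csum (ad_fmapr y) (ps_summable (ad_fmap lx) _ s)).
have AF := act_fmapl aF cF F.
have -> : act a c (DD ng p q) F = csum (fun n => act a c (ng n.+1 *: ddn p q n.+1) F).
  by apply: (fmap_csum AF) => n; apply/lowZ/low_ddn.
have E n : <[y, iter n (lbra x) s]> = k *: act a c (ddn p q n) F.
  elim: n => [|n IH] /=; first by rewrite ys (lin0 AF.1) scaler0.
  by rewrite lbra_leibniz yF IH lbraZr xF (linD AF.1) scalerDr.
rewrite csum_shift => [|n].
  rewrite [iter 0 _ _]/= lbraZr ys scaler0 add0r -csumZ; apply: eq_csum => n.
  by rewrite lbraZr E (linZ AF.1) !scalerA mulrC.
by have := (ad_fmapr y).2 n _ (@ps_summable _ _ _ (ad_fmap lx) ng s n); rewrite addn0.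
Qed.

Variables X1 X2 X3 Y1 Y2 Y3 T12 T13 T23 : LL.
Hypotheses (l1 : low 1 X1) (l2 : low 1 X2) (l3 : low 1 X3).
Hypotheses (X12 : <[X1, X2]> = 0) (X13 : <[X1, X3]> = 0) (X23 : <[X2, X3]> = 0).
Hypotheses (Xsum : X1 + X2 + X3 = 0) (Ysum : Y1 + Y2 + Y3 = 0).
Hypotheses (XY12 : <[X1, Y2]> = T12) (XY21 : <[X2, Y1]> = T12)
  (XY13 : <[X1, Y3]> = T13) (XY31 : <[X3, Y1]> = T13)
  (XY23 : <[X2, Y3]> = T23) (XY32 : <[X3, Y2]> = T23).
Hypotheses (X3T : <[X3, T12]> = 0) (X2T : <[X2, T13]> = 0) (X1T : <[X1, T23]> = 0).
Hypotheses (Y3T : <[Y3, T12]> = 0) (Y2T : <[Y2, T13]> = 0) (Y1T : <[Y1, T23]> = 0).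

Let a1F := ad_fmap l1.
Let a2F := ad_fmap l2.
Let a3F := ad_fmap l3.

Let XY11 : <[X1, Y1]> = - (T12 + T13).
Proof.
have /eqP := Xsum; rewrite -addrA addr_eq0 => /eqP ->.
by rewrite lbraNl lbraDl XY21 XY31.
Qed.
Let XY22 : <[X2, Y2]> = - (T12 + T23).
Proof.
have /eqP := Xsum; rewrite addrAC addrC addr_eq0 => /eqP ->.
by rewrite lbraNl lbraDl XY12 XY32.
Qed.

Lemma T12_T13T23 : <[T12, T13 + T23]> = 0.
Proof.
have -> : T13 + T23 = - <[X3, Y3]>.
  have /eqP := Xsum; rewrite addrC addr_eq0 => /eqP ->.
  by rewrite lbraNl lbraDl XY13 XY23 opprK.
by rewrite lbraNr lbra_leibniz (lbra_eq0C X3T) (lbra_eq0C Y3T) lbrax0 lbra0x addr0 oppr0.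
Qed.

(** The generator of the module in which the computation ends: u and v act by - ad x_2 and - ad x_3,
    hence x_1 by u + v. The brackets of the t_ij are F up to sign, so the remaining brackets are
    f(u, v) F for explicit f. *)
Let F := <[T12, T13]>.
Let U : LL -> LL := lbra (- X2).
Let V : LL -> LL := lbra (- X3).
Let l2N : low 1 (- X2). Proof. exact: lowN. Qed.
Let l3N : low 1 (- X3). Proof. exact: lowN. Qed.
Let UF : fmap 1 U. Proof. exact: ad_fmap. Qed.
Let VF : fmap 1 V. Proof. exact: ad_fmap. Qed.
Let UV z : U (V z) = V (U z).
Proof. by apply: lbra_comm; rewrite lbraNl lbraNr opprK. Qed.
Let R f := act U V f F.
Let RL : linear R := (act_fmapl UF VF F).1.

Let Ru f : R (uv_u * f) = U (R f). Proof. exact: (act_u UF VF). Qed.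
Let Rv f : R (uv_v * f) = V (R f). Proof. exact: (act_v UF VF UV). Qed.
Let A2 f : <[X2, R f]> = R (- uv_u * f).
Proof. by rewrite mulNr (linN RL) Ru /U lbraNl opprK. Qed.
Let A1 f : <[X1, R f]> = R ((uv_u + uv_v) * f).
Proof.
have /eqP := Xsum; rewrite -addrA addr_eq0 => /eqP ->.
by rewrite opprD lbraDl mulrDl (linD RL) Ru Rv.
Qed.
Let FE : F = R 1. Proof. by rewrite /R (act1 U V). Qed.

Let T12T23 : <[T12, T23]> = - F.
Proof. by apply/eqP; rewrite -addr_eq0 -lbraDr addrC T12_T13T23. Qed.
Let T13T23 : <[T13, T23]> = F.
Proof.
have t : <[T13, T12 + T23]> = 0.
  have -> : T12 + T23 = - <[X2, Y2]> by rewrite XY22 opprK.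
  rewrite lbraNr lbra_leibniz (lbra_eq0C X2T) (lbra_eq0C Y2T).
  by rewrite lbrax0 lbra0x addr0 oppr0.
by have /eqP := t; rewrite lbraDr addrC addr_eq0 -lbraC => /eqP.
Qed.

Let luv := uv_lowD low_u low_v.
Let ac := act U V.
Let au f z : ac (uv_u * f) z = U (ac f z). Proof. exact: (act_u UF VF). Qed.
Let av f z : ac (uv_v * f) z = V (ac f z). Proof. exact: (act_v UF VF UV). Qed.
Let auv f z : ac ((uv_u + uv_v) * f) z = <[X1, ac f z]>.
Proof.
have /eqP := Xsum; rewrite -addrA addr_eq0 => /eqP ->.
by rewrite opprD lbraDl mulrDl /ac (actD UF VF) -/ac au av.
Qed.
Let aNu f z : ac (- uv_u * f) z = <[X2, ac f z]>.
Proof. by rewrite mulNr /ac (actN UF VF) -/ac au /U lbraNl opprK. Qed.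

Let RSu c f : R (uvps c uv_u * f) = ps U c (R f).
Proof. exact: (act_S UF VF _ _ _ low_u au). Qed.
Let RSv c f : R (uvps c uv_v * f) = ps V c (R f).
Proof. exact: (act_S UF VF _ _ _ low_v av). Qed.
Let RSuv c f : R (uvps c (uv_u + uv_v) * f) = ps (lbra X1) c (R f).
Proof. exact: (act_S UF VF _ _ _ luv auv). Qed.
Let RSNu c f : R (uvps c (- uv_u) * f) = ps (lbra X2) c (R f).
Proof. exact: (act_S UF VF _ _ _ (uv_lowN low_u) aNu). Qed.

Let X1T12 : <[X1 + X2, T12]> = 0.
Proof. by have /eqP := Xsum; rewrite addr_eq0 => /eqP ->; rewrite lbraNl X3T oppr0. Qed.
Let X1T13 : <[X1 + X3, T13]> = 0.
Proof.
have /eqP := Xsum; rewrite addrAC addr_eq0 => /eqP ->.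
by rewrite lbraNl X2T oppr0.
Qed.
Let X2T23 : <[X2 + X3, T23]> = 0.
Proof.
have /eqP := Xsum; rewrite -addrA addrC addr_eq0 => /eqP ->.
by rewrite lbraNl X1T oppr0.
Qed.

Let g1T12 := ps (lbra X1) ng T12.
Let g1T13 := ps (lbra X1) ng T13.
Let g2T23 := ps (lbra X2) ng T23.

Let X1g : <[X1, g2T23]> = 0.
Proof. exact: ps_ad_kill. Qed.
Let X2N_T13 : <[- X2, T13]> = 0. Proof. by rewrite lbraNl X2T oppr0. Qed.
Let X3N_T12 : <[- X3, T12]> = 0. Proof. by rewrite lbraNl X3T oppr0. Qed.

Let B1 : <[g1T12, g2T23]> = - R (uvps ng (uv_u + uv_v) * uvps ng uv_v).
Proof.
rewrite ps_ad_bral // /g2T23 (ps_adN _ X23 X2T23) ps_ad_brar // T12T23.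
rewrite (linN (ps_fmap VF _).1) (linN (ps_fmap a1F _).1).
by rewrite RSuv -[uvps ng uv_v]mulr1 RSv -FE.
Qed.

Let B2 : <[g1T12, g1T13]> = R (uvps ng uv_u * uvps ng uv_v).
Proof.
rewrite /g1T12 /g1T13 (ps_adN _ X12 X1T12) (ps_adN _ X13 X1T13).
rewrite ps_ad_bral //; last first.
  by apply: ps_ad_kill => //; rewrite lbraNl lbraNr opprK.
by rewrite ps_ad_brar // RSu -[uvps ng uv_v]mulr1 RSv -FE.
Qed.

Let B3 : <[g1T13, g2T23]> = R (uvps ng (uv_u + uv_v) * uvps ng (- uv_u)).
Proof.
rewrite ps_ad_bral // ps_ad_brar // T13T23.
by rewrite RSuv -[uvps ng (- _)]mulr1 RSNu -FE.
Qed.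

Let RuX n : R (uv_u ^+ n) = iter n U F.
Proof. by elim: n => [|n IH]; rewrite ?expr0 ?FE //= exprS Ru IH FE. Qed.
Let RvX n : R (uv_v ^+ n) = iter n V F.
Proof. by elim: n => [|n IH]; rewrite ?expr0 ?FE //= exprS Rv IH FE. Qed.

Let C3 : <[Y3, g1T12]> = R (DD ng (uv_u + uv_v) uv_u).
Proof.
rewrite -[RHS]scale1r; apply: (divided_bra UF VF) low_u Y3T A1 _ => // n.
rewrite scale1r [act _ _ _ _]RuX [<[Y3, _]>]lbraC XY13 lbraNl -lbraC.
by rewrite (iter_adN n X12 X1T12) iter_bral.
Qed.

Let C1 : <[Y1, g2T23]> = R (DD ng (- uv_u) uv_v).
Proof.
rewrite -[RHS]scale1r; apply: (divided_bra UF VF) low_v Y1T A2 _ => // [|n].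
  exact: uv_lowN low_u.
rewrite scale1r [act _ _ _ _]RvX [<[Y1, _]>]lbraC XY21 lbraNl.
rewrite (iter_adN n X23 X2T23) iter_brar // T12T23.
by rewrite (linN (iter_linear n VF.1)) opprK.
Qed.

Let C2 : <[Y2, g1T13]> = - R (DD ng (uv_u + uv_v) uv_v).
Proof.
rewrite -scaleN1r; apply: (divided_bra UF VF) low_v Y2T A1 _ => // n.
rewrite scaleN1r [act _ _ _ _]RvX [<[Y2, _]>]lbraC XY12 lbraNl.
by rewrite (iter_adN n X13 X1T13) iter_brar.
Qed.

(** The right side is kept as [y_1, y_2] so that the lemma works in both directions: it gives
    [t_01, t_02 + t_12] = 0 when the y's commute, and the commutation of deformed y's from the
    deformed relation. *)
Lemma bra_T0 : <[T0 X1 Y1, T0 X2 Y2 + T12]> = <[Y1, Y2]>.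
Proof.
rewrite (T0E l1 XY11) (T0E l2 XY22) (ngT12 l1 X12 Xsum X3T).
rewrite -/g1T12 -/g1T13 -/g2T23.
have -> : - Y2 + (- g1T12 - T12) + g2T23 + T12 = - Y2 - g1T12 + g2T23 by zmod.
rewrite !lbraDl !lbraDr !lbraNl !lbraNr lbraxx B1 B3 [<[g1T13, g1T12]>]lbraC B2 C1.
rewrite [<[g1T12, Y2]>]lbraC [<[g1T13, Y2]>]lbraC C2 !opprK.
(* Neither [y_1, g t_12] nor [y_2, g t_12] is a multiple of F; only their sum is, through y_1 + y_2
   = - y_3 and [y_3, t_12] = 0. *)
have Y1g : <[Y1, g1T12]> = - <[Y2, g1T12]> - R (DD ng (uv_u + uv_v) uv_u).
  by have /eqP := Ysum; rewrite -addrA addr_eq0 => /eqP ->; rewrite lbraNl lbraDl C3 opprD.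
rewrite Y1g -[RHS]addr0 -[in RHS](lin0 RL) -fay_identity.
by rewrite !(linD RL) !(linN RL); zmod.
Qed.

End Fay.

(** * Dual numbers *)

Section Dual.
Variable L : lieType.

(* L + eps L with eps^2 = 0; a derivation D corresponds to the morphism
   x |-> x + eps D x. *)
Definition dual := (L * L)%type.
HB.instance Definition _ := GRing.Lmodule.on dual.

Definition dual_bra (x y : dual) : dual :=
  (<[x.1, y.1]>, <[x.1, y.2]> + <[x.2, y.1]>).

Fact dual_linl y : linear (dual_bra^~ y).
Proof.
move=> a x z; congr pair; rewrite /= !lbraDl !lbraZl //.
by rewrite scalerDr addrACA.
Qed.
Fact dual_linr x : linear (dual_bra x).
Proof.
move=> a y z; congr pair; rewrite /= !lbraDr !lbraZr //.
by rewrite scalerDr addrACA.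
Qed.
Fact dual_xx x : dual_bra x x = 0.
Proof. by congr pair; rewrite ?lbraxx //= [X in X + _]lbraC addNr. Qed.
Fact dual_jacobi x y z :
  dual_bra x (dual_bra y z) + dual_bra y (dual_bra z x) + dual_bra z (dual_bra x y) = 0.
Proof.
case: x y z => [x x'] [y y'] [z z']; congr pair; rewrite /= ?lbra_jacobi // !lbraDr.
have j1 := lbra_jacobi x' y z; have j2 := lbra_jacobi x y' z.
have j3 := lbra_jacobi x y z'.
transitivity ((<[x', <[y, z]>]> + <[y, <[z, x']>]> + <[z, <[x', y]>]>)
  + (<[x, <[y', z]>]> + <[y', <[z, x]>]> + <[z, <[x, y']>]>)
  + (<[x, <[y, z']>]> + <[y, <[z', x]>]> + <[z', <[x, y]>]>)); first by zmod.
by rewrite j1 j2 j3 !addr0.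
Qed.
HB.instance Definition _ := isLie.Build dual dual_linl dual_linr dual_xx dual_jacobi.

Variable g : lieGrading L.

Definition dual_gpart d (x : dual) : Prop := g d x.1 /\ g d x.2.
Fact dual_gpart0 d : dual_gpart d 0.
Proof. by split; apply: gpart0. Qed.
Fact dual_gpartD d x y : dual_gpart d x -> dual_gpart d y -> dual_gpart d (x + y).
Proof. by move=> [? ?] [? ?]; split; apply: gpartD. Qed.
Fact dual_gpartZ d a x : dual_gpart d x -> dual_gpart d (a *: x).
Proof. by move=> [? ?]; split; apply: gpartZ. Qed.
Fact dual_gpart_bra m n x y :
  dual_gpart m x -> dual_gpart n y -> dual_gpart (m + n) <[x, y]>.
Proof.
by move=> [? ?] [? ?]; split; [|apply: gpartD]; apply: gpart_bra.
Qed.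
Definition dual_grading : lieGrading dual :=
  @LieGrading dual (Grading dual_gpart0 dual_gpartD dual_gpartZ) dual_gpart_bra.

Implicit Types (x y d z w : compl g).

Fact cpair_subproof z w n : dual_grading n (z n, w n).
Proof. by split; apply: complP. Qed.
Definition cpair z w : compl dual_grading := mkcompl (cpair_subproof z w).
Definition cfst (u : compl dual_grading) : compl g := mkcompl (fun n => (complP u n).1).
Definition csnd (u : compl dual_grading) : compl g := mkcompl (fun n => (complP u n).2).

Lemma cpair_eta u : u = cpair (cfst u) (csnd u).
Proof. by apply: compl_ext => n /=; case: (u n). Qed.
Lemma cfst_pair z w : cfst (cpair z w) = z. Proof. exact: compl_ext. Qed.
Lemma csnd_pair z w : csnd (cpair z w) = w. Proof. exact: compl_ext. Qed.
Lemma cpairD z w z' w' : cpair z w + cpair z' w' = cpair (z + z') (w + w').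
Proof. exact: compl_ext. Qed.
Lemma cpairZ a z w : a *: cpair z w = cpair (a *: z) (a *: w).
Proof. exact: compl_ext. Qed.
Lemma cpair0 : cpair 0 0 = 0.
Proof. exact: compl_ext. Qed.
Lemma cfst_fmap : fmap 0 cfst.
Proof.
split=> [a u v|n u lu k kn]; first exact: compl_ext.
by rewrite /= lu // -[n]addn0.
Qed.
Lemma csnd_fmap : fmap 0 csnd.
Proof.
split=> [a u v|n u lu k kn]; first exact: compl_ext.
by rewrite /= lu // -[n]addn0.
Qed.
Lemma cpair_low n z w : low n z -> low n w -> low n (cpair z w).
Proof. by move=> lz lw k kn; rewrite /= lz // lw. Qed.

Lemma pair_sum I (r : seq I) (P : pred I) (F : I -> dual) :
  \sum_(i <- r | P i) F i = (\sum_(i <- r | P i) (F i).1, \sum_(i <- r | P i) (F i).2).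
Proof. by elim/big_rec3: _ => // i a b c _ ->. Qed.

Lemma cpair_bra z w z' w' :
  <[cpair z w, cpair z' w']> = cpair <[z, z']> (<[z, w']> + <[w, z']>).
Proof.
apply: compl_ext => n; rewrite [LHS]/= /cauchy pair_sum; congr pair.
by rewrite [RHS]complD /= /cauchy -big_split.
Qed.

Lemma cfst_ps x d p u : low 1 x -> low 1 d ->
  cfst (ps (lbra (cpair x d)) p u) = ps (lbra x) p (cfst u).
Proof.
move=> lx ld; apply: (ps_comm _ _ (ad_fmap (cpair_low lx ld)) cfst_fmap) => v.
by rewrite [v]cpair_eta cpair_bra !cfst_pair.
Qed.

(** To first order e^{x + eps d} is (1 + eps h) e^x with h = (e^{ad x} - 1) / ad x applied to d, and
    conjugation by 1 + eps h adds the bracket with h. *)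
Lemma exp_dual x d z w : low 1 x -> low 1 d ->
  ps (lbra (cpair x d)) nexp (cpair z w) =
  cpair (ps (lbra x) nexp z)
        (ps (lbra x) nexp w + <[ps (lbra x) nhh d, ps (lbra x) nexp z]>).
Proof.
move=> lx ld; have lX := cpair_low lx ld.
rewrite [LHS]cpair_eta cfst_ps // cfst_pair; congr cpair.
rewrite (fmap_csum csnd_fmap (ps_summable (ad_fmap lX) _ _)).
have aF := ad_fmap lx.
rewrite -(hh_bil (@lbra_fbil L g) aF aF aF (fun y z => lbra_leibniz x y z)).
(* The eps part of the k-th power of ad (x + eps d) inserts ad d once, at each of the k places. *)
have E k : iter k (lbra (cpair x d)) (cpair z w) = cpair (iter k (lbra x) z)
    (iter k (lbra x) w + \sum_(i < k) iter i (lbra x) <[d, iter (k.-1 - i) (lbra x) z]>).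
  elim: k => [|k IH]; first by rewrite big_ord0 addr0.
  rewrite iterS IH cpair_bra; congr cpair; rewrite lbraDr -addrA; congr (_ + _).
  rewrite lbra_sumr [RHS]big_ord_recl /= subn0 addrC; congr (_ + _).
  by apply: eq_bigr => i _; rewrite /bump /= add1n; congr (<[_, iter _ _ <[_, iter _ _ _]>]>); lia.
transitivity (csum (fun k => nexp k *: iter k (lbra x) w) + csum (fun k =>
    nexp k *: \sum_(i < k) iter i (lbra x) <[d, iter (k.-1 - i) (lbra x) z]>)).
  by rewrite -csumD; apply: eq_csum => k; rewrite E cpairZ csnd_pair scalerDr.
congr (_ + _); rewrite csum_shift; first by rewrite big_ord0 scaler0 add0r.
case=> [|k]; first exact: low0z.
apply/lowZ/low_sum => i _.
have := iter_low aF (k := i) (lbra_low ld (iter_low aF (k := k - i) (low0z z))).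
by move/low_le; apply; have := ltn_ord i; lia.
Qed.

(** The inner automorphism e^{eps ad psi} of the dual numbers. *)
Definition gauge (psi : compl g) (u : compl dual_grading) : compl dual_grading :=
  cpair (cfst u) (csnd u + <[psi, cfst u]>).

Lemma gauge_pair psi z w : gauge psi (cpair z w) = cpair z (w + <[psi, z]>).
Proof. by rewrite /gauge cfst_pair csnd_pair. Qed.

Lemma gauge_morph psi : lie_morphism (gauge psi).
Proof.
split=> [a u v|u v].
  rewrite [u]cpair_eta [v]cpair_eta cpairZ cpairD !gauge_pair cpairZ cpairD.
  by congr cpair; rewrite lbraDr lbraZr; zmod.
rewrite [u]cpair_eta [v]cpair_eta cpair_bra !gauge_pair cpair_bra; congr cpair.
by rewrite lbra_leibniz !lbraDr !lbraDl; zmod.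
Qed.

Lemma gauge_fmap psi : fmap 0 (gauge psi).
Proof.
split=> [|n u lu]; first exact: (gauge_morph psi).1.
have l1 := cfst_fmap.2 _ _ lu; have l2 := csnd_fmap.2 _ _ lu.
by apply: cpair_low => //; apply: lowD => //; apply: (ad_fmapr psi).2; rewrite -[n]addn0.
Qed.

End Dual.

(** * The relations of grt_1 *)

Section Morphisms.
Variables (G : Type) (R : lterm G -> lterm G -> Prop).

Lemma lie_morphism_ext (L : lieType) (f h : presLie R -> L) :
  lie_morphism f -> lie_morphism h -> (forall g, f (lgen R g) = h (lgen R g)) -> f =1 h.
Proof.
move=> [fL fB] [hL hB] e; elim/lclassW; elim=> [g||s IHs t IHt|a s IH|s IHs t IHt].
- exact: e.
- by rewrite lclass_zero !lin0.
- by rewrite lclass_add !linD // IHs IHt.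
- by rewrite lclass_scale !linZ // IH.
- by rewrite lclass_bra fB hB IHs IHt.
Qed.

Lemma lie_der_ext (L : lieType) (f d e : presLie R -> L) :
  linear d -> linear e ->
  (forall x y, d <[x, y]> = <[d x, f y]> + <[f x, d y]>) ->
  (forall x y, e <[x, y]> = <[e x, f y]> + <[f x, e y]>) ->
  (forall g, d (lgen R g) = e (lgen R g)) -> d =1 e.
Proof.
move=> dL eL dB eB h; elim/lclassW; elim=> [g||s IHs t IHt|a s IH|s IHs t IHt].
- exact: h.
- by rewrite lclass_zero !lin0.
- by rewrite lclass_add !linD // IHs IHt.
- by rewrite lclass_scale !linZ // IH.
- by rewrite lclass_bra dB eB IHs IHt.
Qed.

End Morphisms.

Lemma lie_morphism_comp (L M N : lieType) (f : M -> N) (h : L -> M) :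
  lie_morphism f -> lie_morphism h -> lie_morphism (fun x => f (h x)).
Proof.
move=> [fL fB] [hL hB]; split=> [a x y|x y]; first by rewrite hL fL.
by rewrite hB fB.
Qed.

Section F2Eval.
Variable L : lieType.
Implicit Types (A B C z : L) (psi : f2).

Lemma f2_evalL A B : linear (f2_eval A B).
Proof. by case: (f2_evalP A B) => -[]. Qed.
Lemma f2_evalB A B x y : f2_eval A B <[x, y]> = <[f2_eval A B x, f2_eval A B y]>.
Proof. by case: (f2_evalP A B) => -[]. Qed.
Lemma f2_evalA A B : f2_eval A B fA = A. Proof. by case: (f2_evalP A B). Qed.
Lemma f2_evalBB A B : f2_eval A B fB = B. Proof. by case: (f2_evalP A B). Qed.

Lemma f2_eval_comm A B z psi : <[z, A]> = 0 -> <[z, B]> = 0 -> <[z, f2_eval A B psi]> = 0.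
Proof.
move=> zA zB; have dz := lbra_linr z.
have L0 : linear (fun x : f2 => <[z, f2_eval A B x]>).
  by move=> a x y; rewrite f2_evalL dz.
apply: (lie_der_ext (f := f2_eval A B) (e := fun=> 0) L0) psi.
- by move=> a x y; rewrite scaler0 addr0.
- by move=> x y; rewrite f2_evalB lbra_leibniz.
- by move=> x y; rewrite lbra0x lbrax0 addr0.
by case; rewrite -/fA -/fB ?f2_evalA ?f2_evalBB.
Qed.

End F2Eval.

Lemma f2_eval_morph (L M : lieType) (f : L -> M) A B psi : lie_morphism f ->
  f (f2_eval A B psi) = f2_eval (f A) (f B) psi.
Proof.
move=> fM; apply: (lie_morphism_ext (f := fun x => f (f2_eval A B x))).
- by apply: lie_morphism_comp => //; case: (f2_evalP A B).
- by case: (f2_evalP (f A) (f B)).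
by case; rewrite -/fA -/fB ?f2_evalA ?f2_evalBB.
Qed.

(** The relations of t_n, with an arbitrary index type so that a strand 0 can be adjoined as
    [None]. *)
Definition t_family (I : eqType) (L : lieType) (F : I -> I -> L) : Prop :=
  [/\ forall i j, i != j -> F i j = F j i,
      forall i j k, uniq [:: i; j; k] -> <[F i j, F i k + F j k]> = 0
    & forall i j k l, uniq [:: i; j; k; l] -> <[F i j, F k l]> = 0].

Lemma t_family_hom (L : lieType) n (F : 'I_n -> 'I_n -> L) : t_family F ->
  exists2 f : tlie n -> L, lie_morphism f & forall i j, i != j -> f (tt_ i j) = F i j.
Proof.
move=> [Fs F4 Fc]; have FE := leval_tterm F.
have R u v : t_rel u v -> leval (fun g : tgen n => F (val g).1 (val g).2) u =
                          leval (fun g : tgen n => F (val g).1 (val g).2) v.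
  case=> [i j ij|i j k|i j k l] /=; rewrite ?FE.
  - by rewrite ij eq_sym ij Fs.
  - move=> u3; have h := F4 i j k u3; move: u3.
    by rewrite /= !inE negb_or andbT => /andP[/andP[ij ik] jk]; rewrite ij ik jk.
  - move=> u4; have h := Fc i j k l u4; move: u4.
    rewrite /= !inE !negb_or andbT => /and3P[/and3P[ij _ _] _ kl].
    by rewrite ij kl.
exists (lext (fun g : tgen n => F (val g).1 (val g).2)); first by case: (lextP R).
by move=> i j ij; rewrite /tt_ lextE // FE ij.
Qed.

Lemma t_family_inj (I J : eqType) (L : lieType) (F : I -> I -> L) (s : J -> I) :
  injective s -> t_family F -> t_family (fun i j => F (s i) (s j)).
Proof.
move=> sI [Fs F4 Fc]; split=> [i j ij|i j k u|i j k l u].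
- by rewrite Fs // (inj_eq sI).
- by apply: F4; rewrite -(map_inj_uniq sI) in u.
- by apply: Fc; rewrite -(map_inj_uniq sI) in u.
Qed.

(** The relations of t_3 for the images A, B, C of t_12, t_23, t_13, in a form symmetric in the
    three: A + B + C commutes with each of them. *)
Definition central3 (L : lieType) (A B C : L) : Prop :=
  [/\ <[A, B + C]> = 0, <[B, A + C]> = 0 & <[C, A + B]> = 0].

Lemma forall_I3 (P : 'I_3 -> Prop) : P ord0 -> P (inord 1) -> P (inord 2) -> forall i, P i.
Proof.
move=> p0 p1 p2; case=> [[|[|[|//]]] im].
- by have -> : Ordinal im = ord0 by apply: val_inj.
- by have -> : Ordinal im = inord 1 by apply: val_inj; rewrite /= inordK.
- by have -> : Ordinal im = inord 2 by apply: val_inj; rewrite /= inordK.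
Qed.

Lemma block_sum (V : nmodType) n (l : seq nat) (G : 'I_n.+1 -> V) :
  uniq l -> all (fun k => 0 < k <= n.+1)%N l ->
  \sum_(a in [set a : 'I_n.+1 | a.+1 \in l]) G a = \sum_(k <- l) G (strand n k).
Proof.
move=> ul /allP al; rewrite -(big_map (strand n) xpredT G) big_uniq.
  apply: eq_bigl => a; rewrite inE; apply/idP/mapP => [al'|[k kl ->]].
    by exists a.+1 => //; apply: val_inj; rewrite /strand /= inordK.
  by have /andP[k0 kn] := al k kl; rewrite /strand inordK ?prednK.
rewrite map_inj_in_uniq // => k k' /al/andP[k0 kn] /al/andP[k0' kn'].
move=> /(congr1 val); rewrite /= !inordK ?prednK // => e.
by rewrite -(prednK k0) e prednK.
Qed.

Section Blocks.
Variables (n : nat) (I1 I2 I3 : seq nat).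
Hypothesis uI : uniq (I1 ++ I2 ++ I3).
Hypothesis aI : all (fun k => 0 < k <= n.+1)%N (I1 ++ I2 ++ I3).
Let s := [:: I1; I2; I3].

Lemma blocks_disjoint (i j : 'I_3) : i != j ->
  [disjoint blocks n.+1 s i & blocks n.+1 s j].
Proof.
have D (l l' : seq nat) : ~~ has (mem l) l' ->
    [disjoint [set a : 'I_n.+1 | a.+1 \in l] & [set a : 'I_n.+1 | a.+1 \in l']].
  move=> /hasPn h; apply/pred0P => a /=; rewrite !inE.
  by apply/negbTE/negP => /andP[al /h]; rewrite /= al.
move: uI; rewrite !cat_uniq has_cat negb_or => /and3P[_ /andP[h12 h13] /and3P[_ h23 _]].
have D21 := D _ _ h12; have D31 := D _ _ h13; have D32 := D _ _ h23.
elim/forall_I3: i; elim/forall_I3: j; rewrite ?eqxx // /blocks /= ?inordK //= => _;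
  by rewrite // disjoint_sym.
Qed.

(** Turns psi^{I1,I2,I3}, defined through t_3 and insertions, into psi evaluated at two sums, with
    the strands already mapped to the target. *)
Lemma f2_tE (L : lieType) (f : tlie n.+1 -> L) (F : 'I_n.+1 -> 'I_n.+1 -> L) psi :
  lie_morphism f -> (forall i j, i != j -> f (tt_ i j) = F i j) ->
  f (f2_t n.+1 s psi) =
  f2_eval (\sum_(a <- I1) \sum_(b <- I2) F (strand n a) (strand n b))
          (\sum_(a <- I2) \sum_(b <- I3) F (strand n a) (strand n b)) psi.
Proof.
move=> fM fF; have [insM insE] := t_insP blocks_disjoint.
rewrite /f2_t /f2_to_t3 (f2_eval_morph _ _ _ insM) (f2_eval_morph _ _ _ fM).
have ne : [/\ strand 2 1 != strand 2 2 & strand 2 2 != strand 2 3].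
  by split; rewrite -val_eqE /= !inordK.
have [n12 n23] := ne.
move: (uI) (aI); rewrite !cat_uniq !all_cat has_cat negb_or.
move=> /and3P[u1 /andP[h12 _] /and3P[u2 h23 u3]] /and3P[a1 a2 a3].
have FB (l l' : seq nat) : uniq l -> uniq l' -> ~~ has (mem l) l' ->
    all (fun k => 0 < k <= n.+1)%N l -> all (fun k => 0 < k <= n.+1)%N l' ->
    f (\sum_(a in [set a : 'I_n.+1 | a.+1 \in l]) \sum_(b in [set a : 'I_n.+1 | a.+1 \in l'])
      tt_ a b) = \sum_(a <- l) \sum_(b <- l') F (strand n a) (strand n b).
  move=> ul ul' /hasPn h al al'; rewrite (lin_sum fM.1).
  rewrite -(block_sum (fun a => \sum_(b <- l') F a (strand n b)) ul al).
  apply: eq_bigr => a al0; rewrite (lin_sum fM.1) -(block_sum _ ul' al').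
  apply: eq_bigr => b bl; apply: fF; apply: contraTneq bl => <-.
  by rewrite !inE in al0 *; apply/negP => /h; rewrite /= al0.
congr (f2_eval _ _ psi); rewrite insE // /blocks /= !inordK //=; exact: FB.
Qed.

End Blocks.

Section Grt1.
Variables (psi : f2) (psiP : in_grt1 psi) (L : lieType).
Implicit Types A B C : L.
Local Notation P A B := (f2_eval A B psi).

(** On the strands 0, 1, 2 the sum of two distinct indices is 1, 3 or 2 and thus identifies the
    pair. *)
Let F3 A B C (i j : 'I_3) : L :=
  if (i + j == 1)%N then A else if (i + j == 3)%N then B else C.

Let F3_family A B C : central3 A B C -> t_family (F3 A B C).
Proof.
move=> [hA hB hC]; split=> [i j _|i j k|i j k l u]; first by rewrite /F3 addnC.
  case: i => [[|[|[|//]]] ?]; case: j => [[|[|[|//]]] ?]; case: k => [[|[|[|//]]] ?] //= _;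
  by rewrite /F3 //= addrC.
by have := max_card (mem [:: i; j; k; l]); rewrite (card_uniqP u) card_ord.
Qed.

Let hom_eval n (F : 'I_n.+1 -> 'I_n.+1 -> L) : t_family F ->
  exists f : tlie n.+1 -> L, [/\ lie_morphism f, forall i j, i != j -> f (tt_ i j) = F i j &
  forall s, uniq (flatten s) -> all (fun k => 0 < k <= n.+1)%N (flatten s) -> size s = 3%N ->
  f (f2_t n.+1 s psi) = f2_eval
    (\sum_(a <- nth [::] s 0) \sum_(b <- nth [::] s 1) F (strand n a) (strand n b))
    (\sum_(a <- nth [::] s 1) \sum_(b <- nth [::] s 2) F (strand n a) (strand n b)) psi].
Proof.
move=> /t_family_hom[f fM fE]; exists f; split=> // -[|I1 [|I2 [|I3 []]]] //=.
by rewrite cats0 => u a _; apply: f2_tE.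
Qed.

Lemma grt1_anti A B C : central3 A B C -> P B A = - P A B.
Proof.
move=> /F3_family/hom_eval[f [fM _ fE]]; case: psiP => /(congr1 f) + _ _ _.
rewrite (linD fM.1) (lin0 fM.1) !fE //= !big_seq1 /F3 /strand !inordK //=.
by move=> /eqP; rewrite addrC addr_eq0 => /eqP.
Qed.

Lemma grt1_cyc A B C : central3 A B C -> P A B + P B C + P C A = 0.
Proof.
move=> /F3_family/hom_eval[f [fM _ fE]]; case: psiP => _ /(congr1 f) + _ _.
by rewrite !(linD fM.1) (lin0 fM.1) !fE //= !big_seq1 /F3 /strand !inordK.
Qed.

Lemma grt1_hex A B C : central3 A B C -> <[B, P A B]> + <[C, P A C]> = 0.
Proof.
move=> /F3_family/hom_eval[f [fM fT fE]]; case: psiP => _ _ /(congr1 f) + _.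
rewrite !(linD fM.1) (lin0 fM.1) !fM.2 !fE // /tk !fT; try by rewrite -val_eqE /strand /= !inordK.
by rewrite /= !big_seq1 /F3 /strand !inordK.
Qed.

Lemma grt1_pent (I : eqType) (F : I -> I -> L) a b c d :
  t_family F -> uniq [:: a; b; c; d] ->
  P (F b c) (F c d) - P (F a c + F b c) (F c d) + P (F a b + F a c) (F b d + F c d)
  - P (F a b) (F b c + F b d) + P (F a b) (F b c) = 0.
Proof.
move=> FF u; pose s (i : 'I_4) := nth a [:: a; b; c; d] i.
have sI : injective s.
  by move=> i j /eqP; rewrite nth_uniq // => /eqP; apply: val_inj.
have [f [fM _ fE]] := hom_eval (t_family_inj sI FF); case: psiP => _ _ _ /(congr1 f).
rewrite !(linD fM.1, linN fM.1) (lin0 fM.1) !fE //= !(big_cons, big_nil) !addr0.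
by rewrite /s /strand !inordK.
Qed.

End Grt1.

Section FourPoints.
(* The strand 0 is None. *)
Variables (L : lieType) (t0 : 'I_3 -> L) (t : 'I_3 -> 'I_3 -> L).

Definition four_points (a b : option 'I_3) : L :=
  match a, b with
  | None, None => 0
  | None, Some i => t0 i
  | Some i, None => t0 i
  | Some i, Some j => t i j
  end.

Hypotheses (ts : forall i j, i != j -> t i j = t j i)
  (t4 : forall i j k, uniq [:: i; j; k] -> <[t i j, t i k + t j k]> = 0)
  (t04 : forall i j, i != j -> <[t0 i, t0 j + t i j]> = 0)
  (tt0 : forall i j, i != j -> <[t i j, t0 i + t0 j]> = 0)
  (t0t : forall i j k, uniq [:: i; j; k] -> <[t0 i, t j k]> = 0).

Lemma uniq3P (I : eqType) (a b c : I) :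
  reflect [/\ a != b, a != c & b != c] (uniq [:: a; b; c]).
Proof.
rewrite /= !inE negb_or andbT -andbA; exact: and3P.
Qed.

Lemma four_points_family : t_family four_points.
Proof.
split=> [[i|] [j|] //= ij||].
- exact: ts.
- move=> [i|] [j|] [k|] // /uniq3P[ij ik jk] /=.
  + by apply/t4/uniq3P.
  + exact: tt0.
  + by rewrite addrC; apply: t04.
  + exact: t04.
move=> a b c d u; have u3 : [/\ uniq [:: a; c; d], uniq [:: b; c; d], uniq [:: a; b; c] & uniq [:: a; b; d]].
  move: u; rewrite /= !inE !negb_or !andbT => /and3P[/and3P[-> -> ->] /andP[-> ->] ->].
  by [].
case: a b c d u u3 => [i|] [j|] [k|] [l|] u [] u1 u2 u3 u4 //=.
- have u' : uniq [:: i; j; k; l] by rewrite -(map_inj_uniq (@Some_inj _)).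
  by have := max_card (mem [:: i; j; k; l]); rewrite (card_uniqP u') card_ord.
- by apply/lbra_eq0C/t0t; move: u3 => /uniq3P[? ? ?]; apply/uniq3P; split; rewrite // eq_sym.
- by apply/lbra_eq0C/t0t; move: u4 => /uniq3P[? ? ?]; apply/uniq3P; split; rewrite // eq_sym.
- by apply/t0t; move: u1 => /uniq3P[? ? ?]; apply/uniq3P; split; rewrite // eq_sym.
- by apply/t0t; move: u2 => /uniq3P[? ? ?]; apply/uniq3P; split; rewrite // eq_sym.
Qed.

End FourPoints.

Lemma others3 (i j : 'I_3) : i != j -> exists k, uniq [:: i; j; k].
Proof.
move=> ij; have [k] : exists k, k \notin [set i; j].
  apply/existsP; rewrite -negb_forall; apply/negP => /forallP h.
  have : [set i; j] = setT by apply/setP => k; rewrite h inE.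
  by move=> /(congr1 (fun A : {set 'I_3} => #|A|)); rewrite cards2 ij cardsT card_ord.
rewrite !inE negb_or => /andP[ki kj]; exists k; apply/uniq3P.
by split; rewrite // eq_sym.
Qed.

Lemma sum3 (V : zmodType) (F : 'I_3 -> V) i j k : uniq [:: i; j; k] ->
  \sum_l F l = F i + F j + F k.
Proof.
move=> u; have /uniq3P[ij ik jk] := u.
rewrite (bigD1 i) //= (bigD1 j) 1?eq_sym //= (bigD1 k) /=; last by rewrite ![k == _]eq_sym ik jk.
rewrite big1 ?addr0 ?addrA // => l /andP[/andP[li lj] lk].
have u' : uniq [:: l; i; j; k] by rewrite cons_uniq u !inE !negb_or li lj lk.
by have := max_card (mem [:: l; i; j; k]); rewrite (card_uniqP u') card_ord.
Qed.

(** * Elliptic triples *)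

Section Elliptic3.
Variables (L : lieType) (g : lieGrading L).
Local Notation LL := (compl g).

Definition elliptic3 (x y : 'I_3 -> LL) : Prop :=
  [/\ forall i, low 1 (x i), forall i j, <[x i, x j]> = 0,
      \sum_i x i = 0, \sum_i y i = 0 &
  [/\ forall i j, <[y i, y j]> = 0,
      forall i j, i != j -> <[x i, y j]> = <[x j, y i]>,
      forall i j k, uniq [:: i; j; k] -> <[x k, <[x i, y j]>]> = 0
    & forall i j k, uniq [:: i; j; k] -> <[y k, <[x i, y j]>]> = 0]].

Variables x y : 'I_3 -> LL.
Hypothesis xyE : elliptic3 x y.

Let xl i : low 1 (x i). Proof. by case: xyE. Qed.
Let xx i j : <[x i, x j]> = 0. Proof. by case: xyE. Qed.
Let xs i j k : uniq [:: i; j; k] -> x i + x j + x k = 0.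
Proof. by move=> /(sum3 x) <-; case: xyE. Qed.
Let ys i j k : uniq [:: i; j; k] -> y i + y j + y k = 0.
Proof. by move=> /(sum3 y) <-; case: xyE. Qed.

Definition el_t i j := <[x i, y j]>.
Definition el_t0 i := T0 (x i) (y i).
Definition el_e i := ps (lbra (x i)) nexp.
Local Notation t := el_t.
Local Notation t0 := el_t0.
Local Notation e := el_e.

Let xt i j k : uniq [:: i; j; k] -> <[x k, t i j]> = 0.
Proof. by case: xyE => _ _ _ _ [_ _ + _]; apply. Qed.
Let yt i j k : uniq [:: i; j; k] -> <[y k, t i j]> = 0.
Proof. by case: xyE => _ _ _ _ [_ _ _ +]; apply. Qed.

Lemma el_ts i j : i != j -> t i j = t j i.
Proof. by case: xyE => _ _ _ _ [_ + _ _]; apply. Qed.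
Local Notation ts := el_ts.

Lemma el_t0t i j k : uniq [:: i; j; k] -> <[t0 i, t j k]> = 0.
Proof.
move=> u; apply: lbra_eq0C; rewrite /t0 lbraNr.
have u' : uniq [:: j; k; i] by rewrite (uniq_catC [:: j; k] [:: i]).
by rewrite ps_ad_kill ?oppr0 //; apply: lbra_eq0C; [apply: xt|apply: yt].
Qed.

Lemma el_xii i j k : uniq [:: i; j; k] -> <[x i, y i]> = - (t i j + t i k).
Proof.
move=> u; have /uniq3P[ij ik _] := u; have /eqP := ys u.
by rewrite -addrA addr_eq0 => /eqP ->; rewrite lbraNr lbraDr.
Qed.

Lemma el_t4 i j k : uniq [:: i; j; k] -> <[t i j, t i k + t j k]> = 0.
Proof.
move=> u; have /uniq3P[ij ik jk] := u.
have u' : uniq [:: k; i; j] by rewrite (uniq_catC [:: k] [:: i; j]).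
have -> : t i k + t j k = - <[x k, y k]>.
  by rewrite (el_xii u') opprK; congr (_ + _); apply: ts.
by rewrite lbraNr lbra_leibniz !(lbra_eq0C (xt u), lbra_eq0C (yt u)) lbrax0 lbra0x addr0 oppr0.
Qed.

Lemma el_t04 i j : i != j -> <[t0 i, t0 j + t i j]> = 0.
Proof.
move=> ij; have [k u] := others3 ij; have /uniq3P[_ ik jk] := u.
have uikj : uniq [:: i; k; j] by apply/uniq3P; split; rewrite // eq_sym.
have ujki : uniq [:: j; k; i] by apply/uniq3P; split; rewrite // eq_sym.
rewrite /t0 (@bra_T0 _ _ (x i) (x j) (x k) (y i) (y j) (y k) (t i j) (t i k) (t j k)) //.
  by case: xyE => _ _ _ _ [].
all: try by [apply: xs|apply: ys|apply: xt|apply: yt|rewrite [RHS]ts].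
Qed.

Lemma el_sum i j k : uniq [:: i; j; k] ->
  t0 i + t0 j + t0 k + t i j + t i k + t j k = 0.
Proof.
move=> u; have /uniq3P[ij ik jk] := u.
have uikj : uniq [:: i; k; j] by apply/uniq3P; split; rewrite // eq_sym.
have ujki : uniq [:: j; k; i] by apply/uniq3P; split; rewrite // eq_sym.
rewrite /t0 (T0_sum (T12 := t i j) (T13 := t i k) (T23 := t j k)) ?ys ?oppr0 //.
all: try by [apply: xs|apply: xt|rewrite [RHS]ts].
Qed.

(** Since all six t's on the strands 0, i, j, k add up to zero, t_0i + t_0j is minus a sum of t_0k,
    t_ij and t_ik + t_jk, each of which commutes with t_ij. *)
Lemma el_tt0 i j : i != j -> <[t i j, t0 i + t0 j]> = 0.
Proof.
move=> ij; have [k u] := others3 ij; have /uniq3P[_ ik jk] := u.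
have ukij : uniq [:: k; i; j] by rewrite (uniq_catC [:: k] [:: i; j]).
have -> : t0 i + t0 j = - (t0 k + t i j + (t i k + t j k)).
  by apply/eqP; rewrite -addr_eq0 -(el_sum u); apply/eqP; zmod.
by rewrite lbraNr lbraDr (el_t4 u) lbraDr (lbra_eq0C (el_t0t ukij)) lbraxx !addr0 oppr0.
Qed.

Lemma el_e_morph i : lie_morphism (e i).
Proof.
split; first exact: (ps_fmap (ad_fmap (xl i)) _).1.
by move=> z w; apply: exp_ad_bra.
Qed.

Lemma el_e_t0 i j : i != j -> e i (t0 j + t i j) = t0 j.
Proof.
move=> ij; have [k u] := others3 ij.
by apply: (@exp_T02 _ _ (x i) (x j) (x k)) => //; [apply: xs|apply: xt].
Qed.

Lemma el_e_t i j k : uniq [:: i; j; k] -> e i (t j k) = t j k.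
Proof.
move=> u; have ujki : uniq [:: j; k; i] by rewrite (uniq_catC [:: j; k] [:: i]).
rewrite /e ps_kill ?xt //; first by rewrite [nexp 0]invr1 scale1r.
exact: ad_fmap.
Qed.

Lemma el_eC i j z : e i (e j z) = e j (e i z).
Proof.
rewrite /e -!exp_add; try exact: ad_fmap; try by move=> w; apply: lbra_comm.
by congr (ps _ _ _); apply: funext => w; rewrite addrC.
Qed.

Lemma el_e3 i j k z : uniq [:: i; j; k] -> e i (e j (e k z)) = z.
Proof.
move=> u; rewrite /e -[ps (lbra (x j)) _ _]exp_add -?exp_add.
- rewrite -[RHS](ps1 (fun=> 0)); apply: eq_csum => -[|n] /=.
    by rewrite [nexp 0]invr1.
  by rewrite -!lbraDl addrA (xs u) lbra0x scaler0 scaler0.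
- exact: ad_fmap.
- by apply: fmapD; apply: ad_fmap.
- by move=> w; rewrite lbraDr; congr (_ + _); apply: lbra_comm.
- exact: ad_fmap.
- exact: ad_fmap.
- by move=> w; apply: lbra_comm.
Qed.

Definition el_family := four_points_family el_ts el_t4 el_t04 el_tt0 el_t0t.

Lemma el_central i j : i != j -> central3 (t0 i) (t i j) (t0 j).
Proof.
move=> ij; split; first by rewrite addrC; apply: el_t04.
  exact: el_tt0.
by rewrite (ts ij); apply: el_t04; rewrite eq_sym.
Qed.

Lemma el_central' i j k : uniq [:: i; j; k] -> central3 (t i j) (t j k) (t i k).
Proof.
move=> u; have /uniq3P[ij ik jk] := u.
have ujki : uniq [:: j; k; i] by rewrite (uniq_catC [:: j; k] [:: i]).
have uikj : uniq [:: i; k; j] by apply/uniq3P; split; rewrite // eq_sym.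
split; first by rewrite addrC; apply: el_t4.
  by rewrite -[t i k]ts 1?eq_sym // (ts ij); apply: el_t4.
by have := el_t4 uikj; rewrite -(ts jk).
Qed.

End Elliptic3.

Lemma uniq3_perm (I : eqType) (i j k : I) : uniq [:: i; j; k] ->
  [/\ uniq [:: i; k; j], uniq [:: j; i; k], uniq [:: j; k; i], uniq [:: k; i; j]
    & uniq [:: k; j; i]].
Proof.
by move=> /uniq3P[? ? ?]; split; apply/uniq3P; split; rewrite // eq_sym.
Qed.

(** * First-order deformation of an elliptic triple *)

Section GrtElliptic.
Variables (psi : f2) (psiP : in_grt1 psi).
Variables (L : lieType) (g : lieGrading L).
Local Notation LL := (compl g).
Variables (x y : 'I_3 -> LL) (pot : 'I_3 -> LL).
Hypothesis xyE : elliptic3 x y.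
Local Notation t := (el_t x y).
Local Notation t0 := (el_t0 x y).
Local Notation e := (el_e x).
Local Notation P A B := (f2_eval A B psi).
(* psi^{i,j,k} for i, j, k > 0, psi^{0,j,k} and psi^{0i,j,k}. *)
Local Notation P3 i j k := (P (t i j) (t j k)).
Local Notation P0 j k := (P (t0 j) (t j k)).
Local Notation P01 i j k := (P (t0 j + t i j) (t j k)).
(** With this choice the term psi^{k,j,i} of the pentagon on 0, k, j, i equals pot i - pot k and can
    be split between [q i] and [p k]. *)
Hypothesis potP : forall i j k, uniq [:: i; j; k] -> pot j - pot i = P3 i k j.

Definition el_s i := \sum_(l | l != i) t i l.
Definition el_r i := \sum_(l | l != i) t0 l.
Local Notation s := el_s.
Local Notation r := el_r.

Lemma el_others (F : 'I_3 -> LL) i j k : uniq [:: i; j; k] ->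
  \sum_(l | l != i) F l = F j + F k.
Proof.
move=> u; apply: (addrI (F i)); rewrite addrA -(sum3 F u).
by rewrite [RHS](bigD1 i).
Qed.
Let sE i j k : uniq [:: i; j; k] -> s i = t i j + t i k.
Proof. exact: (el_others (t i)). Qed.
Let rE i j k : uniq [:: i; j; k] -> r i = t0 j + t0 k.
Proof. exact: (el_others t0). Qed.

Variables p q : 'I_3 -> LL.
(** Up to the potential, [p i] is psi^{0,i,jk} and [q i] is psi^{0,jk,i}, the images of psi^{0,1,2}
    and psi^{0,2,1} under the insertion of i, jk. *)
Hypothesis pE : forall i, p i = P (t0 i) (s i) + pot i.
Hypothesis qE : forall i, q i = P (r i) (s i) + pot i.

(* The pentagon on the strands 0, k, j, i. *)
Lemma el_qp i j k : uniq [:: i; j; k] -> q i - p k = P01 k j i - P0 k j.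
Proof.
move=> u; have [uikj ujik ujki ukij ukji] := uniq3_perm u.
have u4 : uniq [:: None; Some k; Some j; Some i].
  by rewrite /= !inE !negb_or; move: ukji => /uniq3P[kj ki ji]; rewrite !eqE /= kj ki ji.
have /= h := grt1_pent psiP (el_family xyE) u4.
rewrite qE pE (sE ukij) (sE uikj) (rE uikj) -(subrK (pot k) (pot i)) (potP ukij).
have /uniq3P[ij ik jk] := u.
rewrite !(@el_ts _ _ _ _ xyE i) //.
apply/eqP; rewrite -subr_eq0 -h; apply/eqP.
rewrite [t k i + t k j]addrC [t k i + t j i]addrC.
by zmod.
Qed.

(** Conjugation by e^{x_i} sends t_0j + t_ij to t_0j and fixes t_jk: it detaches the strand i from
    0. *)
Lemma el_eP01 i j k : uniq [:: i; j; k] -> e i (P01 i j k) = P0 j k.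
Proof.
move=> u; have /uniq3P[ij ik jk] := u.
rewrite (f2_eval_morph _ _ _ (el_e_morph xyE i)) (el_e_t xyE u).
by rewrite (el_e_t0 xyE ij).
Qed.

Let eD i z w : e i (z + w) = e i z + e i w.
Proof. exact: (linD (el_e_morph xyE i).1). Qed.
Let eN i z : e i (- z) = - e i z.
Proof. exact: (linN (el_e_morph xyE i).1). Qed.
Let eC i j z : e i (e j z) = e j (e i z).
Proof. exact: (el_eC xyE). Qed.
Let e3 i j k z : uniq [:: i; j; k] -> e i (e j (e k z)) = z.
Proof. exact: (el_e3 xyE). Qed.

(** The logarithmic derivative of e^{x_i} under the deformation, that is the eps part of (deformed
    e^{x_i}) e^{- x_i}. *)
Definition el_delta i := q i - e i (p i).
Local Notation delta := el_delta.

Lemma el_e_qp i j k : uniq [:: i; j; k] -> e i (q k - p i) = P0 j k - e i (P0 i j).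
Proof.
move=> u; have [uikj ujik ujki ukij ukji] := uniq3_perm u.
by rewrite (el_qp ukji) eD eN el_eP01.
Qed.

Lemma el_e_P01 i j k z : uniq [:: i; j; k] -> e i z = P0 j k -> z = e j (e k (P0 j k)).
Proof.
by move=> u <-; have [_ _ ujki _ _] := uniq3_perm u; rewrite e3.
Qed.

(** First-order form of e^{x_i} e^{x_k} = e^{x_k} e^{x_i}. Every difference of the q's and p's is
    expressed by [el_qp], and the exponentials reduce the terms psi^{0a,b,c} to terms
    psi^{0,b,c}. *)
Lemma el_delta_cocycle i k : i != k ->
  delta i + e i (delta k) = delta k + e k (delta i).
Proof.
move=> ik; have [j uikj] := others3 ik.
have [uijk ukij ukji ujik ujki] := uniq3_perm uikj.
have D a b c : uniq [:: a; b; c] ->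
    delta a + e a (delta c) = q a + P0 b c - e a (P0 a b) - e a (e c (p c)).
  move=> u; rewrite /delta eD eN.
  have := el_e_qp u; rewrite eD eN => /eqP; rewrite subr_eq => /eqP ->.
  by zmod.
have qq : q i - q k = P01 j k i - P0 j k - (P01 j i k - P0 j i).
  by rewrite -(el_qp uikj) -(el_qp ukij); zmod.
have pp : p i - p k = P01 k i j - P0 k i - (P01 i k j - P0 i k).
  by rewrite -(el_qp ujik) -(el_qp ujki); zmod.
have E1 := el_e_P01 ujki (el_eP01 ujki).
have E2 := el_e_P01 ujik (el_eP01 ujik).
have E3 : e i (e k (P01 k i j)) = e i (P0 i j) by rewrite el_eP01.
have E4 : e i (e k (P01 i k j)) = e k (P0 k j) by rewrite eC el_eP01.
have ee : e i (e k (p i)) = e i (e k (p k)) + e i (P0 i j) - e i (e k (P0 k i))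
    - e k (P0 k j) + e i (e k (P0 i k)).
  have -> : p i = p k + (p i - p k) by zmod.
  by rewrite pp !(eD, eN) E3 E4; zmod.
rewrite (D _ _ _ uijk) (D _ _ _ ukji) [e k (e i _)]eC ee.
have -> : q i = q k + (q i - q k) by zmod.
rewrite qq E1 E2 [e k (e i (P0 k i))]eC.
by zmod.
Qed.

(** First-order form of e^{x_i} e^{x_j} e^{x_k} = 1. *)
Lemma el_delta_sum i j k : uniq [:: i; j; k] ->
  delta i + e i (delta j) + e i (e j (delta k)) = 0.
Proof.
move=> u; have [uikj ujik ujki ukij ukji] := uniq3_perm u.
have h1 := el_e_qp uikj; have h2 := el_e_qp ujik.
have h3 : q i - p k = e i (e j (P0 j i)) - P0 k j.
  by rewrite (el_qp u) [P01 k j i](el_e_P01 ukji (el_eP01 ukji)) eC.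
rewrite eD eN in h1; rewrite eD eN in h2.
rewrite /delta !(eD, eN) (e3 _ u).
have -> : q i = p k + (q i - p k) by zmod.
have -> : e i (q j) = e i (p i) + (P0 k j - e i (P0 i k)) by rewrite -h1; zmod.
have -> : e j (q k) = e j (p j) + (P0 i k - e j (P0 j i)) by rewrite -h2; zmod.
by rewrite h3 !(eD, eN); zmod.
Qed.

(** In other words the deformation [p_j, t_0j] + [pot_k, t_ij] of t_0j + t_ij is its bracket with
    p_i + psi^{0i,j,k}. This form suits both e_i, which turns psi^{0i,j,k} into psi^{0,j,k}, and
    t_0i, which commutes with it. *)
Lemma el_bra_diff i j k : uniq [:: i; j; k] ->
  <[p j - p i, t0 j]> + <[pot k - p i, t i j]> = <[P01 i j k, t0 j + t i j]>.
Proof.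
move=> u; have [uikj ujik ujki ukij ukji] := uniq3_perm u; have /uniq3P[ij ik jk] := u.
have cC := el_central xyE ij.
have pp : p j - p i = P01 i j k - P0 i j - (P01 j i k - P0 j i).
  by rewrite -(el_qp ukji) -(el_qp ukij); zmod.
have pk : pot k - p i = P01 i j k - P0 i j - P (r k) (s k).
  by rewrite -(el_qp ukji) qE; zmod.
have K1 : <[P01 j i k, t0 j]> = 0.
  apply: lbra_eq0C; apply: f2_eval_comm; first by apply: (el_t04 xyE); rewrite eq_sym.
  exact: (el_t0t xyE ujik).
have K2 : <[P (r k) (s k), t i j]> = 0.
  apply: lbra_eq0C; rewrite (rE ukij) (sE ukij); apply: f2_eval_comm.
    exact: (el_tt0 xyE).
  by rewrite !(@el_ts _ _ _ _ xyE k) 1?eq_sym //; apply: (el_t4 xyE u).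
have a1 := grt1_anti psiP cC; have c1 := grt1_cyc psiP cC; have h1 := grt1_hex psiP cC.
have C' : central3 (t0 j) (t i j) (t0 i) by case: cC => a b c; split; rewrite // addrC.
have a2 := grt1_anti psiP C'.
have a3 : P (t0 j) (t0 i) = - P (t0 i) (t0 j).
  have C2 : central3 (t0 i) (t0 j) (t i j) by case: cC => a b c; split; rewrite // addrC.
  exact: (grt1_anti psiP C2).
(* Antisymmetry and the three-term relation for t_0i, t_ij, t_0j turn the difference into psi(t_0j,
   t_0i); the bracket relation of grt_1 for the same triple concludes. *)
have h : <[P0 j i - P0 i j, t0 j]> = <[P0 i j, t i j]>.
  have -> : P0 j i - P0 i j = P (t0 j) (t0 i).
    rewrite -(el_ts xyE ij); move: c1; rewrite a2 => c1.
    by apply/eqP; rewrite -subr_eq0 -oppr_eq0 -c1; apply/eqP; zmod.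
  rewrite a3 lbraNl -lbraC [RHS]lbraC; apply/eqP.
  by rewrite -addr_eq0 addrC h1.
rewrite pp pk !(lbraDr, lbraDl, lbraNl) K1 K2.
rewrite !lbraDl !lbraNl in h.
have -> : <[P0 j i, t0 j]> = <[P0 i j, t i j]> + <[P0 i j, t0 j]> by rewrite -h; zmod.
by zmod.
Qed.

Let eB i z w : e i <[z, w]> = <[e i z, e i w]>.
Proof. exact: (el_e_morph xyE i).2. Qed.

(** The eps part of e^{ad x_i} (t_0j + t_ij) = t_0j. *)
Lemma el_bra_t0 i j k : uniq [:: i; j; k] ->
  <[delta i, t0 j]> + e i (<[p j, t0 j]> + <[pot k, t i j]>) = <[p j, t0 j]>.
Proof.
move=> u; have [uikj ujik ujki ukij ukji] := uniq3_perm u; have /uniq3P[ij ik jk] := u.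
have K1 : <[P01 j k i, t0 j]> = 0.
  apply: lbra_eq0C; apply: f2_eval_comm; first by apply: (el_t04 xyE).
  exact: (el_t0t xyE ujki).
have hq : <[q i, t0 j]> = <[p j, t0 j]> - <[P0 j k, t0 j]>.
  have -> : q i = p j + (P01 j k i - P0 j k) by rewrite -(el_qp uikj); zmod.
  by rewrite !lbraDl lbraNl K1; zmod.
have hK : <[p j, t0 j]> + <[pot k, t i j]> = <[p i, t0 j + t i j]> + <[P01 i j k, t0 j + t i j]>.
  by rewrite -(el_bra_diff u) !lbraDl !lbraNl !lbraDr; zmod.
rewrite hK eD !eB (el_eP01 u) (el_e_t0 xyE ij) /delta lbraDl lbraNl hq.
by zmod.
Qed.

(** The eps part of [t_0i, t_0j + t_ij] = 0: relative to the common term p_i, only psi^{0i,j,k} is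
    left, and t_0i commutes with it. *)
Lemma el_bra_t04 i j k : uniq [:: i; j; k] ->
  <[<[p i, t0 i]>, t0 j + t i j]> + <[t0 i, <[p j, t0 j]> + <[pot k, t i j]>]> = 0.
Proof.
move=> u; have /uniq3P[ij ik jk] := u.
have hK : <[p j, t0 j]> + <[pot k, t i j]> = <[p i, t0 j + t i j]> + <[P01 i j k, t0 j + t i j]>.
  by rewrite -(el_bra_diff u) !lbraDl !lbraNl !lbraDr; zmod.
have z : <[t0 i, t0 j + t i j]> = 0 by apply: (el_t04 xyE).
have K : <[t0 i, P01 i j k]> = 0.
  by apply: f2_eval_comm => //; apply: (el_t0t xyE).
rewrite hK lbraDr addrA -lbra_leibniz z lbrax0 add0r.
by rewrite lbra_leibniz K z lbra0x lbrax0 addr0.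
Qed.

(** The eps part of [el_sum]. The bracket relation of grt_1 is used on three sets of strands: 0, i,
    jk with j, k fused, then 0, j, k, then i, j, k. *)
Lemma el_bra_sum i j k : uniq [:: i; j; k] ->
  <[p i, t0 i]> + <[p j, t0 j]> + <[p k, t0 k]>
  + <[pot k, t i j]> + <[pot j, t i k]> + <[pot i, t j k]> = 0.
Proof.
move=> u; have [uikj ujik ujki ukij ukji] := uniq3_perm u; have /uniq3P[ij ik jk] := u.
have tt := @el_t0t _ _ _ _ xyE; have t04 := @el_t04 _ _ _ _ xyE.
have tt0 := @el_tt0 _ _ _ _ xyE.
have cB : central3 (s i) (t0 i) (r i).
  rewrite (sE u) (rE u); split.
  - have -> : t0 i + (t0 j + t0 k) = (t0 i + t0 j) + t0 k by zmod.
    rewrite lbraDl [X in X + _]lbraDr tt0 // (lbra_eq0C (tt _ _ _ ukij)) addr0 add0r.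
    have -> : t0 i + t0 j + t0 k = (t0 i + t0 k) + t0 j by zmod.
    by rewrite lbraDr tt0 // (lbra_eq0C (tt _ _ _ ujik)) addr0.
  - have -> : t i j + t i k + (t0 j + t0 k) = (t0 j + t i j) + (t0 k + t i k) by zmod.
    by rewrite lbraDr !t04 // addr0.
  have tB : <[t0 j, t0 i + t i j]> = 0 by rewrite (el_ts xyE ij); apply: t04; rewrite eq_sym.
  have tC : <[t0 k, t0 i + t i k]> = 0 by rewrite (el_ts xyE ik); apply: t04; rewrite eq_sym.
  have -> : t i j + t i k + t0 i = (t0 i + t i j) + t i k by zmod.
  rewrite lbraDl [X in X + _]lbraDr tB (tt _ _ _ ujik) !add0r.
  have -> : t0 i + t i j + t i k = (t0 i + t i k) + t i j by zmod.
  by rewrite lbraDr tC (tt _ _ _ ukij) addr0.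
have hB := grt1_hex psiP cB.
have aB := grt1_anti psiP cB.
have cB' : central3 (s i) (r i) (t0 i) by case: cB => a b c; split; rewrite // addrC.
have aB' := grt1_anti psiP cB'.
have cA : central3 (t j k) (t0 j) (t0 k).
  have [a b c] := el_central xyE jk.
  by split; rewrite // addrC // [X in _ + X]addrC.
have hA := grt1_hex psiP cA.
have aA := grt1_anti psiP cA.
have cA' : central3 (t j k) (t0 k) (t0 j).
  by case: cA => a b c; split; rewrite // addrC.
have aA' := grt1_anti psiP cA'.
have cT : central3 (t j k) (t i j) (t i k).
  have [a b c] := el_central' xyE ujki.
  by rewrite -(el_ts xyE ij) -(el_ts xyE ik) in a b c; split; rewrite // addrC.
have hT := grt1_hex psiP cT.
have aT := grt1_anti psiP cT.
have cT' : central3 (t j k) (t i k) (t i j).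
  by case: cT => a b c; split; rewrite // addrC.
have aT' := grt1_anti psiP cT'.
have st : t0 i + t0 j + t0 k = - (t i j + t i k + t j k).
  by apply/eqP; rewrite -subr_eq0 -(el_sum xyE u); apply/eqP; zmod.
have hp : <[p i, t0 i]> + <[q i, t0 j]> + <[q i, t0 k]> = <[pot i, t0 i + t0 j + t0 k]>.
  rewrite pE qE !(lbraDl _ (pot i)) !(lbraDr (pot i)).
  have : <[P (t0 i) (s i), t0 i]> + <[P (r i) (s i), r i]> = 0.
    by rewrite aB aB' !lbraNl -!lbraC.
  rewrite {2}(rE u) (lbraDr _ (t0 j)) => h.
  rewrite -[RHS]addr0 -h; zmod.
have hqj : <[p j, t0 j]> = <[q i, t0 j]> + <[P0 j k, t0 j]>.
  have -> : q i = p j + (P01 j k i - P0 j k) by rewrite -(el_qp uikj); zmod.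
  have K1 : <[P01 j k i, t0 j]> = 0.
    by apply: lbra_eq0C; apply: f2_eval_comm; [apply: t04|apply: tt].
  by rewrite !(lbraDl, lbraNl) K1; zmod.
have hqk : <[p k, t0 k]> = <[q i, t0 k]> + <[P0 k j, t0 k]>.
  have -> : q i = p k + (P01 k j i - P0 k j) by rewrite -(el_qp u); zmod.
  have K1 : <[P01 k j i, t0 k]> = 0.
    by apply: lbra_eq0C; apply: f2_eval_comm; [apply: t04; rewrite eq_sym|apply: tt].
  by rewrite !(lbraDl, lbraNl) K1; zmod.
have h0 : <[P0 j k, t0 j]> + <[P0 k j, t0 k]> = 0.
  rewrite -(el_ts xyE jk) aA aA' !lbraNl -!lbraC; exact: hA.
have hT' : <[pot k - pot i, t i j]> + <[pot j - pot i, t i k]> = 0.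
  rewrite (potP uikj) (potP u) -(el_ts xyE jk) aT aT' !lbraNl -!lbraC; exact: hT.
rewrite hqj hqk.
have -> : <[p i, t0 i]> = <[pot i, t0 i + t0 j + t0 k]> - <[q i, t0 j]> - <[q i, t0 k]>.
  by rewrite -hp; zmod.
rewrite st lbraNr !(lbraDr (pot i)).
rewrite !(lbraDl, lbraNl) in hT'.
have -> : <[pot k, t i j]> = <[pot i, t i j]> + <[pot i, t i k]> - <[pot j, t i k]>.
  by apply/eqP; rewrite -subr_eq0 -hT'; apply/eqP; zmod.
have -> : <[P0 j k, t0 j]> = - <[P0 k j, t0 k]> by apply/eqP; rewrite -addr_eq0 h0.
by zmod.
Qed.

End GrtElliptic.

(** * Logarithmic derivatives of products of exponentials *)

Section HhIdentities.

Lemma S_hhN_u : uvps nexp uv_u * uvps nhh (- uv_u) = uvps nhh uv_u.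
Proof.
have lu := low_u; apply: uv_uI.
transitivity (uvps nexp uv_u * (uv_u * uvps nhh (- uv_u))); first by ring.
rewrite S_hN //; transitivity (uvps nexp uv_u - uvps nexp uv_u * uvps nexp (- uv_u)); first by ring.
by rewrite S_eN // S_e //; ring.
Qed.

(** With h(u) = (e^u - 1) / u, the factor v clears the divided difference and leaves (u + v) h(u +
    v) - u h(u) = e^u (e^v - 1). *)
Lemma S_hh_add : uv_u * DD nhh (uv_u + uv_v) uv_u + uvps nhh (uv_u + uv_v) =
  uvps nexp uv_u * uvps nhh uv_v.
Proof.
have lu := low_u; have lv := low_v; have luv := uv_lowD lu lv.
have := DDP nhh luv lu; rewrite subv_uv => hK; apply: uv_vI.
transitivity (uv_u * (uv_v * DD nhh (uv_u + uv_v) uv_u) + uv_v * uvps nhh (uv_u + uv_v)).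
  by ring.
rewrite hK; have e1 := S_e lu; have e2 := S_e lv; have e3 := S_e luv.
rewrite S_eD // e1 e2 in e3.
set H := uvps nhh (uv_u + uv_v) in e3 *; set h := uvps nhh uv_u in e1 e3 *.
set k := uvps nhh uv_v in e2 e3 *.
transitivity (1 + (uv_u + uv_v) * H - 1 - uv_u * h); first by ring.
by rewrite -e3 e1; ring.
Qed.

Variables (V : lmodType rat) (g : grading V).
Implicit Types a c : compl g -> compl g.

Lemma ps_exp_hhN a z : fmap 1 a ->
  ps a nexp (ps (fun z => - a z) nhh z) = ps a nhh z.
Proof.
move=> aF; pose o : compl g -> compl g := fun=> 0.
have oF : fmap 1 o.
  by split=> [c x y|n w _]; [rewrite scaler0 addr0|apply: low_zero].
have A f w : act a o (uv_u * f) w = a (act a o f w) by apply: act_u.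
have AN f w : act a o (- uv_u * f) w = - a (act a o f w).
  by rewrite mulNr (actN aF oF) A.
have -> : ps (fun z => - a z) nhh z = act a o (uvps nhh (- uv_u) * 1) z.
  by rewrite (act_S (P := fun z => - a z) aF oF _ _ _ (uv_lowN low_u) AN) act1.
rewrite -(act_S (P := a) aF oF _ _ _ low_u A) mulr1 S_hhN_u.
by rewrite -[uvps nhh _]mulr1 (act_S (P := a) aF oF _ _ _ low_u A) act1.
Qed.

(** The logarithmic derivative of e^{x + y} computed as that of e^x e^y, when z and w deform x and y
    so that they still commute, which is the hypothesis on c z. It rests on h(u + v) = h(u) + v D
    with D a divided difference and on v z = u w. *)
Lemma ps_hh_add a c z w : fmap 1 a -> fmap 1 c -> (forall z, a (c z) = c (a z)) ->
  c z = a w ->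
  ps (fun z => a z + c z) nhh (z + w) = ps a nhh z + ps a nexp (ps c nhh w).
Proof.
move=> aF cF ac cz; pose R := act a c.
have A f x : R (uv_u * f) x = a (R f x) by apply: (act_u aF cF).
have C f x : R (uv_v * f) x = c (R f x) by apply: (act_v aF cF ac).
have AC f x : R ((uv_u + uv_v) * f) x = a (R f x) + c (R f x).
  by rewrite mulrDl /R (actD aF cF) -/R A C.
have luv := uv_lowD low_u low_v.
have E x : ps (fun z => a z + c z) nhh x = R (uvps nhh (uv_u + uv_v) * 1) x.
  by rewrite /R (act_S (P := fun z => a z + c z) aF cF _ _ _ luv AC) act1.
rewrite (linD (ps_fmap (fmapD aF cF) _).1) !E !mulr1.
have := DDP nhh luv low_u; rewrite subv_uv => hK.
have hKu : uvps nhh (uv_u + uv_v) = uvps nhh uv_u * 1 + uv_v * DD nhh (uv_u + uv_v) uv_u.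
  by rewrite hK; ring.
rewrite {1}hKu {1}/R (actD aF cF) -/R C /R -(act_cr aF cF ac) cz (act_ar aF cF ac) -/R -A -addrA.
rewrite /R (act_S (P := a) aF cF _ _ _ low_u A) act1 -(actD aF cF) S_hh_add.
rewrite (act_S (P := a) aF cF _ _ _ low_u A) -[uvps nhh _]mulr1.
by rewrite (act_S (P := c) aF cF _ _ _ low_v C) act1.
Qed.

End HhIdentities.

Section DualElliptic.
Variables (psi : f2) (psiP : in_grt1 psi).
Variables (L : lieType) (g : lieGrading L).
Local Notation LL := (compl g).
Variables (x y pot p q d f : 'I_3 -> LL).
Hypothesis xyE : elliptic3 x y.
Local Notation t := (el_t x y).
Local Notation t0 := (el_t0 x y).
Hypothesis potP : forall i j k, uniq [:: i; j; k] ->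
  pot j - pot i = f2_eval (t i k) (t k j) psi.
Hypothesis pE : forall i, p i = f2_eval (t0 i) (el_s x y i) psi + pot i.
Hypothesis qE : forall i, q i = f2_eval (el_r x y i) (el_s x y i) psi + pot i.
Hypothesis dl : forall i, low 1 (d i).
Hypothesis dE : forall i, ps (lbra (x i)) nhh (d i) = el_delta x p q i.
Let X i := cpair (x i) (d i).
Let Y i := cpair (y i) (f i).
Hypothesis YE : forall i, T0 (X i) (Y i) = cpair (t0 i) <[p i, t0 i]>.
Variable T : 'I_3 -> 'I_3 -> compl (dual_grading g).
Hypothesis TE : forall i j k, uniq [:: i; j; k] -> T j k = cpair (t j k) <[pot i, t j k]>.
Hypothesis XT : forall i j k, uniq [:: i; j; k] -> <[X i, T j k]> = 0.
Hypothesis YT : forall i j k, uniq [:: i; j; k] -> <[Y i, T j k]> = 0.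

Let xl i : low 1 (x i). Proof. by case: xyE. Qed.
Let xx i j : <[x i, x j]> = 0. Proof. by case: xyE. Qed.
Let aF i := ad_fmap (xl i).
Let Xl i : low 1 (X i). Proof. exact: cpair_low. Qed.

(** The cocycle identity is this one with both (e^{ad x_i} - 1) / ad x_i and its analogue for j
    applied, and these operators are invertible. *)
Lemma dual_dC i j : <[x j, d i]> = <[x i, d j]>.
Proof.
have [->//|ij] := eqVneq i j.
apply: (ps_hh_inj (aF i)); apply: (ps_hh_inj (aF j)).
have C k l z pp qq : ps (lbra (x k)) pp (ps (lbra (x l)) qq z) =
    ps (lbra (x l)) qq (ps (lbra (x k)) pp z).
  apply: (ps_comm _ _ (aF l) (ps_fmap (aF k) pp)) => w.
  by rewrite (ps_comm (a' := lbra (x k)) (b := lbra (x l)) _ _ (aF k) (aF l)) // => v;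
     apply: lbra_comm.
have D k l z : <[x k, ps (lbra (x l)) nhh z]> = ps (lbra (x l)) nhh <[x k, z]>.
  by apply: (ps_comm _ _ (aF l) (aF k)) => w; apply: lbra_comm.
have h := el_delta_cocycle psiP xyE potP pE qE ij.
rewrite -!dE /el_e !ps_exp // in h.
have {h} : <[x j, ps (lbra (x j)) nhh (ps (lbra (x i)) nhh (d i))]> =
       <[x i, ps (lbra (x i)) nhh (ps (lbra (x j)) nhh (d j))]>.
  by apply: (addrI (ps (lbra (x j)) nhh (d j) + ps (lbra (x i)) nhh (d i))); rewrite -addrA -h; zmod.
by rewrite !D [in RHS]C.
Qed.

Lemma dual_XX i j : <[X i, X j]> = 0.
Proof.
by rewrite cpair_bra xx -(dual_dC i j) [<[d i, _]>]lbraC addrN cpair0.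
Qed.

(** With a = ad x_i + ad x_j = - ad x_k and h(u) = (e^u - 1) / u, the first two terms of
    [el_delta_sum] make h(a)(d_i + d_j) and the third e^a h(- a) d_k = h(a) d_k; then h(a) is
    inverted. *)
Lemma dual_dsum i j k : uniq [:: i; j; k] -> d i + d j + d k = 0.
Proof.
move=> u; have := el_delta_sum psiP xyE potP pE qE u; rewrite -!dE /el_e.
have xs : x i + x j = - x k.
  by apply/eqP; rewrite -addr_eq0 -(sum3 x u); case: xyE => _ _ -> _ _.
have cij z : <[x i, <[x j, z]>]> = <[x j, <[x i, z]>]> by apply: lbra_comm.
have xkE : lbra (x k) = (fun z => - (<[x i, z]> + <[x j, z]>)).
  by apply: funext => z; rewrite -lbraDl -lbraNl xs opprK.
rewrite -[X in _ + X]exp_add // xkE (ps_exp_hhN _ (fmapD (aF i) (aF j))).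
rewrite -(ps_hh_add (aF i) (aF j) cij (dual_dC i j)).
rewrite -(linD (ps_fmap (fmapD (aF i) (aF j)) nhh).1) => h.
apply: (ps_hh_inj (fmapD (aF i) (aF j))); rewrite h.
by rewrite (lin0 (ps_fmap (fmapD (aF i) (aF j)) nhh).1).
Qed.

Lemma dual_Xsum i j k : uniq [:: i; j; k] -> X i + X j + X k = 0.
Proof.
move=> u; rewrite !cpairD dual_dsum // -(sum3 x u).
by case: xyE => _ _ -> _ _; apply: cpair0.
Qed.

(** The exponential relation over the dual numbers has the eps part [el_bra_t0], and [exp_T02_inv]
    recovers the bracket from it. *)
Lemma dual_XY i j : i != j -> <[X i, Y j]> = T i j.
Proof.
move=> ij; have [k u] := others3 ij.
have [uikj ujik ujki ukij ukji] := uniq3_perm u.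
apply: (@exp_T02_inv _ _ (X i) (X j) (X k)) => //.
- exact: dual_XX.
- exact: dual_Xsum.
- exact: XT.
rewrite YE (TE ukij) cpairD exp_dual // dE -/(el_e x i).
rewrite (el_e_t0 xyE ij) addrC (el_bra_t0 psiP xyE potP pE qE u).
by [].
Qed.

Lemma dual_Ysum i j k : uniq [:: i; j; k] -> Y i + Y j + Y k = 0.
Proof.
move=> u; have [uikj ujik ujki ukij ukji] := uniq3_perm u; have /uniq3P[ij ik jk] := u.
have TC a b c : uniq [:: a; b; c] -> T b c = T c b.
  move=> v; have [vacb _ _ _ _] := uniq3_perm v; have /uniq3P[ab ac bc] := v.
  by rewrite (TE v) (TE vacb) (el_ts xyE).
apply: oppr_inj; rewrite oppr0.
rewrite -(T0_sum (X1 := X i) (X2 := X j) (X3 := X k) (T12 := T i j) (T13 := T i k) (T23 := T j k)) //.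
- rewrite !YE (TE ukij) (TE ujik) (TE u) !cpairD -cpair0; congr cpair.
    exact: (el_sum xyE).
  exact: (el_bra_sum psiP xyE potP pE qE u).
all: try exact: dual_XX.
- exact: dual_Xsum.
- exact: dual_XY.
- by rewrite (TC k) //; apply: dual_XY; rewrite eq_sym.
- exact: dual_XY.
- by rewrite (TC j) //; apply: dual_XY; rewrite eq_sym.
- exact: dual_XY.
- by rewrite (TC i) //; apply: dual_XY; rewrite eq_sym.
all: exact: XT.
Qed.

(** [bra_T0] identifies the bracket with a deformed relation of t_4, whose eps part is [el_bra_t04].
    It comes last because it requires all the other relations of the deformed triple. *)
Lemma dual_YY i j : i != j -> <[Y i, Y j]> = 0.
Proof.
move=> ij; have [k u] := others3 ij.
have [uikj ujik ujki ukij ukji] := uniq3_perm u; have /uniq3P[_ ik jk] := u.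
have TC a b c : uniq [:: a; b; c] -> T b c = T c b.
  move=> v; have [vacb _ _ _ _] := uniq3_perm v; have /uniq3P[ab ac bc] := v.
  by rewrite (TE v) (TE vacb) (el_ts xyE).
rewrite -(@bra_T0 _ _ (X i) (X j) (X k) (Y i) (Y j) (Y k) (T i j) (T i k) (T j k)) //.
- rewrite !YE (TE ukij) cpairD cpair_bra -cpair0; congr cpair.
    exact: (el_t04 xyE).
  by rewrite addrC; exact: (el_bra_t04 psiP xyE potP pE qE u).
all: try exact: dual_XX.
all: try by [apply: dual_Xsum|apply: dual_Ysum|apply: XT|apply: YT|apply: dual_XY].
- by rewrite (TC k) //; apply: dual_XY; rewrite eq_sym.
- by rewrite (TC j) //; apply: dual_XY; rewrite eq_sym.
- by rewrite (TC i) //; apply: dual_XY; rewrite eq_sym.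
Qed.

End DualElliptic.

(** * The equations of grt_1^ell in the completion of t_{1,3} *)

Lemma cauchy_csingle (V : lmodType rat) (g : grading V) (op : V -> V -> V) m n a b
    (ga : g m a) (gb : g n b) d : (forall z, op 0 z = 0) -> (forall z, op z 0 = 0) ->
  cauchy op (csingle ga) (csingle gb) d = if d == (m + n)%N then op a b else 0.
Proof.
move=> op0 op0r; rewrite /cauchy /=; have [->|dN] := eqVneq d (m + n)%N.
  have lm : (m < (m + n).+1)%N by rewrite ltnS leq_addr.
  rewrite (bigD1 (Ordinal lm)) //= eqxx addKn eqxx big1 ?addr0 // => i iN.
  by rewrite ifF ?op0 //; apply: contraNF iN => /eqP im; apply/eqP/val_inj.
rewrite big1 // => i _; case: eqP => [im|]; last by rewrite op0.
case: eqP => [dn|]; last by rewrite op0r.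
by case/eqP: dN; have := ltn_ord i; lia.
Qed.

Section Singles.
Variables (L : lieType) (g : lieGrading L).

Lemma csingle_bra m n a b (ga : g m a) (gb : g n b) :
  <[csingle ga, csingle gb]> = csingle (gpart_bra ga gb).
Proof.
by apply: compl_ext => d; apply: cauchy_csingle => z; [apply: lbra0x|apply: lbrax0].
Qed.

Lemma csingle_eq m n a b (ga : g m a) (gb : g n b) :
  m = n -> a = b -> csingle ga = csingle gb.
Proof. by move=> mn ab; apply: compl_ext => d /=; rewrite mn ab. Qed.

Lemma csingle_eq0 m a (ga : g m a) : a = 0 -> csingle ga = 0.
Proof. by move=> a0; apply: compl_ext => d /=; rewrite a0 if_same. Qed.

Lemma bra_csingle m a (ga : g m a) (z : compl g) d :
  <[csingle ga, z]> (m + d)%N = <[a, z d]>.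
Proof.
rewrite /= /cauchy; have lm : (m < (m + d).+1)%N by rewrite ltnS leq_addr.
rewrite (bigD1 (Ordinal lm)) //= eqxx addKn big1 ?addr0 // => i iN.
by rewrite ifF ?lbra0x //; apply: contraNF iN => /eqP im; apply/eqP/val_inj.
Qed.

Lemma iter_csingle m a (ga : g 1%N a) b (gb : g m b) n d :
  iter n (lbra (csingle ga)) (csingle gb) d = if d == (m + n)%N then iter n (lbra a) b else 0.
Proof.
elim: n d => [|n IH] d; first by rewrite addn0.
case: d => [|d]; first by rewrite /= /cauchy big_ord1 lbra0x addnS.
have := bra_csingle ga (iter n (lbra (csingle ga)) (csingle gb)) d.
rewrite add1n iterS => ->; rewrite IH addnS eqSS.
by case: eqP; rewrite ?lbrax0.
Qed.

End Singles.

Section Componentwise.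
Variables (V W : lmodType rat) (g : grading V) (h : grading W) (f : V -> W).
Hypotheses (fL : linear f) (fg : forall d x, g d x -> h d (f x)).

Definition cmap (z : compl g) : compl h := mkcompl (fun d => fg (complP z d)).

Lemma cmap_fmap : fmap 0 cmap.
Proof.
split=> [a x y|n x lx d dn]; first by apply: compl_ext => d; apply: fL.
by rewrite /= lx ?(lin0 fL) // -[n]addn0.
Qed.

Lemma cmap_csingle d x (gx : g d x) : cmap (csingle gx) = csingle (fg gx).
Proof. by apply: compl_ext => e /=; case: eqP; rewrite ?(lin0 fL). Qed.

End Componentwise.

Lemma cmap_morph (L M : lieType) (g : lieGrading L) (h : lieGrading M) (f : L -> M)
    (fM : lie_morphism f) (fg : forall d x, g d x -> h d (f x)) :
  lie_morphism (cmap fg).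
Proof.
split=> [|x y]; first exact: (cmap_fmap fM.1 fg).1.
apply: compl_ext => d; rewrite /= /cauchy (lin_sum fM.1).
by apply: eq_bigr => i _; rewrite fM.2.
Qed.

Lemma homog_morph (G : Type) (R : lterm G -> lterm G -> Prop) (dg : G -> nat)
    (M : lieType) (h : lieGrading M) (f : presLie R -> M) :
  lie_morphism f -> (forall x, h (dg x) (f (lgen R x))) ->
  forall d x, pres_grading R dg d x -> h d (f x).
Proof.
move=> fM fg d x; elim=> {d x} [x|d|d x y _ IHx _ IHy|d a x _ IH|m n x y _ IHx _ IHy].
- exact: fg.
- by rewrite (lin0 fM.1); apply: gpart0.
- by rewrite (linD fM.1); apply: gpartD.
- by rewrite (linZ fM.1); apply: gpartZ.
- by rewrite fM.2; apply: gpart_bra.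
Qed.

Lemma ps_morph (L M : lieType) (g : lieGrading L) (h : lieGrading M)
    (f : compl g -> compl h) k p x z : lie_morphism f -> fmap k f -> low 1 x ->
  f (ps (lbra x) p z) = ps (lbra (f x)) p (f z).
Proof. by move=> fM fF lx; apply: (ps_comm _ _ (ad_fmap lx) fF) => w; apply: fM.2. Qed.

Lemma T0_morph (L M : lieType) (g : lieGrading L) (h : lieGrading M)
    (f : compl g -> compl h) k x y : lie_morphism f -> fmap k f -> low 1 x ->
  f (T0 x y) = T0 (f x) (f y).
Proof. by move=> fM fF lx; rewrite (linN fM.1) (ps_morph _ _ fM fF lx). Qed.

Section That12.
Local Notation xh := (x_hat true 1).
Local Notation yh := (x_hat false 1).

Lemma strand11 : strand 1 1 = ord0. Proof. by apply: val_inj; rewrite /strand /= inordK. Qed.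
Lemma strand12 : strand 1 2 = ord_max. Proof. by apply: val_inj; rewrite /strand /= inordK. Qed.

Lemma x_hat2 s : x_hat s 2 = - x_hat s 1.
Proof.
apply: compl_ext => d; rewrite complN /= strand11 strand12 t12_x2.
by case: eqP; rewrite ?oppr0.
Qed.

Lemma x_hat_low s k : low 1 (x_hat s k). Proof. exact: low_csingle. Qed.

Lemma t0_hatE k : t0_hat k = T0 (x_hat true k) (x_hat false k).
Proof.
apply: compl_ext => -[|d]; rewrite complN csumE.
  by rewrite big_ord1 complZ iter_csingle /= scaler0 oppr0.
rewrite (bigD1 (Ordinal (ltnW (ltnSn d.+1)))) // complZ iter_csingle add1n eqxx.
rewrite big1 => [|i iN]; first by rewrite /= addr0.
rewrite complZ iter_csingle add1n eqSS ifF ?scaler0 //.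
by apply: contraNF iN => /eqP di; apply/eqP/val_inj.
Qed.

Lemma t_hat12 : t_hat 1 2 = - <[xh, yh]>.
Proof. by rewrite /t_hat x_hat2 lbraNr. Qed.
Lemma t_hat21 : t_hat 2 1 = t_hat 1 2.
Proof. by rewrite t_hat12 /t_hat x_hat2 lbraNl. Qed.

(** As x_2 = - x_1 and y_2 = - y_1, this is b(- u) = e^u b(u) with b(u) = u / (e^u - 1). *)
Lemma t0_hat2 : t0_hat 2 = - ps (lbra xh) nexp (t0_hat 1).
Proof.
have lx := @x_hat_low true 1; have aF := ad_fmap lx.
rewrite !t0_hatE /T0 !x_hat2 (linN (ps_fmap aF _).1) opprK lbraN.
rewrite (linN (ps_fmap (fmapN aF) _).1) opprK.
by rewrite (ps_bernN aF) ps_exp // ps_hh_bern.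
Qed.

Lemma t0_hat_sum : t0_hat 1 + t0_hat 2 + t_hat 1 2 = 0.
Proof.
have lx := @x_hat_low true 1; have aF := ad_fmap lx.
by rewrite t0_hat2 ps_exp // t0_hatE /T0 (linN (ps_fmap aF _).1) ps_hh_bern // lbraNr t_hat12; zmod.
Qed.

Lemma t0_hat2_sum : t0_hat 2 = - (t0_hat 1 + t_hat 1 2).
Proof. by apply/eqP; rewrite -subr_eq0 -t0_hat_sum; apply/eqP; zmod. Qed.

End That12.

Definition t13_hat : lieType := compl (t1_grading 3).
Definition x13 s (i : 'I_3) : t13_hat := csingle (x_homog s i).

Lemma x13_low s i : low 1 (x13 s i). Proof. exact: low_csingle. Qed.

Lemma x13_elliptic : elliptic3 (x13 true) (x13 false).
Proof.
have S s : \sum_i x13 s i = 0.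
  apply: compl_ext => d; rewrite compl_sum /=; case: eqP => _; last by rewrite big1.
  exact: x_sum.
split=> // [i|i j|]; first exact: x13_low.
  by rewrite csingle_bra; apply/csingle_eq0/x_xx.
split=> [i j|i j ij|i j k u|i j k u]; rewrite !csingle_bra.
- exact/csingle_eq0/x_xx.
- exact/csingle_eq/x_xy.
- exact/csingle_eq0/x_xt.
- exact/csingle_eq0/x_xt.
Qed.

Definition ins_blocks (i : 'I_3) (b : 'I_2) : {set 'I_3} :=
  if b == ord0 then [set i] else ~: [set i].

Definition ins13 i : t12 -> t1lie 3 := t1_ins (ins_blocks i).

Lemma ins13P i : lie_morphism (ins13 i) /\
  forall s, ins13 i (x_ s ord0) = x_ s i.
Proof.
have [||insM insE] := @t1_insP _ _ (ins_blocks i).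
- move=> a b ab; rewrite /ins_blocks.
  have [aE|aN] := eqVneq a ord0; have [bE|bN] := eqVneq b ord0.
  + by rewrite aE bE eqxx in ab.
  + by rewrite -setI_eq0 setICr.
  + by rewrite -setI_eq0 setIC setICr.
  by case/eqP: ab; apply: val_inj; case: a b aN bN => [[|[|//]] ?] [[|[|//]] ?].
- move=> a; rewrite /ins_blocks; have [->|ai] := eqVneq a i.
    by exists ord0; rewrite eqxx set11.
  by exists ord_max; rewrite /= !inE.
by split=> // s; rewrite /ins13 insE /ins_blocks eqxx big_set1.
Qed.

Lemma ins13_x2 i s : ins13 i (x_ s ord_max) = - x_ s i.
Proof. by have [insM insE] := ins13P i; rewrite t12_x2 (linN insM.1) insE. Qed.

Lemma ins13_homog i d z : t1_grading 2 d z -> t1_grading 3 d (ins13 i z).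
Proof.
have [insM insE] := ins13P i; apply: (homog_morph insM) => -[s b].
have [->|/eqP bN] := eqVneq b ord0; first by rewrite -[lgen _ _]/(x_ s ord0) insE; apply: x_homog.
have -> : b = ord_max by apply: val_inj; case: b bN => [[|[|//]] ?] //; case/eqP.
rewrite -[lgen _ _]/(x_ s ord_max) ins13_x2 -scaleN1r.
by apply: (@gpartZ _ (t1_grading 3)); apply: x_homog.
Qed.

(** The insertion z |-> z^{i,jk} on completions. *)
Definition iota i : t12_hat -> t13_hat := cmap (@ins13_homog i).

Lemma iota_morph i : lie_morphism (iota i).
Proof. exact: (cmap_morph (ins13P i).1). Qed.
Lemma iota_fmap i : fmap 0 (iota i).
Proof. exact: (cmap_fmap (ins13P i).1.1). Qed.

Lemma iota_x i s : iota i (x_hat s 1) = x13 s i.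
Proof.
rewrite /iota (cmap_csingle (ins13P i).1.1); apply: csingle_eq => //.
by rewrite strand11 (ins13P i).2.
Qed.

Lemma iota_bra_t i j k z : uniq [:: i; j; k] -> <[iota i z, <[x13 true j, x13 false k]>]> = 0.
Proof.
move=> u; have h w : <[<[x_ true j, x_ false k]>, ins13 i w]> = 0.
  have [insM insE] := ins13P i.
  have dz := lbra_linr (<[x_ true j, x_ false k]> : t1lie 3).
  have L0 : linear (fun x : t12 => <[<[x_ true j, x_ false k]>, ins13 i x]>).
    by move=> a x y; rewrite insM.1 dz.
  apply: (lie_der_ext (f := ins13 i) (e := fun=> 0) L0).
  - by move=> a x y; rewrite scaler0 addr0.
  - by move=> x y; rewrite insM.2 lbra_leibniz.
  - by move=> x y; rewrite lbra0x lbrax0 addr0.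
  have hx s : <[<[x_ true j, x_ false k]>, x_ s i]> = 0.
    by apply: lbra_eq0C; apply: x_xt; rewrite (uniq_catC [:: j; k] [:: i]).
  case=> s b; have [->|/eqP bN] := eqVneq b ord0.
    by rewrite -[lgen _ _]/(x_ s ord0) insE.
  have -> : b = ord_max by apply: val_inj; case: b bN => [[|[|//]] ?] //; case/eqP.
  by rewrite -[lgen _ _]/(x_ s ord_max) ins13_x2 lbraNr hx oppr0.
apply: lbra_eq0C; rewrite csingle_bra; apply: compl_ext => d.
have [d2|d2] := ltnP d 2.
  by have := lbra_low (low_csingle (gpart_bra (x_homog true j) (x_homog false k)) (leqnn _)) (low0z (iota i z)); apply.
by rewrite -(subnKC d2) bra_csingle h.
Qed.

(** The family on four strands whose only nonzero member is t_12 = z reduces the pentagon to psi(z,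
    0) = 0. *)
Lemma f2_eval_z0 psi (L : lieType) (z : L) : in_grt1 psi -> f2_eval z 0 psi = 0.
Proof.
move=> psiP; pose F (i j : 'I_4) := if (i + j == 1)%N then z else 0.
have FF : t_family F.
  have FE i j : F i j = z \/ F i j = 0 by rewrite /F; case: ifP; [left|right].
  have FB i j k l : <[F i j, F k l]> = 0.
    by case: (FE i j) => ->; case: (FE k l) => ->; rewrite ?lbraxx ?lbra0x ?lbrax0.
  by split=> [i j _|i j k _|i j k l _] //; [rewrite /F addnC|rewrite lbraDr !FB addr0].
have u : uniq [:: (inord 0 : 'I_4); inord 1; inord 2; inord 3].
  by rewrite /= !inE -!val_eqE /= !inordK.
have := grt1_pent psiP FF u; rewrite /F !inordK //= !addr0.
have -> : f2_eval 0 0 psi = 0 :> L.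
  apply: (lie_morphism_ext (h := fun=> 0)); first by case: (f2_evalP (0 : L) 0).
    by split=> [a x y|x y]; rewrite ?scaler0 ?addr0 ?lbraxx.
  by case; rewrite -/fA -/fB ?f2_evalA ?f2_evalBB.
by rewrite subrr add0r subrr add0r.
Qed.

(** As z commutes with A and B, psi(A + z, B) splits as psi(A, B) + psi(z, 0). This is needed
    because inserting i, jk in t_02 gives t_0j + t_0k + t_jk, one central term more than
    psi^{0,jk,i} has. *)
Lemma f2_eval_central psi (L : lieType) (z A B : L) : in_grt1 psi ->
  <[z, A]> = 0 -> <[z, B]> = 0 -> f2_eval (A + z) B psi = f2_eval A B psi.
Proof.
move=> psiP zA zB; rewrite -[RHS]addr0 -(f2_eval_z0 z psiP).
have zC x : <[z, f2_eval A B x]> = 0 by apply: f2_eval_comm.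
have z0 x : <[z, f2_eval z 0 x]> = 0 by apply: f2_eval_comm; rewrite ?lbraxx ?lbrax0.
have fz w x : <[w, z]> = 0 -> <[w, f2_eval z 0 x]> = 0.
  by move=> h; apply: f2_eval_comm; rewrite ?h ?lbrax0.
apply: (lie_morphism_ext (h := fun x => f2_eval A B x + f2_eval z 0 x)).
- by case: (f2_evalP (A + z) B).
- split=> [a x y|x y]; first by rewrite !f2_evalL scalerDr addrACA.
  rewrite !f2_evalB lbraDr !lbraDl.
  rewrite (fz _ _ (lbra_eq0C (zC x))) (fz _ _ (lbra_eq0C (z0 x))).
  by rewrite (lbra_eq0C (fz _ _ (lbra_eq0C (zC y)))) !addr0 .
by case; rewrite -/fA -/fB ?f2_evalA ?f2_evalBB ?addr0.
Qed.

Section EllEquations.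
Variables (psi : f2) (psiP : in_grt1 psi).
Local Notation x := (x13 true).
Local Notation y := (x13 false).
Local Notation t := (el_t x y).
Local Notation t0 := (el_t0 x y).
Local Notation xyE := x13_elliptic.
Local Notation P A B := (f2_eval A B psi).
Local Notation i1 := (inord 1 : 'I_3).
Local Notation i2 := (inord 2 : 'I_3).

(* Normalized by 0 at the first strand; the differences are the psi^{i,k,j}. *)
Definition potential (l : 'I_3) : t13_hat :=
  if l == ord0 then 0
  else if l == i1 then P (t ord0 i2) (t i2 i1) else P (t ord0 i1) (t i1 i2).
Local Notation pot := potential.

Lemma neq_I3 : [/\ (ord0 == i1) = false, (ord0 == i2) = false, (i1 == i2) = false &
  [/\ (i1 == ord0) = false, (i2 == ord0) = false & (i2 == i1) = false]].
Proof. by do 2?split; rewrite -val_eqE /= !inordK. Qed.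

Lemma potentialP i j k : uniq [:: i; j; k] -> pot j - pot i = P (t i k) (t k j).
Proof.
have [n01 n02 n12 [n10 n20 n21]] := neq_I3.
have u : uniq [:: ord0; i1; i2] by rewrite /= !inE n01 n02 n12.
have cT := el_central' xyE u.
have cT' : central3 (t ord0 i2) (t i1 i2) (t ord0 i1).
  by case: cT => a b c; split; rewrite // addrC.
have cT'' : central3 (t ord0 i1) (t ord0 i2) (t i1 i2).
  by case: cT => a b c; split; rewrite // addrC.
have aT := grt1_anti psiP cT; have cyc := grt1_cyc psiP cT.
have aT' := grt1_anti psiP cT'; have aT'' := grt1_anti psiP cT''.
rewrite aT' in cyc; rewrite aT'' in cyc.
have ts a b : (a == b) = false -> t a b = t b a by move=> ab; apply: (el_ts xyE); rewrite ab.
have e10 := ts _ _ n10; have e20 := ts _ _ n20; have e21 := ts _ _ n21.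
elim/forall_I3: i; elim/forall_I3: j; elim/forall_I3: k;
  rewrite /= ?inE ?eqxx ?n01 ?n02 ?n12 ?n10 ?n20 ?n21 //= => _;
  rewrite /pot ?eqxx ?n01 ?n02 ?n12 ?n10 ?n20 ?n21 ?e10 ?e20 ?e21 ?aT ?aT' ?aT'' ?subr0 ?sub0r //.
- by apply/eqP; rewrite -subr_eq0 -cyc; apply/eqP; zmod.
- by apply/eqP; rewrite -subr_eq0 -oppr_eq0 -cyc; apply/eqP; zmod.
Qed.

Variable u : bool -> t12_hat.
Hypothesis ul : forall s, low 1 (u s).
Local Notation xh := (x_hat true 1).
Local Notation yh := (x_hat false 1).
Local Notation gd := (dual_grading (t1_grading 2)).
Local Notation gd3 := (dual_grading (t1_grading 3)).
(** The prescribed values of D_psi on e^{x_1}, after division by e^{x_1}, and on t_01, the latter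
    over the dual numbers. *)
Hypothesis up : ps (lbra xh) nhh (u true) = psi021 psi - ps (lbra xh) nexp (psi012 psi).
Hypothesis um : T0 (cpair xh (u true) : compl gd) (cpair yh (u false)) =
  cpair (t0_hat 1) <[psi012 psi, t0_hat 1]>.

Let s_ := el_s x y.
Let r_ := el_r x y.
Let p i := P (t0 i) (s_ i) + pot i.
Let q i := P (r_ i) (s_ i) + pot i.

Let others (i : 'I_3) : exists j k, uniq [:: i; j; k].
Proof.
have [j ij] : exists j, i != j.
  by elim/forall_I3: i; [exists i1|exists ord0|exists ord0]; rewrite -val_eqE /= !inordK.
by have [k u'] := others3 ij; exists j, k.
Qed.

Let sE i : s_ i = - <[x i, y i]>.
Proof.
have [j [k uijk]] := others i.
by rewrite /s_ /el_s (el_others _ uijk) (el_xii xyE uijk) opprK.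
Qed.

Let iota_t0 i : iota i (t0_hat 1) = t0 i.
Proof.
by rewrite t0_hatE (T0_morph _ (iota_morph i) (iota_fmap i) (x_hat_low _ _)) !iota_x.
Qed.
Let iota_t12 i : iota i (t_hat 1 2) = s_ i.
Proof.
by rewrite t_hat12 (linN (iota_morph i).1) (iota_morph i).2 !iota_x sE.
Qed.

Let iota_012 i : iota i (psi012 psi) = P (t0 i) (s_ i).
Proof. by rewrite (f2_eval_morph _ _ _ (iota_morph i)) iota_t0 iota_t12. Qed.

Let iota_021 i : iota i (psi021 psi) = P (r_ i) (s_ i).
Proof.
rewrite (f2_eval_morph _ _ _ (iota_morph i)) t_hat21 iota_t12.
have [j [k uijk]] := others i; have [uikj ujik ujki ukij ukji] := uniq3_perm uijk.
have rE : r_ i = t0 j + t0 k by apply: el_others.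
have sE' : s_ i = t i j + t i k by apply: el_others.
have /uniq3P[ij ik jk] := uijk.
have -> : iota i (t0_hat 2) = r_ i + t j k.
  rewrite t0_hat2_sum (linN (iota_morph i).1) (linD (iota_morph i).1) iota_t0 iota_t12 rE sE'.
  by apply/eqP; rewrite -subr_eq0 -oppr_eq0 -(el_sum xyE uijk); apply/eqP; zmod.
apply: f2_eval_central => //; first by rewrite rE; apply: (el_tt0 xyE).
rewrite sE'; have := el_t4 xyE ujki.
by rewrite (el_ts xyE ij) (el_ts xyE ik).
Qed.

(** The eps parts of the deformed x_i and y_i: the insertions of u_+ and u_- followed by the gauge
    of potential [pot i]. *)
Let d i := iota i (u true) + <[pot i, x i]>.
Let f i := iota i (u false) + <[pot i, y i]>.

Let dl i : low 1 (d i).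
Proof.
apply: lowD; first by have := (iota_fmap i).2 _ _ (ul true); rewrite addn0.
by apply: (lbra_low (m := 0)) (low0z _) (x13_low _ _).
Qed.

Let dE i : ps (lbra (x i)) nhh (d i) = el_delta x p q i.
Proof.
have xl := x13_low true i; have aF := ad_fmap xl.
rewrite (linD (ps_fmap aF _).1) /el_delta /p /q.
rewrite -{1}(iota_x i true) -(ps_morph _ _ (iota_morph i) (iota_fmap i) (x_hat_low _ _)) up.
rewrite (linB (iota_morph i).1) iota_021 (ps_morph _ _ (iota_morph i) (iota_fmap i) (x_hat_low _ _)).
rewrite iota_012 iota_x [<[pot i, _]>]lbraC (linN (ps_fmap aF _).1).
rewrite ps_op // /el_e (linD (ps_fmap aF nexp).1) [ps _ nexp (pot i)]ps_exp //.
by zmod.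
Qed.

Definition iota2 i (z : compl gd) : compl gd3 := cpair (iota i (cfst z)) (iota i (csnd z)).

Lemma iota2_morph i : lie_morphism (iota2 i).
Proof.
have [iL iB] := iota_morph i; split=> [a z w|z w].
  rewrite /iota2 (cfst_fmap (t1_grading 2)).1 (csnd_fmap (t1_grading 2)).1 !iL.
  by rewrite cpairZ cpairD.
rewrite [z]cpair_eta [w]cpair_eta cpair_bra /iota2 !cfst_pair !csnd_pair cpair_bra.
by rewrite iB (linD iL) !iB.
Qed.

Lemma iota2_fmap i : fmap 0 (iota2 i).
Proof.
split=> [|n z lz]; first exact: (iota2_morph i).1.
by apply: cpair_low; apply: (iota_fmap i).2; rewrite -[n]addn0;
  [apply: (cfst_fmap _).2|apply: (csnd_fmap _).2].
Qed.

(** A Lie morphism carrying x_1 + eps u_+ and y_1 + eps u_- to the deformed x_i and y_i, hence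
    compatible with [T0]. *)
Let sigma i z := gauge (pot i) (iota2 i z).
Let sigma_morph i : lie_morphism (sigma i).
Proof. exact: lie_morphism_comp (gauge_morph _) (iota2_morph i). Qed.
Let sigma_fmap i : fmap 0 (sigma i).
Proof.
split=> [|n z lz]; first exact: (sigma_morph i).1.
by rewrite -[(n + 0)%N]addn0; apply: (gauge_fmap _).2; apply: (iota2_fmap i).2.
Qed.
Let sigmaE i z w : sigma i (cpair z w) = cpair (iota i z) (iota i w + <[pot i, iota i z]>).
Proof. by rewrite /sigma /iota2 cfst_pair csnd_pair gauge_pair. Qed.

Let X i : compl gd3 := cpair (x i) (d i).
Let Y i : compl gd3 := cpair (y i) (f i).
Let XE i : X i = sigma i (cpair xh (u true)).
Proof. by rewrite sigmaE iota_x. Qed.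
Let YE0 i : Y i = sigma i (cpair yh (u false)).
Proof. by rewrite sigmaE iota_x. Qed.

Let YE i : T0 (X i) (Y i) = cpair (t0 i) <[p i, t0 i]>.
Proof.
rewrite XE YE0 -(T0_morph _ (sigma_morph i) (sigma_fmap i)); last first.
  by apply: cpair_low; [apply: x_hat_low|apply: ul].
by rewrite um sigmaE (iota_morph i).2 iota_012 iota_t0 -lbraDl.
Qed.

(** For distinct j and k the sum has one term, that of the third strand; written so, it needs no
    name for that strand. *)
Let T j k : compl gd3 := cpair (t j k) (\sum_(l | (l != j) && (l != k)) <[pot l, t j k]>).

Let TE i j k : uniq [:: i; j; k] -> T j k = cpair (t j k) <[pot i, t j k]>.
Proof.
move=> u0; have [uikj ujik ujki ukij ukji] := uniq3_perm u0; have /uniq3P[ij ik jk] := u0.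
congr cpair; apply: (addrI (<[pot j, t j k]> + <[pot k, t j k]>)).
have := sum3 (fun l => <[pot l, t j k]>) ujki; rewrite (bigD1 j) //= (bigD1 k) 1?eq_sym //=.
by rewrite addrA.
Qed.

Let sT i j k z w : uniq [:: i; j; k] -> <[sigma i (cpair z w), T j k]> = 0.
Proof.
move=> u0; rewrite (TE u0).
(* In the gauge of i, t_jk is undeformed, and it commutes with everything inserted at i, jk. *)
have -> : cpair (t j k) <[pot i, t j k]> = gauge (pot i) (cpair (t j k) 0).
  by rewrite gauge_pair add0r.
rewrite /sigma -(gauge_morph (pot i)).2 /iota2 cfst_pair csnd_pair cpair_bra.
by rewrite lbrax0 add0r !(iota_bra_t _ u0) cpair0 (lin0 (gauge_morph (pot i)).1).
Qed.

Let XT i j k : uniq [:: i; j; k] -> <[X i, T j k]> = 0.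
Proof. by rewrite XE; apply: sT. Qed.
Let YT i j k : uniq [:: i; j; k] -> <[Y i, T j k]> = 0.
Proof. by rewrite YE0; apply: sT. Qed.

Let pE i : p i = P (t0 i) (el_s x y i) + pot i. Proof. by []. Qed.
Let qE i : q i = P (el_r x y i) (el_s x y i) + pot i. Proof. by []. Qed.

Let cpairI (z w z' w' : t13_hat) : cpair z w = cpair z' w' :> compl gd3 -> w = w'.
Proof. by move=> /(congr1 (@csnd _ _)); rewrite !csnd_pair. Qed.

Lemma ell_eq_sum s i j k : uniq [:: i; j; k] ->
  \sum_(l <- [:: i; j; k]) (iota l (u s) + <[pot l, x13 s l]>) = 0.
Proof.
move=> u0; rewrite !big_cons big_nil addr0 addrA.
have hX := dual_Xsum psiP xyE potentialP pE qE dE u0.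
have hY := dual_Ysum psiP xyE potentialP pE qE dl dE YE TE XT u0.
rewrite !cpairD -cpair0 in hX; rewrite !cpairD -cpair0 in hY.
by case: s; [apply: cpairI hX|apply: cpairI hY].
Qed.

Lemma ell_eq_comm s i j : i != j ->
  <[x13 s i, iota j (u s) + <[pot j, x13 s j]>]>
  + <[iota i (u s) + <[pot i, x13 s i]>, x13 s j]> = 0.
Proof.
move=> ij; have hX := dual_XX psiP xyE potentialP pE qE dE i j.
have hY := dual_YY psiP xyE potentialP pE qE dl dE YE TE XT YT ij.
rewrite cpair_bra -cpair0 in hX; rewrite cpair_bra -cpair0 in hY.
by case: s; [apply: cpairI hX|apply: cpairI hY].
Qed.

Lemma ell_eq_mixed i j k : uniq [:: i; j; k] ->
  <[x i, iota j (u false) + <[pot j, y j]>]> + <[iota i (u true) + <[pot i, x i]>, y j]>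
  = <[pot k, <[x i, y j]>]>.
Proof.
move=> u0; have [uikj ujik ujki ukij ukji] := uniq3_perm u0; have /uniq3P[ij ik jk] := u0.
have h := dual_XY psiP xyE potentialP pE qE dl dE YE TE XT ij.
by rewrite (TE ukij) cpair_bra in h; apply: cpairI h.
Qed.

End EllEquations.

(** * Derivations of completed enveloping algebras *)

Section CauchyDerivation.
Variables (V : zmodType) (op : V -> V -> V) (D : nat -> V -> V).
Hypothesis opl : forall y, {morph op^~ y : u v / u + v}.
Hypothesis opr : forall x, {morph op x : u v / u + v}.
Hypothesis DD : forall k, {morph D k : u v / u + v}.
Hypothesis Dop : forall k x y, D k (op x y) = op (D k x) y + op x (D k y).

(** The total of a family of derivations, [D k] being the part that raises degrees by k; the
    derivation rule survives summation over the degrees. *)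
Definition dsum (f : nat -> V) (d : nat) : V := \sum_(k < d.+1) D k (f (d - k)%N).

Let morph_sum (h : V -> V) (hD : {morph h : u v / u + v}) I (r : seq I) (F : I -> V) :
  h (\sum_(i <- r) F i) = \sum_(i <- r) h (F i).
Proof.
have h0 : h 0 = 0 by apply: (addrI (h 0)); rewrite -hD !addr0.
by elim/big_rec2: _ => // i u v _ <-; rewrite hD.
Qed.

Lemma csum3_swap (T : nat -> nat -> nat -> V) d : csum3 T d = csum3 (fun i j k => T j i k) d.
Proof.
rewrite /csum3 exchange_big; apply: eq_bigr => i _; apply: eq_bigr => j _.
by apply: eq_bigr => k _; rewrite [(j + i)%N]addnC.
Qed.

Lemma dsum_cauchy f h d :
  dsum (cauchy op f h) d = cauchy op (dsum f) h d + cauchy op f (dsum h) d.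
Proof.
pose T1 k i j := op (D k (f i)) (h j); pose T2 k i j := op (f i) (D k (h j)).
have -> : cauchy op (dsum f) h d = csum3 T1 d.
  rewrite csum3C csum3E cauchy_rev; apply: eq_bigr => j _.
  by rewrite (morph_sum (opl _)).
have -> : cauchy op f (dsum h) d = csum3 T2 d.
  rewrite csum3_swap csum3E; apply: eq_bigr => i _.
  by rewrite (morph_sum (opr _)).
rewrite csum3D csum3E; apply: eq_bigr => k _.
by rewrite (morph_sum (@DD k)); apply: eq_bigr => i _; rewrite Dop.
Qed.

End CauchyDerivation.

Section HomogDerivation.
Variables (G : Type) (R : lterm G -> lterm G -> Prop) (dg : G -> nat).

Lemma homog_der (D : presLie R -> presLie R) k : is_derivation D ->
  (forall x, pres_grading R dg (dg x + k)%N (D (lgen R x))) ->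
  forall d x, pres_grading R dg d x -> pres_grading R dg (d + k)%N (D x).
Proof.
move=> [DL DB] Dg d x; elim=> {d x} [x|d|d x y _ IHx _ IHy|d a x _ IH|m n x y hx IHx hy IHy].
- exact: Dg.
- by rewrite (lin0 DL); apply: gpart0.
- by rewrite (linD DL); apply: gpartD.
- by rewrite (linZ DL); apply: gpartZ.
rewrite DB; apply: gpartD; first by rewrite addnAC; apply: gpart_bra.
by rewrite -addnA; apply: gpart_bra.
Qed.

Lemma homog_deg0 (dgpos : forall x, (0 < dg x)%N) d x :
  pres_grading R dg d x -> d = 0%N -> x = 0.
Proof.
elim=> {d x} [x d0|//|d x y _ IHx _ IHy d0|d a x _ IH d0|m n x y _ IHx _ IHy d0].
- by have := dgpos x; rewrite d0.
- by rewrite IHx // IHy // addr0.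
- by rewrite IH // scaler0.
- by rewrite IHx ?lbra0x //; lia.
Qed.

End HomogDerivation.

Section UDerivation.
Variable L : lieType.

Lemma aclassD (s t : aterm L) : aclass (AAdd s t) = aclass s + aclass t.
Proof. by rewrite -aaddE. Qed.
Lemma aclassZ a (s : aterm L) : aclass (AScale a s) = a *: aclass s.
Proof. by rewrite -ascaleE. Qed.
Lemma aclassM (s t : aterm L) : aclass (AMul s t) = aclass s * aclass t.
Proof. by rewrite -amulE. Qed.

Section Der.
Variables (D : L -> L) (DP : is_derivation D).

Fixpoint aderiv (t : aterm L) : Uenv L :=
  match t with
  | AGen x => uin (D x)
  | AZero => 0
  | AOne => 0
  | AAdd s t => aderiv s + aderiv t
  | AScale a s => a *: aderiv s
  | AMul s t => aderiv s * aclass t + aclass s * aderiv t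
  end.

Lemma aderiv_cong s t : acong s t -> aderiv s = aderiv t.
Proof.
have [DL DB] := DP; have uL := @uin_linear L.
elim=> //=.
- by move=> a x y; rewrite DL uL.
- move=> x y; rewrite DB (linD uL) !uin_bra -![aclass (AGen _)]/(uin _) scaleN1r.
  by zmod.
- by move=> ? ? ? _ -> _ ->.
- by move=> ? ? ? ? _ -> _ ->.
- by move=> ? ? ? _ ->.
- by move=> ? ? ? ? /aclassP -> -> /aclassP -> ->.
- by move=> *; rewrite addrA.
- by move=> *; rewrite addrC.
- by move=> *; rewrite add0r.
- by move=> *; rewrite scaleN1r addNr.
- by move=> *; rewrite scalerA.
- by move=> *; rewrite scale1r.
- by move=> *; rewrite scalerDr.
- by move=> *; rewrite scalerDl.
- by move=> *; rewrite !aclassM mulrDl mulrDr !mulrA addrA.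
- by move=> *; rewrite mul0r add0r [aclass AOne * _]mul1r.
- by move=> *; rewrite mulr0 addr0 [_ * aclass AOne]mulr1.
- by move=> *; rewrite !aclassD !mulrDl; zmod.
- by move=> *; rewrite !aclassD !mulrDr; zmod.
- by move=> *; rewrite !aclassZ scalerDr !scalerAl.
- by move=> *; rewrite !aclassZ scalerDr !scalerAr.
Qed.

Definition uext (u : Uenv L) : Uenv L := aderiv (repr u).

Lemma uextE s : uext (aclass s) = aderiv s.
Proof. by apply: aderiv_cong; apply: acong_repr. Qed.

Lemma uext_der : is_alg_derivation uext.
Proof.
split=> [a|]; elim/aclassW=> s; elim/aclassW=> t.
  by rewrite -aclassZ -aclassD !uextE.
by rewrite -aclassM !uextE.
Qed.

Lemma uext_uin x : uext (uin x) = uin (D x).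
Proof. by rewrite /uin uextE. Qed.

Lemma uext_homog (g : lieGrading L) k : (forall d x, g d x -> g (d + k)%N (D x)) ->
  forall d u, uhomog g d u -> uhomog g (d + k)%N (uext u).
Proof.
have [eL eM] := uext_der; move=> Dg d u; elim=> {d u}
  [d x gx||d|d u v _ IHu _ IHv|d a u _ IH|m n u v hu IHu hv IHv].
- by rewrite uext_uin; apply/uhomog_in/Dg.
- have -> : uext 1 = 0 by rewrite -[1]/(aclass AOne) uextE.
  exact: uhomog0.
- by rewrite (lin0 eL); apply: uhomog0.
- by rewrite (linD eL); apply: uhomogD.
- by rewrite (linZ eL); apply: uhomogZ.
rewrite eM; apply: uhomogD; first by rewrite addnAC; apply: uhomogM.
by rewrite -addnA; apply: uhomogM.
Qed.

End Der.

(* L acts on L + rat, the element (0, 1) playing the part of - D; this is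
   faithful when D is injective. *)
Section Faithful.
Variables (D : L -> L) (DP : is_derivation D).
Local Notation M := (L * rat^o)%type.

Definition adj_act (x : L) (m : M) : M := (<[x, m.1]> - (m.2 : rat) *: D x, 0).

Fixpoint aact (t : aterm L) : M -> M :=
  match t with
  | AGen x => adj_act x
  | AZero => fun=> 0
  | AOne => id
  | AAdd s t => fun m => aact s m + aact t m
  | AScale a s => fun m => a *: aact s m
  | AMul s t => fun m => aact s (aact t m)
  end.

Lemma aact_linear t : linear (aact t).
Proof.
elim: t => [x||| s IHs t IHt|a s IH|s IHs t IHt] b m n //=.
- congr pair; rewrite /= ?scaler0 ?addr0 //.
  by rewrite lbraDr lbraZr scalerDl -scalerA; zmod.
- by rewrite scaler0 addr0.
- by rewrite IHs IHt scalerDr addrACA.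
- by rewrite IH scalerDr !scalerA mulrC.
- by rewrite IHt IHs.
Qed.

Lemma aact_cong s t : acong s t -> aact s =1 aact t.
Proof.
have [DL DB] := DP.
elim=> //=.
- move=> a x y [m c]; congr pair; rewrite /= ?scaler0 ?addr0 //.
  by rewrite DL lbraDl lbraZl scalerDr !scalerA [c * a]mulrC -scalerA; zmod.
- move=> x y [m c]; congr pair; rewrite /= ?scaler0 ?addr0 //.
  rewrite DB !scale0r !subr0 !lbraBr !lbraZr scaleN1r [<[x, <[y, m]>]>]lbra_leibniz.
  by rewrite [<[D x, y]>]lbraC; zmod.
- by move=> ? ? _ IH m; rewrite IH.
- by move=> ? ? ? _ IH1 _ IH2 m; rewrite IH1.
- by move=> ? ? ? ? _ IH1 _ IH2 m; rewrite IH1 IH2.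
- by move=> ? ? ? _ IH m; rewrite IH.
- by move=> ? ? ? ? _ IH1 _ IH2 m; rewrite IH2 IH1.
- by move=> ? ? ? m; rewrite addrA.
- by move=> ? ? m; rewrite addrC.
- by move=> ? m; rewrite add0r.
- by move=> ? m; rewrite scaleN1r addNr.
- by move=> ? ? ? m; rewrite scalerA.
- by move=> ? m; rewrite scale1r.
- by move=> ? ? ? m; rewrite scalerDr.
- by move=> ? ? ? m; rewrite scalerDl.
- by move=> r ? ? m; rewrite (linD (aact_linear r)).
- by move=> ? r ? m; rewrite (linZ (aact_linear r)).
Qed.

Lemma uin_inj_der x y : uin x = uin y -> D x = D y.
Proof.
move=> /aclassP/aact_cong/(_ (0, 1)) /(congr1 fst) /=.
by rewrite !lbrax0 !scale1r !sub0r => /oppr_inj.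
Qed.

End Faithful.
End UDerivation.

(** This takes the place of the Poincaré-Birkhoff-Witt theorem: the degree derivation multiplies by
    d, so the faithful action built from it separates elements of positive degree. *)
Lemma uin_homog_inj (G : Type) (R : lterm G -> lterm G -> Prop) (dg : G -> nat)
    (RP : forall u v, R u v ->
      lderiv (@lgen G R) (fun g => (dg g)%:R *: lgen R g) u =
      lderiv (@lgen G R) (fun g => (dg g)%:R *: lgen R g) v)
    (dgpos : forall x, (0 < dg x)%N) d x :
  pres_grading R dg d x -> uin x = 0 -> x = 0.
Proof.
move=> gx ux; have [d0|dN] := eqVneq d 0%N; first exact: (homog_deg0 dgpos gx d0).
have u0 : uin (0 : presLie R) = 0 by apply: (lin0 (@uin_linear _)).
have [DP _] := derP RP; rewrite -u0 in ux.
have D0 : degop dg (0 : presLie R) = 0 by apply: (lin0 DP.1).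
have := uin_inj_der DP ux; rewrite -/(degop dg) (degopE RP gx) D0.
by move/eqP; rewrite scaler_eq0 pnatr_eq0 (negbTE dN) => /eqP.
Qed.

Lemma alg_fbil (A : algType rat) (g : algGrading A) : fbil (@GRing.mul (compl g)).
Proof.
split=> [y a f h|x a f h|m n f h lf lh d dmn].
- by rewrite mulrDl scalerAl.
- by rewrite mulrDr scalerAr.
rewrite [LHS]/= /cauchy big1 // => i _; have [im|mi] := ltnP i m.
  by rewrite lf // mul0r.
by rewrite lh ?mulr0 //; have := ltn_ord i; lia.
Qed.

Section CContinuous.
Variables (V W : lmodType rat) (g : grading V) (h : grading W) (D : compl g -> compl h).
Hypotheses (DL : linear D) (DC : ccontinuous D).

Lemma ccont_eq z w : (forall n m, exists2 z', low m (z - z') & low n (D z' - w)) -> D z = w.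
Proof.
move=> h0; apply: low_eq => n; have [m Dm] := DC n; have [z' zz' wz'] := h0 n m.
rewrite -(subrKA (D z')) -(linB DL); apply: lowD => //; exact: Dm.
Qed.

Lemma ccont_csum0 f : summable f -> (forall n, D (f n) = 0) -> D (csum f) = 0.
Proof.
move=> sf f0; apply: ccont_eq => n m; exists (\sum_(i < m) f i); first exact: csum_trunc.
by rewrite (lin_sum DL) big1 ?subrr //; apply: low_zero.
Qed.

End CContinuous.

Lemma fmap_ccont (V W : lmodType rat) (g : grading V) (h : grading W)
  (D : compl g -> compl h) : fmap 0 D -> ccontinuous D.
Proof. by case=> _ DF n; exists n => f lf; have := DF n f lf; rewrite addn0; apply. Qed.

Section UhatFacts.
Variables (L : lieType) (g : lieGrading L).
Local Notation UU := (Uhat g).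
Implicit Types (z w : compl g) (u v : UU).

Lemma uin0 : uin (0 : L) = 0. Proof. exact: (lin0 (@uin_linear L)). Qed.

Lemma uhat_in_linear : linear (@uhat_in L g).
Proof. by move=> a z w; apply: compl_ext => d; apply: uin_linear. Qed.

Lemma uhat_in_fmap : fmap 0 (@uhat_in L g).
Proof.
split=> [|n z lz d dn]; first exact: uhat_in_linear.
by rewrite /= lz ?uin0 // -[n]addn0.
Qed.

Lemma uhat_in_bra z w : uhat_in <[z, w]> = uhat_in z * uhat_in w - uhat_in w * uhat_in z.
Proof.
apply: compl_ext => d; rewrite complD complN /= [X in _ - X]cauchy_rev /cauchy.
rewrite (lin_sum (@uin_linear L)) -sumrN -big_split; apply: eq_bigr => i _.
exact: uin_bra.
Qed.

Variables (x : L) (gx : g 1%N x).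
Local Notation xc := (csingle gx).
Local Notation X := (uhat_in xc).
Local Notation ex := (uexp gx).

Lemma uX_low : low 1 X.
Proof. by have := uhat_in_fmap.2 _ _ (low_csingle gx (leqnn 1)); rewrite addn0. Qed.

Lemma uX_fmap : fmap 1 ( *%R X : UU -> UU).
Proof. exact: (fbil_r (alg_fbil (Ugrading g)) uX_low). Qed.

Lemma uhat_in_mul_fbil : fbil (fun (z : compl g) u => uhat_in z * u).
Proof.
have [h1 h2 h3] := alg_fbil (Ugrading g); split=> [u|z|m n z u lz lu].
- by move=> a z w; rewrite uhat_in_linear h1.
- exact: h2.
by apply: h3 => //; have := uhat_in_fmap.2 _ _ lz; rewrite addn0.
Qed.

Lemma uX_leibniz z u : X * (uhat_in z * u) = uhat_in <[xc, z]> * u + uhat_in z * (X * u).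
Proof. by rewrite uhat_in_bra mulrBl !mulrA subrK. Qed.

Lemma iter_uX n d : iter n ( *%R X) 1 d = if d == n then uin x ^+ n else 0.
Proof.
elim: n d => [|n IH] d; first by rewrite /=.
rewrite iterS /= /cauchy; case: d => [|d].
  by rewrite big_ord1 /= uin0 mul0r.
rewrite !big_ord_recl big1 /= ?uin0 ?mul0r ?add0r ?addr0.
  by rewrite subSS subn0 IH eqSS; case: eqP => _; rewrite ?mulr0 ?exprS.
by move=> i _; rewrite mul0r.
Qed.

Lemma uexpE : ex = ps ( *%R X) nexp 1.
Proof.
have E d i : (nexp i *: iter i ( *%R X) 1) d = if d == i then nexp i *: uin x ^+ i else 0.
  by rewrite complZ iter_uX; case: ifP; rewrite ?scaler0.
apply: compl_ext => d; rewrite csumE; under eq_bigr => i _ do rewrite E.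
by rewrite big_ord_recr /= eqxx big1 ?add0r // => i _; rewrite gtn_eqF.
Qed.

Lemma uexp_mul u : ps ( *%R X) nexp u = ex * u.
Proof.
rewrite uexpE -[in LHS](mul1r u).
rewrite -(ps_comm (a := *%R X) (b := *%R^~ u) _ _ uX_fmap (fbil_l (alg_fbil (Ugrading g)) (low0z u))) //.
by move=> v; rewrite mulrA.
Qed.

Lemma uexp_conj z : ex * uhat_in z = uhat_in (ps (lbra xc) nexp z) * ex.
Proof.
rewrite -uexp_mul -[uhat_in z]mulr1.
rewrite (exp_bil uhat_in_mul_fbil (ad_fmap (low_csingle gx (leqnn 1))) uX_fmap uX_fmap uX_leibniz).
by rewrite -uexpE.
Qed.

Lemma uexp_rinv : exists v, ex * v = 1.
Proof.
exists (ps (fun u => - (X * u)) nexp 1); rewrite -uexp_mul.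
exact: exp_inv uX_fmap 1.
Qed.

Lemma uexp_rI u v : u * ex = v * ex -> u = v.
Proof. by have [w ew] := uexp_rinv => /(congr1 ( *%R^~ w)); rewrite -!mulrA ew !mulr1. Qed.

(** The derivative of the exponential in the enveloping algebra. Of E only continuity is given, so
    the value is approached by finite sums. *)
Lemma cder_uexp (D : compl g -> compl g) E :
  extends_to_Uhat D E -> E ex = uhat_in (ps (lbra xc) nhh (D xc)) * ex.
Proof.
move=> [[EL EM] EC EX].
have E1 : E 1 = 0.
  by have := EM 1 1; rewrite !mulr1 !mul1r => /eqP; rewrite -subr_eq0 opprD addrA subrr sub0r oppr_eq0 => /eqP.
pose S n := \sum_(i < n) iter i ( *%R X) (uhat_in (D xc) * iter (n.-1 - i) ( *%R X) 1).
have ES n : E (iter n ( *%R X) 1) = S n.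
  elim: n => [|n IH]; first by rewrite /S big_ord0.
  rewrite iterS EM EX IH /S big_ord_recl /= subn0; congr (_ + _).
  rewrite mulr_sumr; apply: eq_bigr => i _ /=.
  by have -> : (n.-1 - i = n - bump 0 i)%N by rewrite /bump; lia.
have aF := ad_fmap (low_csingle gx (leqnn 1)).
rewrite uexpE -(hh_bil uhat_in_mul_fbil aF uX_fmap uX_fmap uX_leibniz).
apply: (ccont_eq EL EC) => n m.
pose M := maxn m n.
(* One term more than M: the constant term of the exponential is killed by E, and M terms of the
   series for (e^u - 1) / u remain. *)
exists (\sum_(k < M.+1) nexp k *: iter k ( *%R X) 1).
  apply: (low_le (csum_trunc (N := M.+1) (ps_summable uX_fmap nexp 1))).
  by rewrite ltnW // ltnS leq_maxl.
rewrite (lin_sum EL) big_ord_recl (linZ EL) E1 scaler0 add0r -opprB; apply: lowN.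
have sS : summable (fun k => nhh k *: S k.+1).
  move=> k; apply/lowZ/low_sum => i _.
  have [_ _ bl] := uhat_in_mul_fbil.
  have := iter_low uX_fmap (k := i) (bl _ _ _ _ (low0z (D xc)) (iter_low uX_fmap (k := k - i) (low0z 1))).
  by move/low_le; apply; have := ltn_ord i; lia.
have -> : \sum_(i < M) E (nexp (lift ord0 i) *: iter (lift ord0 i) ( *%R X) 1) =
          \sum_(i < M) nhh i *: S i.+1.
  by apply: eq_bigr => i _; rewrite (linZ EL) ES.
by apply: (low_le (csum_trunc (N := M) sS)); rewrite leq_maxr.
Qed.

End UhatFacts.

Section DegreeSum.
Variables (V : lmodType rat) (g : grading V) (D : nat -> V -> V).
Hypothesis DL : forall k, linear (D k).
Hypothesis Dg : forall k d x, g d x -> g (d + k)%N (D k x).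

Fact dsum_subproof (z : compl g) d : g d (dsum D z d).
Proof.
apply: gpart_sum => k; have := Dg k (complP z (d - k)).
by rewrite subnK // -ltnS.
Qed.
Definition dsum_map (z : compl g) : compl g := mkcompl (dsum_subproof z).

Lemma dsum_fmap : fmap 0 dsum_map.
Proof.
split=> [a z w|n z lz d dn].
  apply: compl_ext => d; rewrite complD complZ /= /dsum scaler_sumr -big_split.
  by apply: eq_bigr => k _; rewrite DL.
rewrite [LHS]/= /dsum big1 // => k _; rewrite lz ?(lin0 (DL k)) //.
by rewrite addn0 in dn; apply: leq_ltn_trans dn; apply: leq_subr.
Qed.

End DegreeSum.

Lemma dsum_map_lie (L : lieType) (g : lieGrading L) (D : nat -> L -> L)
    (DP : forall k, is_derivation (D k))
    (Dg : forall k d x, g d x -> g (d + k)%N (D k x)) :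
  is_derivation (dsum_map Dg).
Proof.
split=> [|z w]; first exact: (dsum_fmap (fun k => (DP k).1) Dg).1.
apply: compl_ext => d; rewrite complD.
apply: (dsum_cauchy (D := D)) => [y x x'|x y y'|k x y|k x y].
- exact: lbraDl.
- exact: lbraDr.
- exact: (linD (DP k).1).
- exact: (DP k).2.
Qed.

Lemma dsum_map_alg (A : algType rat) (g : algGrading A) (D : nat -> A -> A)
    (DP : forall k, is_alg_derivation (D k))
    (Dg : forall k d x, g d x -> g (d + k)%N (D k x)) :
  is_alg_derivation (dsum_map Dg).
Proof.
split=> [|z w]; first exact: (dsum_fmap (fun k => (DP k).1) Dg).1.
apply: compl_ext => d; rewrite complD.
apply: (dsum_cauchy (D := D)) => [y x x'|x y y'|k x y|k x y].
- exact: mulrDl.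
- exact: mulrDr.
- exact: (linD (DP k).1).
- exact: (DP k).2.
Qed.

Section DsumU.
Variables (L : lieType) (g : lieGrading L) (D : nat -> L -> L).
Variable DP : forall k, is_derivation (D k).
Variable Dg : forall k d x, g d x -> g (d + k)%N (D k x).

Let Ug k d u : Ugrading g d u -> Ugrading g (d + k)%N (uext (D k) u).
Proof. exact: (uext_homog (DP k) (Dg k)). Qed.

Lemma dsum_extends : exists E, extends_to_Uhat (dsum_map Dg) E.
Proof.
exists (dsum_map Ug); split.
- exact: (dsum_map_alg (fun k => uext_der (DP k))).
- exact/fmap_ccont/(dsum_fmap (fun k => (uext_der (DP k)).1)).
move=> z; apply: compl_ext => d; rewrite /= /dsum (lin_sum (@uin_linear L)).
by apply: eq_bigr => k _; rewrite (uext_uin (DP k)).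
Qed.

Lemma dsum_cder : is_cderivation (dsum_map Dg).
Proof.
split; first exact: dsum_map_lie.
exact/fmap_ccont/(dsum_fmap (fun k => (DP k).1)).
Qed.

End DsumU.

(** * Continuous derivations of the completion of t_{1,2} *)

Section Dhat.
Local Notation xh := (x_hat true 1).
Local Notation yh := (x_hat false 1).
Implicit Types (al : bool -> t12_hat).

Lemma t12_hat0 (z : t12_hat) : z 0%N = 0.
Proof. exact: (homog_deg0 (dg := fun=> 1%N) _ (complP z 0)). Qed.
Lemma t12_hat_low (z : t12_hat) : low 1 z.
Proof. by case=> [|//] _; apply: t12_hat0. Qed.

Lemma I2P (b : 'I_2) : b = ord0 \/ b = ord_max.
Proof. by case: b => [[|[|//]] ?]; [left|right]; apply: val_inj. Qed.

(** The part raising degrees by k; as x_1 and y_1 have degree 1, it takes the components of degree k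
    + 1 of their images. *)
Definition dpart al k : t12 -> t12 := t12_D (fun s => al s k.+1).

Lemma dpart_der al k : is_derivation (dpart al k).
Proof. by case: (t12_DP (fun s => al s k.+1)). Qed.
Lemma dpart_x al k s : dpart al k (x_ s ord0) = al s k.+1.
Proof. by rewrite /dpart; have [_ ->] := t12_DP (fun s => al s k.+1). Qed.

Lemma dpart_homog al k d x : t1_grading 2 d x -> t1_grading 2 (d + k)%N (dpart al k x).
Proof.
apply: (homog_der (dpart_der al k)) => -[s b]; rewrite add1n.
have [->|->] := I2P b; first by rewrite [dpart _ _ _]dpart_x; apply: complP.
rewrite -[lgen _ _]/(x_ s ord_max) t12_x2 (linN (dpart_der al k).1) dpart_x -scaleN1r.
by apply: (@gpartZ _ (t1_grading 2)); apply: complP.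
Qed.

Definition Dhat al : t12_hat -> t12_hat := dsum_map (dpart_homog al).

Lemma Dhat_cder al : is_cderivation (Dhat al).
Proof. exact: (dsum_cder (dpart_der al) (dpart_homog al)). Qed.
Lemma Dhat_der al : is_derivation (Dhat al). Proof. by case: (Dhat_cder al). Qed.
Lemma Dhat_fmap al : fmap 0 (Dhat al).
Proof. exact: (dsum_fmap (fun k => (dpart_der al k).1)). Qed.
Lemma Dhat_x al s : Dhat al (x_hat s 1) = al s.
Proof.
apply: compl_ext => -[|d]; first by rewrite !t12_hat0.
rewrite /= /dsum !big_ord_recr /= subSnn subnn /= strand11 dpart_x.
rewrite (lin0 (dpart_der al _).1) addr0 big1 ?add0r // => i _.
rewrite ifF ?(lin0 (dpart_der al _).1) //.
by have := ltn_ord i; lia.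
Qed.

Lemma strand2P (b : 'I_2) s : exists c : rat, csingle (x_homog s b) = c *: x_hat s 1.
Proof.
have [->|->] := I2P b; [exists 1|exists (-1)]; rewrite ?scale1r ?scaleN1r -?x_hat2;
  by apply: csingle_eq; rewrite // (strand11, strand12).
Qed.

(** Homogeneous elements come from the generators by finitely many operations, and continuity passes
    to the sum of the components of z. *)
Lemma cder_eq0_xy (D : t12_hat -> t12_hat) : is_cderivation D ->
  (forall s, D (x_hat s 1) = 0) -> forall z, D z = 0.
Proof.
move=> [[DL DB] DC] Dx.
have Dg d z : t1_grading 2 d z -> forall gz : t1_grading 2 d z, D (csingle gz) = 0.
  elim=> {d z} [[s b]|d|d x y hx IHx hy IHy|d a x hx IH|m n x y hx IHx hy IHy] gz.
  - have [c cE] := strand2P b s.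
    have -> : csingle gz = csingle (x_homog s b) by apply: csingle_eq.
    by rewrite cE (linZ DL) Dx scaler0.
  - by rewrite csingle_eq0 // (lin0 DL).
  - have -> : csingle gz = csingle (hx : t1_grading 2 d x) + csingle (hy : t1_grading 2 d y).
      by apply: compl_ext => e; rewrite complD /=; case: eqP; rewrite ?addr0.
    by rewrite (linD DL) IHx IHy addr0.
  - have -> : csingle gz = a *: csingle (hx : t1_grading 2 d x).
      by apply: compl_ext => e; rewrite complZ /=; case: eqP; rewrite ?scaler0.
    by rewrite (linZ DL) IH scaler0.
  have -> : csingle gz = <[csingle (hx : t1_grading 2 m x), csingle (hy : t1_grading 2 n y)]>.
    by rewrite csingle_bra; apply: csingle_eq.
  by rewrite DB IHx IHy lbra0x lbrax0 addr0.
move=> z; rewrite (csum_csingle z) (ccont_csum0 DL DC) // => n; first exact: low_csingle.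
exact: Dg (complP z n) _.
Qed.

Lemma cder_eq0 (D : t12_hat -> t12_hat) : is_cderivation D ->
  D xh = 0 -> D (t0_hat 1) = 0 -> forall z, D z = 0.
Proof.
move=> DP Dx Dt; have [[DL DB] DC] := DP.
have lx := x_hat_low true 1; have aF := ad_fmap lx.
have Dy : D yh = 0.
  (* Inverting the defining series expresses y_1 by x_1 and t_01. *)
  have -> : yh = - ps (lbra xh) nhh (t0_hat 1).
    by rewrite t0_hatE /T0 (linN (ps_fmap aF _).1) ps_hh_bern // opprK.
  rewrite (linN DL) (ccont_csum0 DL DC (ps_summable aF _ _)) ?oppr0 // => n.
  rewrite (linZ DL); have -> : D (iter n (lbra xh) (t0_hat 1)) = 0.
    by elim: n => //= n IH; rewrite DB Dx IH lbra0x lbrax0 addr0.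
  by rewrite scaler0.
by apply: cder_eq0_xy => // -[].
Qed.

Lemma cder_sub (D D' : t12_hat -> t12_hat) a :
  is_cderivation D -> is_cderivation D' -> is_cderivation (fun z => a *: D z + D' z).
Proof.
move=> [[DL DB] DC] [[DL' DB'] DC']; split.
  split=> [b u v|u v]; first by rewrite DL DL' !scalerDr !scalerA mulrC; zmod.
  by rewrite DB DB' lbraDl lbraDr lbraZl lbraZr; zmod.
move=> n; have [m hm] := DC n; have [m' hm'] := DC' n.
exists (maxn m m') => f lf; apply: lowD; first apply: lowZ; [apply: hm|apply: hm'] => d dm; apply: lf.
  by rewrite leq_max dm.
by rewrite leq_max dm orbT.
Qed.

Lemma cder_ext (D D' : t12_hat -> t12_hat) : is_cderivation D -> is_cderivation D' ->
  D xh = D' xh -> D (t0_hat 1) = D' (t0_hat 1) -> D =1 D'.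
Proof.
move=> DP DP' ex et z; apply/eqP; rewrite eq_sym -subr_eq0 addrC -scaleN1r; apply/eqP.
by apply: (cder_eq0 (cder_sub (-1) DP DP')); rewrite ?ex ?et scaleN1r addNr.
Qed.

End Dhat.

(** * The derivation D_psi *)

Section Dpsi.
Local Notation xh := (x_hat true 1).
Local Notation yh := (x_hat false 1).
Local Notation t0 := (t0_hat 1).
Local Notation gd := (dual_grading (t1_grading 2)).
Implicit Types (psi : f2) (D : t12_hat -> t12_hat).

Lemma uhat_in_inj (z w : t12_hat) : uhat_in z = uhat_in w -> z = w.
Proof.
move=> e; apply/eqP; rewrite -subr_eq0; apply/eqP; apply: compl_ext => d.
apply: (uin_homog_inj (dg := fun=> 1%N)) (complP (z - w) d) _ => //.
  by apply: t12_relP => s; rewrite /= -[lgen _ _]/(x_ _ _) t12_x2 scalerN.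
have /(congr1 (fun f : Uhat (t1_grading 2) => f d)) : uhat_in (z - w) = 0.
  by rewrite (linB (@uhat_in_linear _ _)) e subrr.
by [].
Qed.

(** The value on x_1 forced by the one on e^{x_1}: the inverse of (e^{ad x_1} - 1) / ad x_1 is
    applied. *)
Definition u_plus psi : t12_hat :=
  ps (lbra xh) bern (psi021 psi - ps (lbra xh) nexp (psi012 psi)).
(* y_1 + eps u_-, obtained from t_01 + eps [psi^{0,1,2}, t_01] by inverting T0. *)
Definition u_Y psi : compl gd :=
  - ps (lbra (cpair xh (u_plus psi))) nhh (cpair t0 <[psi012 psi, t0]>).
Definition u_psi psi (s : bool) : t12_hat := if s then u_plus psi else csnd (u_Y psi).
Definition D_psi psi := Dhat (u_psi psi).

Let aF := ad_fmap (x_hat_low true 1).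

Lemma u_plusE psi :
  ps (lbra xh) nhh (u_plus psi) = psi021 psi - ps (lbra xh) nexp (psi012 psi).
Proof. exact: ps_hh_bern. Qed.

Lemma u_YE psi : u_Y psi = cpair yh (u_psi psi false).
Proof.
rewrite [LHS]cpair_eta; congr cpair.
rewrite (linN (cfst_fmap _).1) cfst_ps ?cfst_pair; try exact: t12_hat_low.
by rewrite t0_hatE /T0 (linN (ps_fmap aF _).1) ps_hh_bern // opprK.
Qed.

Lemma u_minusE psi : T0 (cpair xh (u_psi psi true) : compl gd) (cpair yh (u_psi psi false)) =
  cpair t0 <[psi012 psi, t0]>.
Proof.
have lX : low 1 (cpair xh (u_plus psi) : compl gd) by apply: cpair_low; apply: t12_hat_low.
by rewrite -u_YE /T0 (linN (ps_fmap (ad_fmap lX) _).1) opprK ps_bern_hh //; apply: ad_fmap.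
Qed.

Lemma der_dual_morph D : is_derivation D ->
  lie_morphism (fun z => cpair z (D z) : compl gd).
Proof.
move=> [DL DB]; split=> [a z w|z w]; first by rewrite DL cpairZ cpairD.
by rewrite DB cpair_bra addrC.
Qed.

(** The morphism z |-> z + eps D z commutes with [T0], so the equation that defines u_- gives the
    value on t_01. *)
Lemma D_psi_t0 psi : D_psi psi t0 = <[psi012 psi, t0]>.
Proof.
have sM := der_dual_morph (Dhat_der (u_psi psi)).
have sF : fmap 0 (fun z => cpair z (D_psi psi z) : compl gd).
  split=> [|n z lz]; first exact: sM.1.
  apply: cpair_low; last exact: (Dhat_fmap _).2.
  by rewrite addn0.
have := T0_morph yh sM sF (x_hat_low true 1).
rewrite -t0_hatE !Dhat_x u_minusE => /(congr1 (@csnd _ _)).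
by rewrite !csnd_pair.
Qed.

Lemma D_psiP psi : is_Dpsi psi (D_psi psi).
Proof.
split; [exact: Dhat_cder| |exact: D_psi_t0].
have [E EP] := dsum_extends (dpart_der (u_psi psi)) (dpart_homog (u_psi psi)).
exists E => //; rewrite (cder_uexp _ EP) -[dsum_map _]/(Dhat _) Dhat_x u_plusE.
by rewrite (linB (@uhat_in_linear _ _)) mulrBl -uexp_conj.
Qed.

Lemma is_Dpsi_x psi D : is_Dpsi psi D -> D xh = u_plus psi.
Proof.
move=> [DP [E EP Ee] Dt]; apply: (ps_hh_inj aF); rewrite u_plusE.
apply: uhat_in_inj; apply: (uexp_rI (gx := x_homog true (strand 1 1))).
rewrite -(cder_uexp _ EP) (linB (@uhat_in_linear _ _)) mulrBl -uexp_conj.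
exact: Ee.
Qed.

Lemma is_Dpsi_unique psi D : is_Dpsi psi D -> D = D_psi psi.
Proof.
move=> DP; have [cD _ Dt] := DP; apply: funext; apply: cder_ext => //.
- exact: Dhat_cder.
- by rewrite (is_Dpsi_x DP) [RHS]Dhat_x.
by rewrite Dt D_psi_t0.
Qed.

Lemma alg_der_comb (A : algType rat) (E E' : A -> A) a :
  is_alg_derivation E -> is_alg_derivation E' -> is_alg_derivation (fun z => a *: E z + E' z).
Proof.
move=> [EL EM] [EL' EM']; split=> [b u v|u v].
  by rewrite EL EL' !scalerDr !scalerA mulrC; zmod.
by rewrite EM EM' scalerDr mulrDl mulrDr -scalerAl -scalerAr; zmod.
Qed.

Lemma ccont_comb (V W : lmodType rat) (g : grading V) (h : grading W)
    (E E' : compl g -> compl h) a :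
  ccontinuous E -> ccontinuous E' -> ccontinuous (fun z => a *: E z + E' z).
Proof.
move=> EC EC' n; have [m hm] := EC n; have [m' hm'] := EC' n.
exists (maxn m m') => f lf; apply: lowD; first apply: lowZ; [apply: hm|apply: hm'] => d dm; apply: lf.
  by rewrite leq_max dm.
by rewrite leq_max dm orbT.
Qed.

Lemma ccont_comp (V : lmodType rat) (g : grading V) (E E' : compl g -> compl g) :
  ccontinuous E -> ccontinuous E' -> ccontinuous (fun z => E (E' z)).
Proof.
move=> EC EC' n; have [m hm] := EC n; have [m' hm'] := EC' m.
by exists m' => f lf; apply: hm; apply: hm'.
Qed.

Lemma extends_comb D D' E E' a : extends_to_Uhat (g := t1_grading 2) D E -> extends_to_Uhat D' E' ->
  extends_to_Uhat (g := t1_grading 2) (fun z => a *: D z + D' z) (fun z => a *: E z + E' z).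
Proof.
move=> [EA EC EX] [EA' EC' EX']; split; [exact: alg_der_comb|exact: ccont_comb|].
by move=> z; rewrite EX EX' uhat_in_linear.
Qed.

Lemma extends_comm D D' E E' : extends_to_Uhat (g := t1_grading 2) D E -> extends_to_Uhat D' E' ->
  extends_to_Uhat (g := t1_grading 2) (fun z => D (D' z) - D' (D z)) (fun z => E (E' z) - E' (E z)).
Proof.
move=> [[EL EM] EC EX] [[EL' EM'] EC' EX']; split.
- split=> [b u v|u v]; first by rewrite EL' !EL EL' scalerBr; zmod.
  by rewrite EM' EM (linD EL) !EM (linD EL') !EM' mulrBl mulrBr; zmod.
- move=> n; have [m hm] := ccont_comp EC EC' n; have [m' hm'] := ccont_comp EC' EC n.
  exists (maxn m m') => f lf; apply: lowB; [apply: hm|apply: hm'] => d dm; apply: lf.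
    by rewrite leq_max dm.
  by rewrite leq_max dm orbT.
by move=> z; rewrite EX' EX EX EX' (linB (@uhat_in_linear _ _)).
Qed.

Lemma cder_comm D D' : is_cderivation (g := t1_grading 2) D -> is_cderivation D' ->
  is_cderivation (g := t1_grading 2) (fun z => D (D' z) - D' (D z)).
Proof.
move=> [[EL EM] EC] [[EL' EM'] EC']; split.
  split=> [b u v|u v]; first by rewrite EL' !EL EL' scalerBr; zmod.
  by rewrite EM' EM (linD EL) !EM (linD EL') !EM' lbraBl lbraBr; zmod.
move=> n; have [m hm] := ccont_comp EC EC' n; have [m' hm'] := ccont_comp EC' EC n.
exists (maxn m m') => f lf; apply: lowB; [apply: hm|apply: hm'] => d dm; apply: lf.
  by rewrite leq_max dm.
by rewrite leq_max dm orbT.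
Qed.

Lemma psi012L : linear psi012. Proof. exact: f2_evalL. Qed.
Lemma psi021L : linear psi021. Proof. exact: f2_evalL. Qed.

Lemma D_psi_linear a psi psi' z :
  D_psi (a *: psi + psi') z = a *: D_psi psi z + D_psi psi' z.
Proof.
suff : is_Dpsi (a *: psi + psi') (fun z => a *: D_psi psi z + D_psi psi' z).
  by move=> /is_Dpsi_unique /(congr1 (@^~ z)) /= ->.
have [c1 [E EP Ee] t1] := D_psiP psi; have [c2 [E' EP' Ee'] t2] := D_psiP psi'.
split; first exact: cder_sub.
  exists (fun z => a *: E z + E' z); first exact: extends_comb.
  rewrite Ee Ee' psi012L psi021L !uhat_in_linear mulrDl mulrDr -scalerAl -scalerAr.
  by zmod.
by rewrite t1 t2 psi012L lbraDl lbraZl.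
Qed.

End Dpsi.

(** * Commutators of the derivations D_psi *)

Section Commutators.
Local Notation t0 := (t0_hat 1).
Local Notation t02 := (t0_hat 2).
Local Notation ex := exp_x1.
Implicit Types (psi : f2) (D : t12_hat -> t12_hat).

Let inL := @uhat_in_linear _ (t1_grading 2).

Lemma D_psi_bra psi z w : D_psi psi <[z, w]> = <[D_psi psi z, w]> + <[z, D_psi psi w]>.
Proof. exact: (Dhat_der (u_psi psi)).2. Qed.

(** Since t_02 = - e^{ad x_1} t_01, one has t_02 e^{x_1} = - e^{x_1} t_01 in the enveloping algebra.
    Applying the extended derivation and cancelling e^{x_1} gives the value. *)
Lemma D_psi_t02 psi : D_psi psi t02 = <[psi021 psi, t02]>.
Proof.
have [_ [E [[EL EM] EC EX] Ee] Dt] := D_psiP psi.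
apply: uhat_in_inj; apply: (uexp_rI (gx := x_homog true (strand 1 1))).
rewrite -/ex; have h : uhat_in t02 * ex = - (ex * uhat_in t0).
  by rewrite t0_hat2 (linN inL) mulNr -uexp_conj.
have := congr1 E h; rewrite (linN EL) !EM !EX Dt Ee !uhat_in_bra => h'.
have -> : uhat_in (D_psi psi t02) * ex = - ((uhat_in (psi021 psi) * ex - ex * uhat_in (psi012 psi)) * uhat_in t0 +
      ex * (uhat_in (psi012 psi) * uhat_in t0 - uhat_in t0 * uhat_in (psi012 psi)))
      - uhat_in t02 * (uhat_in (psi021 psi) * ex - ex * uhat_in (psi012 psi)).
  by rewrite -h'; zmod.
rewrite !(mulrBl, mulrBr) !mulrA -(mulrA _ ex) -[uhat_in t02 * ex * _]mulrA.
have -> : ex * uhat_in t0 = - (uhat_in t02 * ex) by rewrite h opprK.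
rewrite !mulrA [uhat_in t02 * ex]h -!(mulrA (uhat_in (psi021 psi))) h !mulrN !mulNr !mulrA.
by zmod.
Qed.

(** As t_01 + t_02 + t_12 = 0, these three satisfy the relations of t_3, and the values on t_01 and
    t_02 cancel by the bracket relation of grt_1. *)
Lemma D_psi_t12 psi : in_grt1 psi -> D_psi psi (t_hat 1 2) = 0.
Proof.
move=> psiP; have DL : linear (D_psi psi) := (Dhat_der (u_psi psi)).1.
have cC : central3 (t_hat 1 2) t0 t02.
  have h := t0_hat_sum; split.
  - have -> : t0 + t02 = - t_hat 1 2 by apply/eqP; rewrite -addr_eq0 h.
    by rewrite lbraNr lbraxx oppr0.
  - have -> : t_hat 1 2 + t02 = - t0.
      by apply/eqP; rewrite -subr_eq0 -h; apply/eqP; zmod.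
    by rewrite lbraNr lbraxx oppr0.
  have -> : t_hat 1 2 + t0 = - t02.
    by apply/eqP; rewrite -subr_eq0 -h; apply/eqP; zmod.
  by rewrite lbraNr lbraxx oppr0.
have cC' : central3 (t_hat 1 2) t02 t0 by case: cC => a b c; split; rewrite // addrC.
have hx := grt1_hex psiP cC; have a1 := grt1_anti psiP cC; have a2 := grt1_anti psiP cC'.
have -> : t_hat 1 2 = - (t0 + t02).
  by apply/eqP; rewrite -subr_eq0 -t0_hat_sum; apply/eqP; zmod.
rewrite (linN DL) (linD DL) D_psi_t0 D_psi_t02.
by rewrite /psi012 /psi021 t_hat21 a1 a2 !lbraNl -!lbraC hx oppr0.
Qed.

(** A derivation acting on a and b as [f2_D psi] acts on A and B acts the same way on every phi(a,
    b); this is where the Ihara bracket comes from. *)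
Lemma der_f2_eval (L : lieType) (D : L -> L) a b psi phi : is_derivation D ->
  D a = <[f2_eval a b psi, a]> -> D b = 0 ->
  D (f2_eval a b phi) = f2_eval a b (f2_D psi phi).
Proof.
move=> [DL DB] Da Db; have [[DfL DfB] fDA fDB] := f2_DP psi.
apply: (lie_der_ext (f := f2_eval a b) (d := fun x => D (f2_eval a b x))
  (e := fun x => f2_eval a b (f2_D psi x))) => [c x y|c x y|x y|x y|].
- by rewrite f2_evalL DL.
- by rewrite DfL f2_evalL.
- by rewrite f2_evalB DB.
- by rewrite DfB (linD (f2_evalL a b)) !f2_evalB.
case; rewrite -/fA -/fB ?f2_evalA ?f2_evalBB.
  by rewrite Da fDA f2_evalB f2_evalA.
by rewrite Db fDB (lin0 (f2_evalL a b)).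
Qed.

Lemma D_psi_012 psi phi : in_grt1 psi ->
  D_psi psi (psi012 phi) = psi012 (f2_D psi phi).
Proof.
move=> psiP; apply: der_f2_eval; [exact: Dhat_der|exact: D_psi_t0|exact: D_psi_t12].
Qed.

Lemma D_psi_021 psi phi : in_grt1 psi ->
  D_psi psi (psi021 phi) = psi021 (f2_D psi phi).
Proof.
move=> psiP; apply: der_f2_eval; [exact: Dhat_der|exact: D_psi_t02|].
by rewrite t_hat21 D_psi_t12.
Qed.

Lemma D_psi_ihara psi psi' z : in_grt1 psi -> in_grt1 psi' ->
  D_psi (ihara psi psi') z = D_psi psi' (D_psi psi z) - D_psi psi (D_psi psi' z).
Proof.
move=> psiP psiP'.
suff : is_Dpsi (ihara psi psi') (fun z => D_psi psi' (D_psi psi z) - D_psi psi (D_psi psi' z)).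
  by move=> /is_Dpsi_unique /(congr1 (@^~ z)) /= ->.
have [c1 [E EP Ee] t1] := D_psiP psi; have [c2 [E' EP' Ee'] t2] := D_psiP psi'.
have [[EL EM] EC EX] := EP; have [[EL' EM'] EC' EX'] := EP'.
have e1 : psi012 (ihara psi psi') = <[psi012 psi, psi012 psi']>
    + psi012 (f2_D psi' psi) - psi012 (f2_D psi psi').
  by rewrite /ihara (linB psi012L) (linD psi012L) /psi012 f2_evalB.
have e2 : psi021 (ihara psi psi') = <[psi021 psi, psi021 psi']>
    + psi021 (f2_D psi' psi) - psi021 (f2_D psi psi').
  by rewrite /ihara (linB psi021L) (linD psi021L) /psi021 f2_evalB.
split; first exact: cder_comm.
  exists (fun u => E' (E u) - E (E' u)); first exact: extends_comm.
  rewrite Ee Ee' !(linB EL) !(linB EL') !EM !EM' !EX !EX' Ee Ee'.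
  rewrite !D_psi_012 // !D_psi_021 // e1 e2 !(linD inL) !(linN inL) !uhat_in_bra.
  by rewrite !(mulrBl, mulrBr, mulrDl, mulrDr, mulrN, mulNr) !mulrA; zmod.
rewrite t1 t2 !D_psi_bra t1 t2.
rewrite !D_psi_012 // e1 !(lbraDl, lbraNl).
have -> : <[<[psi012 psi, psi012 psi']>, t0]> =
    <[psi012 psi, <[psi012 psi', t0]>]> - <[psi012 psi', <[psi012 psi, t0]>]>.
  by rewrite [<[psi012 psi, <[_, _]>]>]lbra_leibniz; zmod.
by zmod.
Qed.

End Commutators.

(** * Compatibility with the degree deg_- *)

Section DegM.
Local Notation xh := (x_hat true 1).
Local Notation yh := (x_hat false 1).
Local Notation t0 := (t0_hat 1).
Local Notation ex := exp_x1.
Implicit Types (psi : f2).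

Lemma t12_degm_der : is_derivation t12_degm /\
  forall g, t12_degm (lgen (@t1_rel 2) g) = (degm_gen g)%:R *: lgen (@t1_rel 2) g.
Proof.
by apply: derP; apply: t12_relP => s; rewrite /= -[lgen _ _]/(x_ _ _) t12_x2 scalerN.
Qed.

(** Concentrated in k = 0, so that [Nhat] is an instance of [dsum_map] and inherits its extension to
    the completed enveloping algebra. *)
Definition degm_part (k : nat) : t12 -> t12 := if k is 0 then t12_degm else fun=> 0.

Lemma degm_part_der k : is_derivation (degm_part k).
Proof.
case: k => [|k]; first by case: t12_degm_der.
by split=> [a x y|x y]; rewrite /= ?scaler0 ?addr0 // lbra0x lbrax0 addr0.
Qed.

Lemma degm_part_homog k d x : t1_grading 2 d x -> t1_grading 2 (d + k)%N (degm_part k x).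
Proof.
case: k => [|k] dx; last exact: (gpart0 (t1_grading 2)).
move: d x dx; apply: (homog_der (degm_part_der 0)) => g.
rewrite [degm_part 0 _](t12_degm_der.2 g); apply: (@gpartZ _ (t1_grading 2)).
by rewrite addn0; apply: homog_gen.
Qed.

Definition Nhat : t12_hat -> t12_hat := dsum_map degm_part_homog.

Lemma NhatE z d : Nhat z d = t12_degm (z d).
Proof.
by rewrite /= /dsum big_ord_recl subn0 /= big1 ?addr0.
Qed.

Lemma Nhat_cder : is_cderivation Nhat.
Proof. exact: (dsum_cder degm_part_der degm_part_homog). Qed.

Lemma Nhat_fmap : fmap 0 Nhat.
Proof. exact: (dsum_fmap (fun k => (degm_part_der k).1)). Qed.

Let NL : linear Nhat := Nhat_cder.1.1.
Let NB := Nhat_cder.1.2.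

Lemma Nhat_x s : Nhat (x_hat s 1) = (degm_gen (s, ord0 : 'I_2))%:R *: x_hat s 1.
Proof.
apply: compl_ext => d; rewrite NhatE complZ /= strand11.
have [[DL _] Dg] := t12_degm_der.
case: eqP => _; first exact: Dg.
by rewrite (lin0 DL) scaler0.
Qed.

Lemma Nhat_xh : Nhat xh = 0. Proof. by rewrite Nhat_x scale0r. Qed.
Lemma Nhat_yh : Nhat yh = yh. Proof. by rewrite Nhat_x scale1r. Qed.

Lemma Nhat_t0 : Nhat t0 = t0.
Proof.
rewrite t0_hatE /T0 (linN NL); congr (- _).
rewrite (ps_comm (a' := lbra xh) (b := Nhat) _ _ (ad_fmap (x_hat_low _ _)) Nhat_fmap).
  by rewrite Nhat_yh.
by move=> z; rewrite NB Nhat_xh lbra0x add0r.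
Qed.

Lemma Nhat_t12 : Nhat (t_hat 1 2) = t_hat 1 2.
Proof. by rewrite t_hat12 (linN NL) NB Nhat_xh Nhat_yh lbra0x add0r. Qed.

Lemma Nhat_t02 : Nhat (t0_hat 2) = t0_hat 2.
Proof.
by rewrite t0_hat2_sum (linN NL) (linD NL) Nhat_t0 Nhat_t12.
Qed.

Lemma f2_deg_der : [/\ is_derivation f2_deg, f2_deg fA = fA & f2_deg fB = fB].
Proof.
have [//|D Dg] := @derP _ f2_rel (fun g : bool => 1%N%:R *: lgen f2_rel g).
by split=> //; [have := Dg true|have := Dg false]; rewrite scale1r.
Qed.

Lemma der_f2_deg (L : lieType) (D : L -> L) a b phi : is_derivation D ->
  D a = a -> D b = b -> D (f2_eval a b phi) = f2_eval a b (f2_deg phi).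
Proof.
move=> [DL DB] Da Db; have [[DfL DfB] fDA fDB] := f2_deg_der.
apply: (lie_der_ext (f := f2_eval a b) (d := fun x => D (f2_eval a b x))
  (e := fun x => f2_eval a b (f2_deg x))) => [c x y|c x y|x y|x y|].
- by rewrite f2_evalL DL.
- by rewrite DfL f2_evalL.
- by rewrite f2_evalB DB.
- by rewrite DfB (linD (f2_evalL a b)) !f2_evalB.
by case; rewrite -/fA -/fB ?fDA ?fDB ?f2_evalA ?f2_evalBB.
Qed.

(** x_1 has deg_- equal to 0 and t_01, t_02, t_12 have deg_- equal to 1, so the commutator with
    [Nhat] has the values that characterize the derivation attached to (deg psi) psi. *)
Lemma D_psi_deg psi z : D_psi (f2_deg psi) z = Nhat (D_psi psi z) - D_psi psi (Nhat z).
Proof.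
suff : is_Dpsi (f2_deg psi) (fun z => Nhat (D_psi psi z) - D_psi psi (Nhat z)).
  by move=> /is_Dpsi_unique /(congr1 (@^~ z)) /= ->.
have [c1 [E EP Ee] t1] := D_psiP psi.
have [EN ENP] := dsum_extends degm_part_der degm_part_homog.
have [[EL EM] EC EX] := EP; have [[EL' EM'] EC' EX'] := ENP.
have inL := @uhat_in_linear _ (t1_grading 2).
have N12 : Nhat (psi012 psi) = psi012 (f2_deg psi).
  by apply: der_f2_deg; [exact: Nhat_cder.1|exact: Nhat_t0|exact: Nhat_t12].
have N21 : Nhat (psi021 psi) = psi021 (f2_deg psi).
  by apply: der_f2_deg; [exact: Nhat_cder.1|exact: Nhat_t02|rewrite t_hat21 Nhat_t12].
have ENe : EN ex = 0.
  rewrite (cder_uexp _ ENP) -[csingle _]/xh -/Nhat Nhat_xh.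
  by rewrite (lin0 (ps_fmap (ad_fmap (x_hat_low true 1)) _).1) (lin0 inL) mul0r.
split; first exact: cder_comm Nhat_cder c1.
  exists (fun u => EN (E u) - E (EN u)); first exact: extends_comm.
  rewrite Ee ENe (lin0 EL) subr0 (linB EL') !EM' ENe !EX' -/Nhat N12 N21.
  by rewrite mulr0 mul0r addr0 add0r.
rewrite t1 NB N12 Nhat_t0 t1.
by zmod.
Qed.

End DegM.

Section DegMHomog.
Local Notation xh := (x_hat true 1).
Local Notation t0 := (t0_hat 1).
Local Notation gd := (dual_grading (t1_grading 2)).
Local Notation gm := (t1_degm 2).

Definition hat_degm (m : nat) (z : t12_hat) : Prop := forall d, gm m (z d).

Fact hat_degm0 m : hat_degm m 0.
Proof. by move=> d; rewrite compl0; apply: (gpart0 gm). Qed.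
Fact hat_degmD m z w : hat_degm m z -> hat_degm m w -> hat_degm m (z + w).
Proof. by move=> hz hw d; rewrite complD; apply: gpartD. Qed.
Fact hat_degmZ m a z : hat_degm m z -> hat_degm m (a *: z).
Proof. by move=> hz d; rewrite complZ; apply: gpartZ. Qed.
Fact hat_degm_bra m n z w : hat_degm m z -> hat_degm n w -> hat_degm (m + n)%N <[z, w]>.
Proof. by move=> hz hw d; apply: gpart_sum => i; apply: gpart_bra. Qed.
Definition hat_degm_grading : lieGrading t12_hat :=
  @LieGrading t12_hat (Grading hat_degm0 hat_degmD hat_degmZ) hat_degm_bra.

Lemma hat_degmN m z : hat_degm m z -> hat_degm m (- z).
Proof. by rewrite -scaleN1r; apply: hat_degmZ. Qed.

Lemma hat_degm_csum m f : (forall n, hat_degm m (f n)) -> hat_degm m (csum f).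
Proof. by move=> hf d; apply: gpart_sum => i; apply: hf. Qed.

Lemma hat_degm_ps m x p z : hat_degm 0 x -> hat_degm m z -> hat_degm m (ps (lbra x) p z).
Proof.
move=> hx hz; apply: hat_degm_csum => n; apply: hat_degmZ.
by elim: n => //= n IH; rewrite -[m]add0n; apply: hat_degm_bra.
Qed.

Lemma hat_degm_x s : hat_degm (if s then 0 else 1)%N (x_hat s 1).
Proof.
move=> d /=; case: eqP => _; last exact: (gpart0 gm).
exact: (homog_gen (@lgen _ (@t1_rel 2)) (@degm_gen 2) (s, strand 1 1)).
Qed.

Lemma hat_degm_t0 : hat_degm 1 t0.
Proof.
rewrite t0_hatE; apply/hat_degmN/hat_degm_ps; first exact: (hat_degm_x true).
exact: (hat_degm_x false).
Qed.

Lemma hat_degm_t12 : hat_degm 1 (t_hat 1 2).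
Proof.
rewrite t_hat12; apply/hat_degmN/(hat_degm_bra (m := 0)); first exact: (hat_degm_x true).
exact: (hat_degm_x false).
Qed.

Lemma hat_degm_f2_eval a b q psi : hat_degm 1 a -> hat_degm 1 b -> f2_grading q psi ->
  hat_degm q (f2_eval a b psi).
Proof.
move=> ha hb; apply: (homog_morph (h := hat_degm_grading)).
  by case: (f2_evalP a b).
by case; rewrite -/fA -/fB ?f2_evalA ?f2_evalBB.
Qed.

Lemma hat_degm_u_plus q psi : f2_grading q psi -> hat_degm q (u_plus psi).
Proof.
move=> hq; have hx := hat_degm_x true; apply: hat_degm_ps => //; apply: hat_degmD.
  apply: hat_degm_f2_eval => //; last by rewrite t_hat21; apply: hat_degm_t12.
  by rewrite t0_hat2_sum; apply/hat_degmN/hat_degmD; [apply: hat_degm_t0|apply: hat_degm_t12].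
apply/hat_degmN/hat_degm_ps => //; apply: hat_degm_f2_eval => //.
  exact: hat_degm_t0.
exact: hat_degm_t12.
Qed.

Lemma hat_degm_u_minus q psi : f2_grading q psi -> hat_degm q.+1 (u_psi psi false).
Proof.
move=> hq; have hx := hat_degm_x true; have hu := hat_degm_u_plus hq.
(* In effect eps is given degree q: then x_1 + eps u_+ is homogeneous of degree 0, and its adjoint
   action preserves Q. *)
pose Q (u : compl gd) := hat_degm 1 (cfst u) /\ hat_degm q.+1 (csnd u).
have QZ a u : Q u -> Q (a *: u).
  by move=> [h1 h2]; rewrite /Q (linZ (cfst_fmap _).1) (linZ (csnd_fmap _).1); split; apply: hat_degmZ.
have Qb u : Q u -> Q <[cpair xh (u_plus psi), u]>.
  move=> [h1 h2]; rewrite [u]cpair_eta cpair_bra /Q cfst_pair csnd_pair; split.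
    exact: (hat_degm_bra (m := 0)).
  apply: hat_degmD; first exact: (hat_degm_bra (m := 0)).
  by rewrite -addn1; apply: hat_degm_bra.
have QT : Q (cpair t0 <[psi012 psi, t0]>).
  rewrite /Q cfst_pair csnd_pair; split; first exact: hat_degm_t0.
  rewrite -addn1; apply: hat_degm_bra; last exact: hat_degm_t0.
  by apply: hat_degm_f2_eval => //; [apply: hat_degm_t0|apply: hat_degm_t12].
have QN u : Q u -> hat_degm q.+1 (csnd u) by case.
have lX : low 1 (cpair xh (u_plus psi) : compl gd) by apply: cpair_low; apply: t12_hat_low.
rewrite /u_psi /u_Y (linN (csnd_fmap _).1); apply: hat_degmN.
rewrite (fmap_csum (csnd_fmap _) (ps_summable (ad_fmap lX) _ _)).
apply: hat_degm_csum => n; apply/QN/QZ.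
by elim: n => //= n IH; apply: Qb.
Qed.

Lemma raises_degm_t12_D q (al : bool -> t12) :
  gm q (al true) -> gm q.+1 (al false) -> raises_degm q (t12_D al).
Proof.
move=> h1 h2 p x hx; have [DP Dg] := t12_DP al.
rewrite -PoszD /=; move: p x hx; apply: (homog_der DP) => -[s b].
have h : gm (degm_gen (s, b) + q)%N (al s) by case: s; rewrite ?add0n ?add1n.
have [bE|bE] := I2P b; rewrite bE in h *; first by rewrite -[lgen _ _]/(x_ s ord0) Dg.
rewrite -[lgen _ _]/(x_ s ord_max) t12_x2 (linN DP.1) Dg -scaleN1r.
exact: (@gpartZ _ gm).
Qed.

Lemma gpartz0 (V : lmodType rat) (g : grading V) q : gpartz g q 0.
Proof. by case: q => n //=; apply: gpart0. Qed.

Lemma t12_D0 x : t12_D (fun=> 0) x = 0.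
Proof.
have [[DL DB] Dg] := t12_DP (fun=> 0).
apply: (lie_der_ext (f := id) (e := fun=> 0) DL) => //.
- by move=> a u v; rewrite scaler0 addr0.
- by move=> u v; rewrite lbra0x lbrax0 addr0.
case=> s b; have [->|->] := I2P b; first exact: Dg.
by rewrite -[lgen _ _]/(x_ s ord_max) t12_x2 (linN DL) Dg oppr0.
Qed.

End DegMHomog.

(** * Homogeneous components *)

(** Homogeneity of terms rather than of their classes: homogeneous relations are what makes
    [to_compl] well defined. *)
Inductive term_homog (G : Type) (dg : G -> nat) : nat -> lterm G -> Prop :=
| th_gen g : term_homog dg (dg g) (LGen g)
| th_zero d : term_homog dg d LZero
| th_add d s t of term_homog dg d s & term_homog dg d t : term_homog dg d (LAdd s t)
| th_scale d a s of term_homog dg d s : term_homog dg d (LScale a s)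
| th_bra m n s t of term_homog dg m s & term_homog dg n t :
    term_homog dg (m + n)%N (LBra s t).

Section Components.
Variables (G : Type) (R : lterm G -> lterm G -> Prop) (dg : G -> nat).
Local Notation gr := (pres_grading R dg).
Hypothesis RH : forall u v, R u v -> exists d, term_homog dg d u /\ term_homog dg d v.

Let single g := csingle (homog_gen (@lgen G R) dg g : gr _ _).

Lemma leval_single d u : term_homog dg d u ->
  exists gu : gr d (lclass R u), leval single u = csingle gu.
Proof.
elim=> {d u} [g|d|d s t _ [gs es] _ [gt et]|d a s _ [gs es]|m n s t _ [gs es] _ [gt et]] /=.
- by exists (homog_gen (@lgen G R) dg g).
- by exists (gpart0 gr d); apply/esym; have := (@csingle_eq0 _ gr _ _ (gpart0 gr d)); apply.
- have gst : gr d (lclass R (LAdd s t)) by rewrite lclass_add; apply: gpartD.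
  exists gst; rewrite es et; apply: compl_ext => e; rewrite complD /= lclass_add.
  by case: eqP; rewrite ?addr0.
- have gst : gr d (lclass R (LScale a s)) by rewrite lclass_scale; apply: gpartZ.
  exists gst; rewrite es; apply: compl_ext => e; rewrite complZ /= lclass_scale.
  by case: eqP; rewrite ?scaler0.
have gst : gr (m + n)%N (lclass R (LBra s t)) by rewrite lclass_bra; apply: gpart_bra.
by exists gst; rewrite es et csingle_bra; apply: (@csingle_eq _ gr); rewrite ?lclass_bra.
Qed.

Lemma single_rel u v : R u v -> leval single u = leval single v.
Proof.
move=> uv; have [d [hu hv]] := RH uv.
have [gu ->] := leval_single hu; have [gv ->] := leval_single hv.
by apply: (@csingle_eq _ gr) => //; apply: lclass_rel.
Qed.

Lemma to_compl_morph : lie_morphism (@to_compl G R dg).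
Proof. by case: (lextP single_rel). Qed.

Lemma to_compl_homog d x (gx : gr d x) : to_compl dg x = csingle gx.
Proof.
have [TL TB] := to_compl_morph.
have [gx' ->] : exists gx' : gr d x, to_compl dg x = csingle gx'; last exact: (@csingle_eq _ gr).
elim: gx => {d x} [g|d|d x y _ [gs es] _ [gt et]|d a x _ [gs es]|m n x y _ [gs es] _ [gt et]].
- by exists (homog_gen (@lgen G R) dg g); have [_ h] := lextP single_rel; apply: h.
- by exists (gpart0 gr d); rewrite (lin0 TL); apply/esym; have := (@csingle_eq0 _ gr _ _ (gpart0 gr d)); apply.
- exists (gpartD gs gt); rewrite (linD TL) es et; apply: compl_ext => e; rewrite complD /=.
  by case: eqP; rewrite ?addr0.
- exists (gpartZ a gs); rewrite (linZ TL) es; apply: compl_ext => e; rewrite complZ /=.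
  by case: eqP; rewrite ?scaler0.
by exists (gpart_bra gs gt); rewrite TB es et csingle_bra.
Qed.

Lemma to_compl_sum (x : presLie R) : exists N, x = \sum_(d < N) to_compl dg x d.
Proof.
have [TL TB] := to_compl_morph.
suff [N hN] : exists N, exists z : nat -> presLie R, (forall d, gr d (z d)) /\ x = \sum_(d < N) z d.
  have [z [zg xE]] := hN; exists N; rewrite {1}xE; apply: eq_bigr => d _.
  rewrite xE (lin_sum TL) compl_sum (bigD1 d) //= (to_compl_homog (zg d)) /= eqxx.
  rewrite big1 ?addr0 // => i id; rewrite (to_compl_homog (zg i)) /= ifF //.
  by apply/negbTE; rewrite eq_sym -val_eqE in id.
elim/lclassW: x; elim=> [g||s [N [z [zg sE]]] t [M [w [wg tE]]]|a s [N [z [zg sE]]]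
    |s [N [z [zg sE]]] t [M [w [wg tE]]]].
- exists (dg g).+1, (fun d => if d == dg g then lgen R g else 0); split.
    by move=> d; case: eqP => [->|_]; [apply: homog_gen|apply: (gpart0 gr)].
  by rewrite big_ord_recr /= eqxx big1 ?add0r // => i _; rewrite ltn_eqF.
- by exists 0%N, (fun=> 0); split=> [d|]; [apply: (gpart0 gr)|rewrite big_ord0].
- exists (N + M)%N, (fun d => (if (d < N)%N then z d else 0) + (if (d < M)%N then w d else 0)); split.
    by move=> d; apply: (gpartD (g := gr)); case: ifP => _ //; apply: (gpart0 gr).
  rewrite lclass_add sE tE big_split /=; congr (_ + _).
    by rewrite (big_ord_widen (N + M) (fun d => z d)) ?leq_addr // big_mkcond.
  by rewrite (big_ord_widen (N + M) (fun d => w d)) ?leq_addl // big_mkcond.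
- exists N, (fun d => a *: z d); split; first by move=> d; apply: (gpartZ (g := gr)).
  by rewrite lclass_scale sE scaler_sumr.
exists (N + M)%N, (fun d => \sum_(i < N) \sum_(j < M) if (i + j == d)%N then <[z i, w j]> else 0).
split.
  move=> d; apply: (gpart_sum (g := gr)) => i; apply: (gpart_sum (g := gr)) => j.
  by case: eqP => [<-|_]; [apply: (gpart_bra (l := gr))|apply: (gpart0 gr)].
rewrite lclass_bra sE tE lbra_suml exchange_big /=; apply: eq_bigr => i _.
rewrite lbra_sumr exchange_big /=; apply: eq_bigr => j _.
have ij : (i + j < N + M)%N by have := ltn_ord i; have := ltn_ord j; lia.
rewrite (bigD1 (Ordinal ij)) //= eqxx big1 ?addr0 // => d dN.
by rewrite ifF //; apply/negbTE; rewrite eq_sym -val_eqE in dN.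
Qed.

End Components.

Lemma f2_rel_homog (u v : lterm bool) : f2_rel u v ->
  exists d, term_homog (fun=> 1%N) d u /\ term_homog (fun=> 1%N) d v.
Proof. by []. Qed.

Section TlieHomog.
Variable n : nat.
Local Notation one := (fun=> 1%N).
Definition t_grading : lieGrading (tlie n) := pres_grading (@t_rel n) one.

Lemma tterm_homog i j : term_homog one 1 (@tterm n i j).
Proof.
rewrite /tterm; case: insub => [g|]; last exact: th_zero.
exact: (th_gen (fun=> 1%N) g).
Qed.

Lemma t_rel_homog (u v : lterm (tgen n)) : t_rel u v ->
  exists d, term_homog one d u /\ term_homog one d v.
Proof.
have h := tterm_homog; case=> [i j _|i j k _|i j k l _].
- by exists 1%N.
- by exists (1 + 1)%N; split; [apply: th_bra => //; apply: th_add|apply: th_zero].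
- by exists (1 + 1)%N; split; [apply: th_bra|apply: th_zero].
Qed.

Lemma tt_homog i j : t_grading 1 (@tt_ n i j).
Proof.
rewrite /tt_ /tterm; case: insub => [g|]; last exact: (gpart0 t_grading).
exact: (homog_gen (@lgen _ (@t_rel n)) one g).
Qed.

End TlieHomog.

Lemma to_compl_cmap (G H : Type) (R : lterm G -> lterm G -> Prop)
    (S : lterm H -> lterm H -> Prop) (dg : G -> nat) (dh : H -> nat)
    (f : presLie R -> presLie S) (fM : lie_morphism f)
    (fg : forall d x, pres_grading R dg d x -> pres_grading S dh d (f x)) :
  (forall u v, R u v -> exists d, term_homog dg d u /\ term_homog dg d v) ->
  (forall u v, S u v -> exists d, term_homog dh d u /\ term_homog dh d v) ->
  forall x, to_compl dh (f x) = cmap fg (to_compl dg x).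
Proof.
move=> RH SH; apply: lie_morphism_ext.
- exact: lie_morphism_comp (to_compl_morph SH) fM.
- exact: lie_morphism_comp (cmap_morph fM fg) (to_compl_morph RH).
move=> g; have gg := homog_gen (@lgen G R) dg g : pres_grading R dg _ _.
by rewrite (to_compl_homog RH gg) (cmap_csingle fM.1) (to_compl_homog SH (fg _ _ gg)).
Qed.

Definition component (d : nat) (psi : f2) : f2 := to_compl (fun=> 1%N) psi d.

Lemma component_linear d : linear (component d).
Proof.
by move=> a x y; rewrite /component (to_compl_morph f2_rel_homog).1 complD.
Qed.

Lemma component_homog d psi : f2_grading d (component d psi).
Proof. exact: (complP (to_compl (fun=> 1%N) psi)). Qed.

Lemma componentE e d psi : f2_grading d psi -> component e psi = if e == d then psi else 0.
Proof. by move=> dpsi; rewrite /component (to_compl_homog f2_rel_homog dpsi). Qed.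

Section Insertions.
Variables (n : nat) (I1 I2 I3 : seq nat).
Hypothesis uI : uniq (I1 ++ I2 ++ I3).
Let s := [:: I1; I2; I3].

Lemma f2_t_morph : lie_morphism (f2_t n.+1 s).
Proof.
apply: lie_morphism_comp; first by have [] := t_insP (blocks_disjoint n uI).
by case: (f2_evalP (tk 2 1 2) (tk 2 2 3)).
Qed.

Lemma f2_t_homog d psi : f2_grading d psi -> t_grading n.+1 d (f2_t n.+1 s psi).
Proof.
have [insM insE] := t_insP (blocks_disjoint n uI).
have tH i j : t_grading n.+1 1 (t_ins (blocks n.+1 s) (tt_ i j : tlie 3)).
  have [->|ij] := eqVneq i j; first by rewrite tt_diag (lin0 insM.1); apply: (gpart0 (t_grading _)).
  rewrite insE //; rewrite big_mkcond; apply: gpart_sum => a.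
  case: ifP => _; last exact: (gpart0 (t_grading _)).
  rewrite big_mkcond; apply: gpart_sum => b.
  by case: ifP => _; [exact: tt_homog|exact: (gpart0 (t_grading _))].
apply: (homog_morph f2_t_morph); case.
  by rewrite -/fA /f2_t /f2_to_t3 f2_evalA; apply: tH.
by rewrite -/fB /f2_t /f2_to_t3 f2_evalBB; apply: tH.
Qed.

Lemma f2_t_component d psi :
  to_compl (fun=> 1%N) (f2_t n.+1 s psi) d = f2_t n.+1 s (component d psi).
Proof.
by rewrite (to_compl_cmap f2_t_morph f2_t_homog f2_rel_homog (@t_rel_homog _)).
Qed.

End Insertions.

Lemma in_grt1_component d psi : in_grt1 psi -> in_grt1 (component d psi).
Proof.
have T n := to_compl_morph (@t_rel_homog n).
case=> h1 h2 h3 h4; split.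
- move/(congr1 (fun x => to_compl (fun=> 1%N) x d)): h1.
  by rewrite (linD (T _).1) (lin0 (T _).1) complD !f2_t_component.
- move/(congr1 (fun x => to_compl (fun=> 1%N) x d)): h2.
  by rewrite !(linD (T _).1) (lin0 (T _).1) !complD !f2_t_component.
(* This relation is read one degree higher, because t_23 and t_13 have degree 1. *)
- move/(congr1 (fun x => to_compl (fun=> 1%N) x (1 + d)%N)): h3.
  rewrite (linD (T _).1) (lin0 (T _).1) complD !(T _).2.
  rewrite !(to_compl_homog (@t_rel_homog _) (tt_homog _ _)).
  by rewrite !(@bra_csingle _ (t_grading 3)) !f2_t_component.
move/(congr1 (fun x => to_compl (fun=> 1%N) x d)): h4.
by rewrite !(linD (T _).1) !(linN (T _).1) (lin0 (T _).1) !(complD, complN) !f2_t_component.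
Qed.

(** With arguments of degree 2, the part of psi of degree m contributes in degree 2 m only; odd
    degrees are empty. *)
Lemma f2_eval_csingle (L : lieType) (g : lieGrading L) a b (ga : g 2 a) (gb : g 2 b) psi n :
  f2_eval (csingle ga) (csingle gb) psi n =
  f2_eval a b (if odd n then 0 else component n./2 psi).
Proof.
have [N ->] := to_compl_sum f2_rel_homog psi.
rewrite (lin_sum (f2_evalL _ _)) compl_sum.
have -> : (if odd n then 0 else component n./2 (\sum_(d < N) component d psi)) =
   \sum_(d < N) (if odd n then 0 else component n./2 (component d psi)).
  case: odd; first by rewrite big1.
  by rewrite (lin_sum (component_linear _)).
rewrite (lin_sum (f2_evalL _ _)); apply: eq_bigr => e _.
have he := component_homog e psi; rewrite -[to_compl _ _ _]/(component e psi).
have [gx ->] : exists gx : g (e * 2)%N (f2_eval a b (component e psi)),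
    f2_eval (csingle ga) (csingle gb) (component e psi) = csingle gx.
  elim: he => {e} [[]|e|e x y _ [gx ex] _ [gy ey]|e c x _ [gx ex]|m k x y _ [gx ex] _ [gy ey]].
  - by rewrite -/fA !f2_evalA; exists ga.
  - by rewrite -/fB !f2_evalBB; exists gb.
  - rewrite !(lin0 (f2_evalL _ _)); exists (gpart0 g _).
    by apply/esym; apply: (@csingle_eq0 _ g).
  - rewrite !(linD (f2_evalL _ _)); exists (gpartD gx gy); rewrite ex ey.
    by apply: compl_ext => d; rewrite complD /=; case: eqP; rewrite ?addr0.
  - rewrite !(linZ (f2_evalL _ _)); exists (gpartZ c gx); rewrite ex.
    by apply: compl_ext => d; rewrite complZ /=; case: eqP; rewrite ?scaler0.
  rewrite !f2_evalB mulnDl; exists (gpart_bra gx gy).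
  by rewrite ex ey csingle_bra.
rewrite /= (componentE _ he); have [->|ne] := eqVneq n (e * 2)%N.
  by rewrite muln2 odd_double doubleK eqxx.
case: (boolP (odd n)) => on; first by rewrite (lin0 (f2_evalL _ _)).
case: eqP => [h|]; last by rewrite (lin0 (f2_evalL _ _)).
by case/eqP: ne; rewrite -h muln2 even_halfK.
Qed.

Section EllipticComponents.
Variables (psi : f2) (psiP : in_grt1 psi) (u : bool -> t12_hat).
Hypothesis ul : forall s, low 1 (u s).
Hypothesis up : ps (lbra (x_hat true 1)) nhh (u true) =
  psi021 psi - ps (lbra (x_hat true 1)) nexp (psi012 psi).
Hypothesis um : T0 (cpair (x_hat true 1) (u true) : compl (dual_grading (t1_grading 2)))
    (cpair (x_hat false 1) (u false)) = cpair (t0_hat 1) <[psi012 psi, t0_hat 1]>.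
Local Notation x := (x13 true).
Local Notation y := (x13 false).
Local Notation t := (el_t x y).
Local Notation P A B := (f2_eval A B psi).
Local Notation i1 := (inord 1 : 'I_3).
Local Notation i2 := (inord 2 : 'I_3).
Local Notation pot := (potential psi).

Let u012 : uniq [:: ord0; i1; i2].
Proof. by have [n01 n02 n12 _] := neq_I3; rewrite /= !inE n01 n02 n12. Qed.

Let pot0 : pot ord0 = 0. Proof. by rewrite /potential eqxx. Qed.
Let psi123 : P (t ord0 i1) (t i1 i2) = pot i2.
Proof.
have [_ ujik ujki _ _] := uniq3_perm u012.
have u' : uniq [:: ord0; i2; i1] by have [] := uniq3_perm u012.
by rewrite -(potentialP psiP u') pot0 subr0.
Qed.
Let psi213 : P (t i1 ord0) (t ord0 i2) = pot i2 - pot i1.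
Proof.
have u' : uniq [:: i1; i2; ord0] by have [] := uniq3_perm u012.
by rewrite -(potentialP psiP u').
Qed.

(** This and the next two lemmas remove the gauge: pot vanishes at the first strand, so psi^{1,2,3}
    and psi^{2,1,3} are expressed by the potentials of the other two. *)
Lemma ell_hat_sum s : iota ord0 (u s) + iota i1 (u s) + iota i2 (u s)
  + <[x13 s ord0, P (t ord0 i1) (t i1 i2)]> + <[x13 s i1, P (t i1 ord0) (t ord0 i2)]> = 0.
Proof.
have := ell_eq_sum psiP ul up um s u012.
rewrite !big_cons big_nil pot0 lbra0x => h.
have xs : x13 s i2 = - (x13 s ord0 + x13 s i1).
  have [_ _ hx hy _] := x13_elliptic.
  have : \sum_i x13 s i = 0 by case: s {h}.
  by rewrite (sum3 _ u012) addrC => /eqP; rewrite addr_eq0 => /eqP.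
rewrite psi123 psi213 -[RHS]h xs !(lbraDr, lbraNr).
by rewrite [<[pot i2, x13 _ ord0]>]lbraC [<[pot i2, x13 _ i1]>]lbraC [<[pot i1, _]>]lbraC; zmod.
Qed.

Lemma ell_hat_comm s : <[x13 s ord0, iota i2 (u s)]> + <[iota ord0 (u s), x13 s i2]>
  - <[x13 s ord0, <[x13 s i2, P (t ord0 i1) (t i1 i2)]>]> = 0.
Proof.
have /uniq3P[_ n02 _] := u012.
rewrite -[RHS](ell_eq_comm psiP ul up um s n02) pot0 psi123 lbra0x addr0 lbraDr.
by rewrite [<[pot i2, _]>]lbraC lbraNr; zmod.
Qed.

Lemma ell_hat_mixed : <[x ord0, iota i1 (u false)]> - <[y i1, iota ord0 (u true)]> =
  <[y i1, <[x ord0, P (t ord0 i1) (t i1 i2)]>]>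
  - <[x ord0, <[y i1, P (t i1 ord0) (t ord0 i2)]>]>.
Proof.
have h := ell_eq_mixed psiP ul up um u012.
rewrite pot0 lbra0x addr0 lbraDr in h.
have J := lbra_jacobi (pot i2) (x ord0) (y i1).
rewrite psi123 psi213 lbraDr !lbraNr lbraDr lbraNr.
rewrite [<[y i1, iota _ _]>]lbraC.
have -> : <[x ord0, iota i1 (u false)]> =
    <[pot i2, <[x ord0, y i1]>]> - <[x ord0, <[pot i1, y i1]>]> - <[iota ord0 (u true), y i1]>.
  by rewrite -h; zmod.
have -> : <[pot i2, <[x ord0, y i1]>]> = - <[x ord0, <[y i1, pot i2]>]> - <[y i1, <[pot i2, x ord0]>]>.
  by apply/eqP; rewrite -subr_eq0 -J; apply/eqP; zmod.
by rewrite [<[pot i2, x ord0]>]lbraC [<[pot i1, _]>]lbraC !lbraNr; zmod.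
Qed.

Local Notation psi_ n := (if odd n then 0 else component n./2 psi).

Lemma blocks_ins (i : 'I_3) l : (forall a : 'I_3, (a.+1 \in l) = (a != i)) ->
  blocks 3 [:: [:: i.+1]; l] = ins_blocks i.
Proof.
move=> il; apply: funext => b; apply/setP => a; rewrite /blocks /ins_blocks.
by have [->|->] := I2P b; rewrite !inE /= ?il ?inE ?eqSS.
Qed.

Lemma t12_t1E (i : 'I_3) l al : (forall a : 'I_3, (a.+1 \in l) = (a != i)) ->
  t12_t1 3 [:: [:: i.+1]; l] al = ins13 i al.
Proof. by move=> il; rewrite /t12_t1 blocks_ins. Qed.

Lemma f2_eval_el_t n a b c d :
  P (t a b) (t c d) n = f2_eval <[x_ true a, x_ false b]> <[x_ true c, x_ false d]> (psi_ n).
Proof.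
rewrite /el_t !csingle_bra.
exact: (f2_eval_csingle (gpart_bra (x_homog true a) (x_homog false b)) (gpart_bra (x_homog true c) (x_homog false d))).
Qed.

End EllipticComponents.

Lemma f2_t1E a b c psi : uniq [:: a; b; c] -> all (fun k => 0 < k <= 3)%N [:: a; b; c] ->
  f2_t1 3 [:: [:: a]; [:: b]; [:: c]] psi =
  f2_eval <[xk 2 true a, xk 2 false b]> <[xk 2 true b, xk 2 false c]> psi.
Proof.
move=> u al; have [TM TE] := t_to_t1P 3.
by rewrite /f2_t1 (@f2_tE 2 [:: a] [:: b] [:: c] u al _ _ _ _ TM TE) !big_seq1.
Qed.

Lemma in_grt1_0 : in_grt1 0.
Proof.
by split; rewrite !(lin0 (f2_t_morph _ _).1) // ?lbrax0 ?subr0 ?addr0.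
Qed.

(** * The morphism to the completed elliptic Lie algebra *)

Section Triple.
Variables (psi : f2) (psiP : in_grt1 psi).
Local Notation i1 := (inord 1 : 'I_3).
Local Notation i2 := (inord 2 : 'I_3).

Definition grt_to_ell (phi : f2) : nat -> ell := ell_hat_triple phi (u_psi phi).

Lemma strand3 : [/\ strand 2 1 = ord0, strand 2 2 = i1 & strand 2 3 = i2].
Proof. by split; apply: val_inj; rewrite /strand /= !inordK. Qed.

Lemma grt_to_ell_in n : in_grt1ell (grt_to_ell psi n).
Proof.
have ul s := t12_hat_low (u_psi psi s).
have up := u_plusE psi; have um := u_minusE psi.
have [s1 s2 s3] := strand3.
have alE e : ell_alpha (grt_to_ell psi n) e = u_psi psi e n.+1 by case: e.
have psE : ell_psi (grt_to_ell psi n) = if odd n then 0 else component n./2 psi by [].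
have B (i : 'I_3) k l al : k = i.+1 -> (forall a : 'I_3, (a.+1 \in l) = (a != i)) ->
    t12_t1 3 [:: [:: k]; l] al = ins13 i al.
  by move=> ->; apply: t12_t1E.
have B1 l al : l =i [:: 2; 3]%N -> t12_t1 3 [:: [:: 1%N]; l] al = ins13 ord0 al.
  by move=> lE; apply: B => //; case=> [[|[|[|//]]] ?]; rewrite lE.
have B2 l al : l =i [:: 1; 3]%N -> t12_t1 3 [:: [:: 2%N]; l] al = ins13 i1 al.
  move=> lE; apply: B => [|]; first by rewrite inordK.
  by case=> [[|[|[|//]]] ?]; rewrite lE -val_eqE /= inordK.
have B3 l al : l =i [:: 1; 2]%N -> t12_t1 3 [:: [:: 3%N]; l] al = ins13 i2 al.
  move=> lE; apply: B => [|]; first by rewrite inordK.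
  by case=> [[|[|[|//]]] ?]; rewrite lE -val_eqE /= inordK.
have C (a b : nat) : [:: a; b] =i [:: b; a] by move=> c; rewrite !inE orbC.
split; rewrite ?psE.
- by case: odd; [exact: in_grt1_0|exact: in_grt1_component].
(* The n-th triple has psi in degree n of x, y and alpha in degree n + 1; this equation is therefore
   the degree n + 1 part, and the next two are those of degree n + 2. *)
- move=> e; rewrite !alE B1 // B2 // B3 // !f2_t1E // /xk s1 s2 s3.
  have := congr1 (fun z : t13_hat => z (1 + n)%N) (ell_hat_sum psiP ul up um e).
  by rewrite !complD !bra_csingle !f2_eval_el_t.
- move=> e; rewrite !alE B1 // B3 // !f2_t1E // /xk s1 s2 s3.
  have := congr1 (fun z : t13_hat => z (1 + (1 + n))%N) (ell_hat_comm psiP ul up um e).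
  rewrite !complD complN [<[iota _ _, _]>]lbraC complN !bra_csingle !f2_eval_el_t.
  by rewrite [<[ins13 _ _, _]>]lbraC.
rewrite !alE B1 // B2 // !f2_t1E // /xk s1 s2 s3.
have := congr1 (fun z : t13_hat => z (1 + (1 + n))%N) (ell_hat_mixed psiP ul up um).
by rewrite !complD !complN !bra_csingle !f2_eval_el_t.
Qed.

Lemma grt_to_ell_degree n : ell_degree n (grt_to_ell psi n).
Proof.
split; last by case; apply: (complP (u_psi psi _)).
by rewrite /ell_psi /=; case: odd => //; exact: (component_homog _ psi).
Qed.

End Triple.

Lemma u_psiE psi s : u_psi psi s = D_psi psi (x_hat s 1).
Proof. by rewrite /D_psi Dhat_x. Qed.

Lemma u_psi_linear s : linear (u_psi^~ s).
Proof. by move=> a psi phi; rewrite !u_psiE D_psi_linear. Qed.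

Lemma grt_to_ell_linear : linear grt_to_ell.
Proof.
move=> a psi phi; apply: funext => n.
rewrite -[RHS]/(a *: grt_to_ell psi n + grt_to_ell phi n).
rewrite /grt_to_ell /ell_hat_triple !u_psi_linear !(to_compl_morph f2_rel_homog).1.
by case: odd => [|//]; congr (_, _, _); apply/esym; rewrite -[LHS]/(a *: 0 + 0 : f2) scaler0 addr0.
Qed.

Lemma grt_to_ell0 : grt_to_ell 0 = 0.
Proof. exact: lin0 grt_to_ell_linear. Qed.

Section HomogeneousBilinear.
Variables (G : Type) (R : lterm G -> lterm G -> Prop) (dg : G -> nat).
Local Notation gr := (pres_grading R dg).
Hypothesis RH : forall u v, R u v -> exists d, term_homog dg d u /\ term_homog dg d v.

Lemma lin_homog_ext (V : lmodType rat) (f h : presLie R -> V) : linear f -> linear h ->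
  (forall d x, gr d x -> f x = h x) -> f =1 h.
Proof.
move=> fL hL fh x; have [N ->] := to_compl_sum RH x.
rewrite (lin_sum fL) (lin_sum hL); apply: eq_bigr => d _.
exact: (fh d) (complP (to_compl dg x) d).
Qed.

Variable op : presLie R -> presLie R -> presLie R.
Hypotheses (opl : forall y, linear (op^~ y)) (opr : forall x, linear (op x))
  (opg : forall d e x y, gr d x -> gr e y -> gr (d + e)%N (op x y)).

Lemma to_compl_bilinear x y d :
  to_compl dg (op x y) d = cauchy op (to_compl dg x) (to_compl dg y) d.
Proof.
have TL := (to_compl_morph RH).1.
move: x; apply: lin_homog_ext => [a x x'|a x x'|m x xm].
- by rewrite opl TL complD.
- rewrite /cauchy scaler_sumr -big_split; apply: eq_bigr => i _.
  by rewrite TL complD complZ opl.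
move: y; apply: lin_homog_ext => [a y y'|a y y'|n y yn].
- by rewrite opr TL complD.
- rewrite /cauchy scaler_sumr -big_split; apply: eq_bigr => i _.
  by rewrite TL complD complZ opr.
rewrite (to_compl_homog RH (opg xm yn)) (to_compl_homog RH xm) (to_compl_homog RH yn).
rewrite (@cauchy_csingle _ gr) // => z; [exact: lin0 (opl z)|exact: lin0 (opr z)].
Qed.

End HomogeneousBilinear.

Lemma f2_rel_homog2 (u v : lterm bool) : f2_rel u v ->
  exists d, term_homog (fun=> 2%N) d u /\ term_homog (fun=> 2%N) d v.
Proof. by []. Qed.

Local Notation psi_ psi n := (if odd n then 0 else component n./2 psi).

(** Giving A and B degree 2 absorbs the distinction between odd and even n, so the general formula
    for components of a bilinear operation applies to the Ihara bracket. *)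
Lemma component2E psi n : to_compl (fun=> 2%N) psi n = psi_ psi n.
Proof.
have gg b : pres_grading f2_rel (fun=> 2%N) 2 (lgen f2_rel b).
  exact: (homog_gen (@lgen _ f2_rel) (fun=> 2%N) b).
have := f2_eval_csingle (gg true) (gg false) psi n.
have -> : f2_eval (csingle (gg true)) (csingle (gg false)) psi = to_compl (fun=> 2%N) psi.
  apply: lie_morphism_ext; [by case: (f2_evalP (csingle (gg true)) (csingle (gg false)))|exact: to_compl_morph|].
  case; rewrite -/fA -/fB ?f2_evalA ?f2_evalBB; apply/esym;
    exact: (to_compl_homog f2_rel_homog2).
move=> ->; apply: (lie_morphism_ext (h := id)) => //.
  by case: (f2_evalP fA fB).
by case; rewrite -/fA -/fB ?f2_evalA ?f2_evalBB.
Qed.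

Lemma f2_D_linear x : linear (f2_D^~ x).
Proof.
move=> a psi phi; have [[L1 B1] A1 BB1] := f2_DP (a *: psi + phi).
have [[L2 B2] A2 BB2] := f2_DP psi; have [[L3 B3] A3 BB3] := f2_DP phi.
apply: (lie_der_ext (f := id) (d := f2_D (a *: psi + phi)) (e := fun x => a *: f2_D psi x + f2_D phi x)) => //.
- by move=> b y z; rewrite L2 L3 !scalerDr !scalerA mulrC; zmod.
- by move=> y z; rewrite B2 B3 lbraDl lbraDr lbraZl lbraZr; zmod.
case; rewrite -/fA -/fB.
  by rewrite A1 A2 A3 lbraDl lbraZl.
by rewrite BB1 BB2 BB3 scaler0 addr0.
Qed.

Lemma ihara_linl phi : linear (ihara^~ phi).
Proof.
move=> a x y; have [[DL _] _ _] := f2_DP phi; rewrite /ihara DL f2_D_linear lbraDl lbraZl; zmod.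
Qed.

Lemma ihara_linr psi : linear (ihara psi).
Proof.
move=> a x y; have [[DL _] _ _] := f2_DP psi; rewrite /ihara DL f2_D_linear lbraDr lbraZr; zmod.
Qed.

Lemma f2_D_homog (c d e : nat) psi x : pres_grading f2_rel (fun=> c) d psi ->
  pres_grading f2_rel (fun=> c) e x -> pres_grading f2_rel (fun=> c) (e + d)%N (f2_D psi x).
Proof.
move=> hd; move: e x; have [D A B] := f2_DP psi; apply: (homog_der D); case.
  rewrite -/fA A addnC; apply: gpart_bra => //; exact: (homog_gen (@lgen _ f2_rel) (fun=> c) true).
by rewrite -/fB B; apply: (gpart0 (pres_grading f2_rel (fun=> c))).
Qed.

Lemma ihara_homog c d e psi phi : pres_grading f2_rel (fun=> c) d psi ->
  pres_grading f2_rel (fun=> c) e phi ->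
  pres_grading f2_rel (fun=> c) (d + e)%N (ihara psi phi).
Proof.
move=> hd he; apply: gpartD; last first.
  by rewrite -scaleN1r; apply: gpartZ; rewrite addnC; apply: f2_D_homog.
by apply: gpartD; [apply: gpart_bra|apply: f2_D_homog].
Qed.

Lemma ell_eq (z w : ell) : ell_psi z = ell_psi w ->
  (forall s, ell_alpha z s = ell_alpha w s) -> z = w.
Proof.
case: z w => [[p a] b] [[p' a'] b'] /= pp' ab.
by congr (_, _, _); [exact: pp'|exact: (ab true)|exact: (ab false)].
Qed.

Lemma ell_alpha_to_ell psi n : ell_alpha (grt_to_ell psi n) = fun s => u_psi psi s n.+1.
Proof. by apply: funext; case. Qed.

Lemma grt_to_ell_bracket psi phi : in_grt1 psi -> in_grt1 phi ->
  grt_to_ell (ihara psi phi) = cauchy ell_bracket (grt_to_ell psi) (grt_to_ell phi).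
Proof.
move=> psiP phiP; apply: funext => n.
have pL : linear ell_psi by [].
have aL s : linear (ell_alpha^~ s) by case: s.
apply: ell_eq.
  rewrite (lin_sum pL) -[LHS]component2E (to_compl_bilinear f2_rel_homog2 ihara_linl ihara_linr (@ihara_homog 2)).
  by apply: eq_bigr => i _; rewrite !component2E.
move=> s; rewrite ell_alpha_to_ell u_psiE D_psi_ihara // -!u_psiE (lin_sum (aL s)).
(* The term k = n + 1 is dropped, z having no component of degree 0; the sum then has the range of
   the bracket of completions. *)
have DE x z : D_psi x z n.+1 = \sum_(k < n.+1) dpart (u_psi x) k (z (n.+1 - k)%N).
  rewrite /= /dsum big_ord_recr /= subnn t12_hat0.
  by rewrite (lin0 (dpart_der _ _).1) addr0.
rewrite complD complN !DE (reindex_inj rev_ord_inj) -sumrN -big_split.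
apply: eq_bigr => i _ /=; have ni := ltn_ord i.
have -> : (n.+1 - (n.+1 - i.+1) = i.+1)%N by lia.
have -> : (n.+1 - i = (n - i).+1)%N by lia.
by rewrite subSS /dpart -!ell_alpha_to_ell; case: s.
Qed.

Lemma component_deg d psi : component d (f2_deg psi) = f2_deg (component d psi).
Proof.
have [[DL _] _ _] := f2_deg_der; have cL := component_linear d.
move: psi; apply: (lin_homog_ext f2_rel_homog) => [a x y|a x y|e x xe].
- by rewrite DL cL.
- by rewrite cL DL.
rewrite (componentE d xe) (f2_degE xe) (linZ cL) (componentE d xe).
by case: eqP => _; rewrite ?(f2_degE xe) // scaler0 (lin0 DL).
Qed.

(** The commutator of deg_- with D_psi subtracts nothing at x_1 and D_psi(y_1) at y_1; the latter is
    the 1 in the factor 1 - deg_- of the action of e_22. *)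
Lemma grt_to_ell_deg psi n : grt_to_ell (f2_deg psi) n = - e22_act (grt_to_ell psi n).
Proof.
have [[DL _] _ _] := f2_deg_der; have DhL : linear (D_psi psi) := (Dhat_der _).1.
apply: ell_eq.
  rewrite -[ell_psi (- _)]/(- - f2_deg (ell_psi (grt_to_ell psi n))) opprK.
  rewrite /ell_psi /=; case: odd; first by rewrite (lin0 DL).
  exact: component_deg.
move=> s; rewrite ell_alpha_to_ell u_psiE D_psi_deg -u_psiE.
case: s; last first.
  rewrite Nhat_yh -u_psiE complD complN NhatE -opprB.
  by [].
rewrite Nhat_xh (lin0 DhL) subr0 NhatE.
by rewrite -[RHS]/(- - t12_degm (u_psi psi true n.+1)) opprK.
Qed.

Definition grt_to_ell_ext (x : f2 * rat^o) : nat -> ell * rat^o :=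
  fun n => (grt_to_ell x.1 n, if n == 0%N then x.2 else 0).

Lemma grt_to_ell_ext_morphism : lie_morphism_on grt grt_ell_hat grt_to_ell_ext.
Proof.
split=> [x xP n|a x y _ _|x y xP yP].
- split; first exact: grt_to_ell_in.
  by split=> /= [|/negbTE -> //]; apply: grt_to_ell_degree.
- apply: funext => n; rewrite -[RHS]/(a *: grt_to_ell_ext x n + grt_to_ell_ext y n).
  rewrite /grt_to_ell_ext /= grt_to_ell_linear; congr (_, _).
  by case: eqP => // _; apply/esym; rewrite -[LHS]/(a *: 0 + 0 : rat^o) scaler0 addr0.
apply: funext => n; rewrite -[RHS]/(cauchy (lbracket_on grt_ell) (grt_to_ell_ext x) (grt_to_ell_ext y) n).
have f1 : linear (fun z : ell * rat^o => z.1) by [].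
have snd2 : linear (fun z : ell * rat^o => z.2) by [].
apply: injective_projections; last first.
  rewrite /cauchy (lin_sum snd2) big1 //=; exact: if_same.
rewrite /cauchy (lin_sum f1) /= big_split /=.
have GN u : grt_to_ell (- u) n = - grt_to_ell u n by rewrite (linN grt_to_ell_linear).
have GZ a u : grt_to_ell (a *: u) n = a *: grt_to_ell u n by rewrite (linZ grt_to_ell_linear).
have GD u v : grt_to_ell (u + v) n = grt_to_ell u n + grt_to_ell v n by rewrite (linD grt_to_ell_linear).
rewrite GD (grt_to_ell_bracket xP yP) !(GD, GN, GZ) !grt_to_ell_deg !opprK; congr (_ + _).
rewrite sumrB; congr (_ - _).
  (* The scalar parts sit in degree 0, so of the Cauchy sum only the terms i = 0 and i = n
     contribute. *)
  rewrite (bigD1 ord0) //= subn0 big1 ?addr0 // => i i0.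
  by rewrite ifF ?scale0r //; apply/negbTE; rewrite -val_eqE in i0.
rewrite (bigD1 ord_max) //= subnn big1 ?addr0 // => i iN.
rewrite ifF ?scale0r //; apply/negbTE; rewrite -val_eqE /= in iN.
by have := ltn_ord i; lia.
Qed.

Lemma grt_to_ell_ext_degm q x : grt_degree q x -> grt_ell_hat_degm q (grt_to_ell_ext x).
Proof.
move=> [xq x2] n; split; last by move=> /x2 e /=; rewrite e if_same.
case: q xq {x2} => [m|m] /= xq.
  split.
    have := componentE n./2 xq; rewrite /ell_psi /= -[to_compl _ _ _]/(component _ _) => ->.
    by case: odd; [|case: (_ == _) => //]; apply: (gpart0 f2_grading).
  rewrite ell_alpha_to_ell; apply: raises_degm_t12_D.
    exact: hat_degm_u_plus.
  exact: hat_degm_u_minus.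
(* For negative q, having degree q means that psi = 0. *)
rewrite xq grt_to_ell0; split; first exact: gpartz0.
move=> p z _; rewrite (_ : ell_alpha _ = fun=> 0); last by apply: funext; case.
by rewrite t12_D0; apply: gpartz0.
Qed.

Theorem proposition4p15 :
  (forall psi : f2, grt1 psi -> exists! D : t12_hat -> t12_hat, is_Dpsi psi D) /\
  exists Phi : f2 -> (nat -> ell),
    [/\ lie_morphism_on grt1 grt1ell_hat Phi,
        forall (psi : f2) (D : t12_hat -> t12_hat), grt1 psi -> is_Dpsi psi D ->
          Phi psi = ell_hat_triple psi (fun s => D (x_hat s 1%N)),
        forall Phi' : f2 -> (nat -> ell),
          lie_morphism_on grt1 grt1ell_hat Phi' ->
          (forall (psi : f2) (D : t12_hat -> t12_hat), grt1 psi -> is_Dpsi psi D ->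
            Phi' psi = ell_hat_triple psi (fun s => D (x_hat s 1%N))) ->
          forall psi : f2, grt1 psi -> Phi' psi = Phi psi
      & exists Psi : f2 * rat^o -> (nat -> ell * rat^o),
          [/\ lie_morphism_on grt grt_ell_hat Psi,
              forall psi : f2, grt1 psi -> Psi (psi, 0) = grt1ell_hat_incl (Phi psi),
              Psi (0, 1) = e22_hat
            & forall (q : int) (x : f2 * rat^o),
                grt x -> grt_degree q x -> grt_ell_hat_degm q (Psi x)]].
Proof.
have PhiE psi D : is_Dpsi psi D ->
    grt_to_ell psi = ell_hat_triple psi (fun s => D (x_hat s 1%N)).
  move=> /is_Dpsi_unique ->; congr ell_hat_triple.
  by apply: funext => s; rewrite u_psiE.
split=> [psi _|].
  exists (D_psi psi); split=> [|D /is_Dpsi_unique ->//]; exact: D_psiP.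
exists grt_to_ell; split.
- split=> [psi psiP n|a psi phi _ _|psi phi]; first by split; [apply: grt_to_ell_in|apply: grt_to_ell_degree].
    exact: grt_to_ell_linear.
  exact: grt_to_ell_bracket.
- by move=> psi D _; apply: PhiE.
- move=> Phi' _ PhiP' psi psiP.
  by rewrite (PhiE _ _ (D_psiP psi)) (PhiP' _ _ psiP (D_psiP psi)).
exists grt_to_ell_ext; split.
- exact: grt_to_ell_ext_morphism.
- by move=> psi _; apply: funext => n; rewrite /grt_to_ell_ext /= if_same.
- by apply: funext => n; rewrite /grt_to_ell_ext /= grt_to_ell0.
by move=> q x _; apply: grt_to_ell_ext_degm.
Qed.
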